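(* In the spiked model described in the context, suppose $\mathbf X$ is a rank $1$ matrix with singular value $t>\gamma^{1/4}$. Let $\widehat{\mathbf X}^{t}$ denote the singular value shrinkage denoiser with $q=t$, and let $\widehat{\mathbf X}^{q^*}$ denote the optimal singular value shrinker for operator norm loss, with $$q^*=t\sqrt{\frac{t^2+\min\{1,\gamma\}}{t^2+\max\{1,\gamma\}}}.$$ Then $$\frac{\mathcal L_\infty(q^* )}{\mathcal L_\infty(t)}=\lim_{n\to\infty}\frac{\|\mathbf X-\widehat{\mathbf X}^{q^*}\|_{\mathrm{op}}}{\|\mathbf X-\widehat{\mathbf X}^{t}\|_{\mathrm{op}}}=\sqrt{\frac{1+\min\{c,\tilde c\}}{1+\max\{c,\tilde c\}}},$$ where the limit holds almost surely as $p/n\to\gamma$.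
   Context: Model. For each $n$, with $p=p(n)$, one observes the $p\times n$ matrix $\mathbf Y=\mathbf X+\mathbf G$, where $\mathbf G$ has iid $N(0,1/n)$ entries and $\mathbf X=t\,\mathbf u\mathbf v^T$, with unit vectors $\mathbf u\in\mathbb R^p$, $\mathbf v\in\mathbb R^n$ (depending on $n$) and $t>0$ fixed, independent of $n$ and $p$. Both $n\to\infty$ and $p=p(n)\to\infty$, with $p(n)/n\to\gamma\in[0,\infty)$. Shrinkage. Let $\hat{\mathbf u},\hat{\mathbf v}$ be the top left and right singular vectors of $\mathbf Y$. For $q\in\mathbb R$ let $\widehat{\mathbf X}^{q}=q\,\hat{\mathbf u}\hat{\mathbf v}^T$. The asymptotic loss is the almost sure limit $\mathcal L_\infty(q)=\lim_{n\to\infty}\|\widehat{\mathbf X}^{q}-\mathbf X\|_{\mathrm{op}}$, which is well defined for each fixed $q$; $\|\cdot\|_{\mathrm{op}}$ is the operator (spectral) norm. For $t>\gamma^{1/4}$ the numbers $c,\tilde c\ge0$ are defined by $$c^2=\frac{1-\gamma/t^4}{1+\gamma/t^2},\qquad \tilde c^2=\frac{1-\gamma/t^4}{1+1/t^2};$$ they are the almost sure limits of $|\langle\hat{\mathbf u},\mathbf u\rangle|$ and $|\langle\hat{\mathbf v},\mathbf v\rangle|$. *)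

(* Defs.v *)
From HB Require Import structures.
From mathcomp Require Import all_boot all_order all_algebra.
From mathcomp Require Import all_classical all_reals all_analysis.

Set Implicit Arguments.
Unset Strict Implicit.
Unset Printing Implicit Defensive.

Import Order.TTheory GRing.Theory Num.Theory.
Import numFieldNormedType.Exports.

Local Open Scope classical_set_scope.
Local Open Scope ring_scope.

(* The library norm on matrices is the maximum of the entries, hence these
   Euclidean and spectral norms. *)
Definition l2norm (R : realType) (m : nat) (x : 'cV[R]_m) : R :=
  Num.sqrt (\sum_(i < m) x i 0 ^+ 2).

Definition opnorm (R : realType) (m n : nat) (A : 'M[R]_(m, n)) : R :=
  sup [set l2norm (A *m x) | x in [set x : 'cV[R]_n | l2norm x <= 1]].

Definition singular_triple (R : realType) (m n : nat) (A : 'M[R]_(m, n))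
    (s : R) (x : 'cV[R]_m) (y : 'cV[R]_n) : Prop :=
  [/\ 0 <= s, l2norm x = 1, l2norm y = 1,
      A *m y = s *: x & A^T *m x = s *: y].

(* x and y are determined only up to a common sign (when the top singular value
   is simple); x *m y^T does not depend on that sign. *)
Definition top_singular_vectors (R : realType) (m n : nat) (A : 'M[R]_(m, n))
    (x : 'cV[R]_m) (y : 'cV[R]_n) : Prop :=
  exists2 s, singular_triple A s x y
    & forall s' x' y', singular_triple A s' x' y' -> s' <= s.

Section probabilistic_notions.
Context (d : measure_display) (T : measurableType d) (R : realType)
        (P : probability T R).

Definition mutually_independent (I : finType) (X : I -> {RV P >-> R}) : Prop :=
  forall (J : {set I}) (B : I -> set R),
    (forall i, measurable (B i)) ->
    P (\bigcap_(i in [set` J]) (X i @^-1` B i)) =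
    (\prod_(i in J) P (X i @^-1` B i))%E.

(* Only the values on measurable sets are meaningful; the second parameter of
   normal_prob is the standard deviation, here s being the variance. *)
Definition normally_distributed (X : {RV P >-> R}) (m s : R) : Prop :=
  forall B : set R, measurable B ->
    distribution P X B = normal_prob m (Num.sqrt s) B.

Definition iid_normal_entries (m n : nat)
    (G : 'I_m -> 'I_n -> {RV P >-> R}) (s : R) : Prop :=
  mutually_independent (fun ij : 'I_m * 'I_n => G ij.1 ij.2) /\
  (forall i j, normally_distributed (G i j) 0 s).

Definition as_cvg (Z : nat -> T -> R) (l : R) : Prop :=
  {ae P, forall w, Z n w @[n --> \oo] --> l}.

(* The value is 0 when there is no almost sure limit. *)
Definition as_lim (Z : nat -> T -> R) : R := xget 0 [set l | as_cvg Z l].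

Lemma as_limE (Z : nat -> T -> R) (l : R) : as_cvg Z l -> as_lim Z = l.
Proof.
move=> Zl; have Zl' : as_cvg Z (as_lim Z).
  by rewrite /as_lim; apply: (@xgetPex _ 0 [set l | as_cvg Z l]); exists l.
suff [w [h1 h2]] : exists w, (Z n w @[n --> \oo] --> l) /\
    (Z n w @[n --> \oo] --> as_lim Z).
  exact: (@cvg_unique _ (@norm_hausdorff _ _) (Z n w @[n --> \oo])).
have FP : ProperFilter (almost_everywhere P).
  by apply: ae_properfilter_algebraOfSetsType; rewrite [X in (_ < X)%E]probability_setT lte01.
have /filter_ex[w wP] : {ae P, forall w, (Z n w @[n --> \oo] --> l) /\
    (Z n w @[n --> \oo] --> as_lim Z)}.
  by apply: filterS2 Zl Zl' => w.
by exists w.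
Qed.

End probabilistic_notions.

Section spiked_model.
Context (R : realType).

Definition signal (t : R) (m n : nat) (u : 'cV[R]_m) (v : 'cV[R]_n)
  : 'M[R]_(m, n) := t *: (u *m v^T).

Definition observation (d : measure_display) (T : measurableType d)
    (P : probability T R) (m n : nat) (X : 'M[R]_(m, n))
    (G : 'I_m -> 'I_n -> {RV P >-> R}) (w : T) : 'M[R]_(m, n) :=
  X + \matrix_(i, j) G i j w.

Definition shrinker (q : R) (m n : nat) (x : 'cV[R]_m) (y : 'cV[R]_n)
  : 'M[R]_(m, n) := q *: (x *m y^T).

Definition shrinkage_loss (T : Type) (p : nat -> nat)
    (X : forall n, 'M[R]_(p n, n))
    (uhat : forall n, T -> 'cV[R]_(p n)) (vhat : forall n, T -> 'cV[R]_n)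
    (q : R) (n : nat) (w : T) : R :=
  opnorm (shrinker q (uhat n w) (vhat n w) - X n).

Definition optimal_shrinkage (t gamma : R) : R :=
  t * Num.sqrt ((t ^+ 2 + Num.min 1 gamma) / (t ^+ 2 + Num.max 1 gamma)).

End spiked_model.

(* Main.v *)
Require Import Defs.
From HB Require Import structures.
From mathcomp Require Import all_boot all_order all_algebra.
From mathcomp Require Import all_classical all_reals all_analysis.
From mathcomp Require Import measurable_realfun ring lra.

Set Implicit Arguments.
Unset Strict Implicit.
Unset Printing Implicit Defensive.

Import Order.TTheory GRing.Theory Num.Theory.
Import numFieldNormedType.Exports.

Local Open Scope classical_set_scope.
Local Open Scope ring_scope.

(** Everything follows from the limits of the overlaps A = <uhat, u> and
    B = <vhat, v>, since the loss is the norm of a rank-two matrix, an explicit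
    function of A B, A^2 and B^2 (a root of a quadratic equation).

    In orthonormal bases starting with u and v, the noise reads
    G = [g, r^T; q, H] with g, q, r, H independent, H being again Gaussian.  The
    same step applies to H with the unit vectors q/|q| and r/|r|, and so on.  By
    Chernoff bounds for chi-square variables and Borel-Cantelli, almost surely for
    n large all the scalars g are small, |q| <= sqrt gamma + eps and |r| <= 1 + eps
    at all steps, and |q| >= sqrt gamma - eps and |r| >= 1 - eps at any fixed
    number of first steps.  Along this chain of vectors,
    2 x y <= m x^2 + y^2 / m at each step bounds x^T G y from above, for any two
    weights, by quadratic forms in |x|, |y|, <x, u> and <y, v>; test vectors with
    geometrically decaying coordinates along finitely many steps of the chain give
    a matching lower bound on the top singular value of Y.  The upper bound at
    x = uhat, y = vhat equals the limiting singular value minus a square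
    vanishing only for B = t mu A, and letting one weight vary around its optimum
    mu forces B^2 to converge to ctilde^2. *)

(** * Gaussian vectors *)

(** The two bounds on the top singular value are a primal and a dual problem. Along the chain the
    limiting noise form is the sum of x_k y_(k+1) + sqrt gamma x_(k+1) y_k, to which the spike adds
    t x_0 y_0. Its maximizer is geometric, x_(k+1) = nu y_k and y_(k+1) = mu x_k, and 2 x y <= m x^2
    + y^2 / m is an equality exactly at y = m x: the optimal weights are the decay ratios of the
    test vector. As |x| = |y| = 1, the tail of x has norm nu and that of y has norm mu, whence nu^2
    = 1 - c^2 and mu^2 = 1 - ctilde^2.

    Nothing is assumed about the measurability of uhat and vhat. Probability therefore enters only
    through events on G, u and v, on which the bounds hold for all x and y at once.

    Dimensions shrink along the chain. Upper bounds on |q| and |r| survive this down to the last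
    step, and the union over up to n steps is absorbed by the exponential rate; lower bounds fail
    near the end, so the test vectors stop at a fixed depth, beyond which their geometric decay
    makes the loss negligible. *)

Section normal.
Context {R : realType}.
Local Notation mu := (@lebesgue_measure R).
Local Open Scope ereal_scope.

Lemma lebesgue_measureD (a : R) (A : set (measurableTypeR R)) : measurable A ->
  mu ((fun x => x + a)%R @^-1` A) = mu A.
Proof.
move=> mA.
have mf : measurable_fun [set: measurableTypeR R]
    ((fun x => x + a)%R : measurableTypeR R -> measurableTypeR R).
  by apply: measurable_funD => //.
rewrite -/(pushforward mu ((fun x => x + a)%R : _ -> measurableTypeR R) A).
apply/esym/lebesgue_measure_unique => //= _ [[b c]] _ <-.
rewrite /pushforward (_ : _ @^-1` _ = `](b - a)%R, (c - a)%R]%classic).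
  rewrite !lebesgue_measure_itv/= !lte_fin ltrD2r.
  by case: ifPn => // _; rewrite !EFinN !EFinD; congr (_%:E); rewrite /=; ring.
by apply/seteqP; split => x /=; rewrite !in_itv/= ltrBlDr lerBrDr.
Qed.

(** The integral is taken against the Radon-Nikodym derivative, which agrees almost everywhere with
    [normal_pdf] because both have the same integral over every measurable set. *)
Lemma ge0_integral_normal_prob (s : R) (f : measurableTypeR R -> \bar R) :
  measurable_fun setT f -> (forall x, 0 <= f x) ->
  \int[normal_prob 0 s]_x f x = \int[mu]_x (f x * (normal_pdf 0 s x)%:E).
Proof.
move=> mf f0.
have dom := @normal_prob_dominates R 0%R s.
rewrite -(Radon_Nikodym_SigmaFinite.change_of_variables dom f0)//.
have mpdf : measurable_fun setT (EFin \o normal_pdf 0 s).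
  by apply/measurable_EFinP; exact: measurable_normal_pdf.
apply: ae_eq_integral => //.
- apply: emeasurable_funM => //.
  exact: measurable_int (Radon_Nikodym_SigmaFinite.f_integrable dom).
- exact: emeasurable_funM.
- apply: ae_eqe_mul2l.
  apply: integral_ae_eq => //.
  + exact: Radon_Nikodym_SigmaFinite.f_integrable.
  + by move=> E _ mE; rewrite -(Radon_Nikodym_SigmaFinite.f_integral dom).
Qed.

Local Notation R2 := (measurableTypeR R * measurableTypeR R)%type.

Lemma measurable_pairL (f : R2 -> R2) : measurable_fun setT (fst \o f) ->
  measurable_fun setT (snd \o f) -> measurable_fun setT f.
Proof. by move=> m1 m2; exact/measurable_fun_pairP. Qed.

Definition xshear (a : R) (z : R2) : R2 := (z.1 + a * z.2, z.2)%R.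
Definition yshear (a : R) (z : R2) : R2 := (z.1, z.2 + a * z.1)%R.

Lemma measurable_xshear a : measurable_fun setT (xshear a).
Proof.
apply: measurable_pairL => /=; last exact: measurable_snd.
apply: measurable_funD; first exact: measurable_fst.
by apply: measurable_funM => //; exact: measurable_snd.
Qed.

Lemma measurable_yshear a : measurable_fun setT (yshear a).
Proof.
apply: measurable_pairL => /=; first exact: measurable_fst.
apply: measurable_funD; first exact: measurable_snd.
by apply: measurable_funM => //; exact: measurable_fst.
Qed.

Lemma lebesgue2_yshear a (A : set R2) : measurable A ->
  (mu \x mu) (yshear a @^-1` A) = (mu \x mu) A.
Proof.
move=> mA; rewrite /product_measure1; apply: eq_integral => x _ /=.
rewrite -[RHS](lebesgue_measureD (a * x)); last exact: measurable_xsection.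
by congr (mu _); apply/seteqP; split => y /=; rewrite !xsectionE.
Qed.

Lemma product_measure12 (A : set R2) : measurable A ->
  (mu \x mu) A = (mu \x^ mu) A.
Proof.
by move=> mA; apply: product_measure_unique => //= B C mB mC; rewrite product_measure2E.
Qed.

(** The other iterated integral is needed here: this shear translates each horizontal section,
    whereas [\x] is defined by the vertical ones. *)
Lemma lebesgue2_xshear a (A : set R2) : measurable A ->
  (mu \x mu) (xshear a @^-1` A) = (mu \x mu) A.
Proof.
move=> mA; have mB : measurable (xshear a @^-1` A).
  by rewrite -[X in measurable X]setTI; exact: measurable_xshear.
rewrite (product_measure12 mA) (product_measure12 mB).
rewrite /product_measure2; apply: eq_integral => y _ /=.
rewrite -[RHS](lebesgue_measureD (a * y)); last exact: measurable_ysection.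
by congr (mu _); apply/seteqP; split => x /=; rewrite !ysectionE.
Qed.

Lemma ge0_integral_invariant (f : R2 -> R2) (g : R2 -> \bar R) :
  measurable_fun setT f ->
  (forall A, measurable A -> (mu \x mu) (f @^-1` A) = (mu \x mu) A) ->
  measurable_fun setT g -> (forall z, 0 <= g z) ->
  \int[mu \x mu]_z g (f z) = \int[mu \x mu]_z g z.
Proof.
move=> mf fE mg g0.
transitivity (\int[pushforward (mu \x mu) f]_z g z).
  by rewrite ge0_integral_pushforward.
by apply: eq_measure_integral => A mA _; exact: fE.
Qed.

Definition rot (c s : R) (z : R2) : R2 :=
  (c * z.1 + s * z.2, - s * z.1 + c * z.2)%R.

Lemma measurable_rot c s : measurable_fun setT (rot c s).
Proof.
apply: measurable_pairL => /=; apply: measurable_funD; apply: measurable_funM => //;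
  (exact: measurable_fst || exact: measurable_snd).
Qed.

(* A factorization into shears, which preserve Lebesgue measure by Fubini and
   translation invariance: no change of variables formula is needed. *)
Lemma rotE (c s : R) (z : R2) : (c ^+ 2 + s ^+ 2 = 1)%R -> (c != -1)%R ->
  rot c s z = xshear (s / (1 + c)) (yshear (- s) (xshear (s / (1 + c)) z)).
Proof.
case: z => x y cs c1.
have c1' : (1 + c != 0)%R by rewrite addrC addr_eq0.
rewrite /rot /xshear /yshear/=; set t := (s / (1 + c))%R.
have t1 : (t * (1 + c) - s = 0)%R by rewrite divfK// subrr.
have ts : (t * s - (1 - c) = 0)%R.
  by rewrite /t mulrAC -expr2 (_ : s ^+ 2 = (1 - c) * (1 + c))%R;
    [rewrite mulfK// subrr|rewrite mulrBl !mul1r mulrDr mulr1 -cs; ring].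
congr (_, _); apply/eqP; rewrite -subr_eq0; apply/eqP.
- transitivity ((t * s - (1 - c)) * (x + t * y) - (t * (1 + c) - s) * y)%R.
    by ring.
  by rewrite ts t1 !mul0r subrr.
- transitivity ((t * s - (1 - c)) * y)%R; first by ring.
  by rewrite ts mul0r.
Qed.

Lemma ge0_integral_rot c s (g : R2 -> \bar R) :
  (c ^+ 2 + s ^+ 2 = 1)%R -> (c != -1)%R ->
  measurable_fun setT g -> (forall z, 0 <= g z) ->
  \int[mu \x mu]_z g (rot c s z) = \int[mu \x mu]_z g z.
Proof.
move=> cs c1 mg g0.
under eq_integral do rewrite rotE//.
rewrite (@ge0_integral_invariant (xshear (s / (1 + c)))
  (fun z => g (xshear (s / (1 + c)) (yshear (- s) z)))) //; last 3 first.
- exact: measurable_xshear.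
- exact: lebesgue2_xshear.
- apply: measurableT_comp => //; apply: measurableT_comp; first exact: measurable_xshear.
  exact: measurable_yshear.
rewrite (@ge0_integral_invariant (yshear (- s))
  (fun z => g (xshear (s / (1 + c)) z))) //; last 3 first.
- exact: measurable_yshear.
- exact: lebesgue2_yshear.
- by apply: measurableT_comp => //; exact: measurable_xshear.
by apply: ge0_integral_invariant => //; [exact: measurable_xshear|exact: lebesgue2_xshear].
Qed.

Lemma normal_prodE (s : R) (A : set R2) : measurable A ->
  (normal_prob 0 s \x normal_prob 0 s) A =
  \int[mu \x mu]_z ((\1_A z)%:E * (normal_pdf 0 s z.1 * normal_pdf 0 s z.2)%:E).
Proof.
move=> mA.
have mp : measurable_fun setT (normal_pdf 0 s) by exact: measurable_normal_pdf.
rewrite fubini_tonelli1//=; last 2 first.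
- apply: emeasurable_funM; apply/measurable_EFinP.
    exact: measurable_indic.
  by apply: measurable_funM; apply: (measurableT_comp mp).
- by move=> z; rewrite mule_ge0// lee_fin// mulr_ge0// normal_pdf_ge0.
rewrite /product_measure1 ge0_integral_normal_prob//; last first.
  exact: measurable_fun_xsection.
apply: eq_integral => x _; rewrite /fubini_F/=.
transitivity (\int[mu]_y ((normal_pdf 0 s x)%:E *
    ((\1_(xsection A x) y)%:E * (normal_pdf 0 s y)%:E))); last first.
  apply: eq_integral => y _; rewrite EFinM muleCA; congr (_ * (_ * _)).
  by rewrite !indicE/= mem_xsection.
rewrite ge0_integralZl//; last 3 first.
- apply: emeasurable_funM; apply/measurable_EFinP => //.
  exact/measurable_indic/measurable_xsection.
- by move=> y _; rewrite mule_ge0// lee_fin// normal_pdf_ge0.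
- by rewrite lee_fin normal_pdf_ge0.
rewrite muleC; congr (_ * _).
rewrite /normal_prob [LHS]integral_mkcond; apply: eq_integral => y _.
by rewrite patchE indicE; case: ifPn => _; rewrite ?mul1e ?mul0e.
Qed.

(** The product density is a function of z.1^2 + z.2^2, which [rot] preserves along with Lebesgue
    measure. The restriction on [c] comes from the half-angle tangent s / (1 + c) in [rotE]. *)
Lemma normal_prod_rot (sd c s : R) (A : set R2) :
  sd != 0%R -> (c ^+ 2 + s ^+ 2 = 1)%R -> c != (- 1)%R -> measurable A ->
  (normal_prob 0 sd \x normal_prob 0 sd) (rot c s @^-1` A) =
  (normal_prob 0 sd \x normal_prob 0 sd) A.
Proof.
move=> sd0 cs c1 mA; rewrite !normal_prodE//; last first.
  by rewrite -[X in measurable X]setTI; exact: measurable_rot.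
have mp : measurable_fun setT (normal_pdf 0 sd) by exact: measurable_normal_pdf.
pose g (z : R2) := (\1_A z)%:E * (normal_pdf 0 sd z.1 * normal_pdf 0 sd z.2)%:E.
apply: etrans (@ge0_integral_rot c s g cs c1 _ _); rewrite /g.
- apply: eq_integral => z _; congr (_ * _%:E).
  rewrite !normal_pdfE// mulrACA [RHS]mulrACA; congr (_ * _)%R.
  rewrite /normal_fun -!expRD; congr expR.
  rewrite !subr0 /= -!mulrDl; congr (_ / _)%R; rewrite -!opprD; congr (- _)%R.
  have -> : ((c * z.1 + s * z.2) ^+ 2 + (- s * z.1 + c * z.2) ^+ 2 =
    (c ^+ 2 + s ^+ 2) * (z.1 ^+ 2 + z.2 ^+ 2))%R by ring.
  by rewrite cs mul1r.
- apply: emeasurable_funM; apply/measurable_EFinP.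
    exact: measurable_indic.
  by apply: measurable_funM; apply: (measurableT_comp mp).
- by move=> z; rewrite mule_ge0// lee_fin// mulr_ge0// normal_pdf_ge0.
Qed.

(** Plane rotations have determinant 1; reflections also require the sign symmetry of a single
    coordinate. *)
Lemma normal_probN (s : R) (A : set (measurableTypeR R)) : s != 0%R -> measurable A ->
  normal_prob 0 s ((-%R : _ -> measurableTypeR R) @^-1` A) = normal_prob 0 s A.
Proof.
move=> s0 mA; rewrite /normal_prob.
have mp : measurable_fun setT (normal_pdf 0 s) by exact: measurable_normal_pdf.
have mN : measurable_fun [set: measurableTypeR R] (-%R : _ -> measurableTypeR R).
  exact: oppr_measurable.
transitivity (\int[pushforward mu (-%R : _ -> measurableTypeR R)]_(x in A) (normal_pdf 0 s x)%:E).
  apply/esym; apply: etrans (ge0_integral_pushforward mN mu mA _ _) _.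
  - by apply/measurable_EFinP; exact: measurable_funTS.
  - by move=> y _; rewrite lee_fin normal_pdf_ge0.
  apply: eq_integral => x _ /=; rewrite !normal_pdfE//; congr (_ * _)%:E.
  by rewrite /normal_fun !subr0 sqrrN.
by apply: eq_measure_integral => B mB _; exact: lebesgue_measureN.
Qed.

End normal.

(** * Finite families of independent centered Gaussian variables *)

Section iid_normal.
Context {R : realType}.
Local Open Scope ereal_scope.

(* Here s is the standard deviation. *)
Definition iid_normal d (T : measurableType d) (P : probability T R) (s : R)
    (I : finType) (X : I -> T -> R) : Prop :=
  (forall i, measurable_fun setT (X i)) /\
  forall B : I -> set R, (forall i, measurable (B i)) ->
    P [set w | forall i, B i (X i w)] = \prod_(i : I) normal_prob 0 s (B i).

(** A pi-system: a law on [I -> R] is determined by its values on boxes, and these are all that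
    [iid_normal] prescribes. *)
Definition boxes (I : Type) : set (set (I -> R)) :=
  [set A | exists2 B : I -> set R, (forall i, measurable (B i)) &
     A = [set x | forall i, B i (x i)]].

Lemma measurable_box d (T : measurableType d) (I : finType) (X : I -> T -> R)
    (B : I -> set R) :
  (forall i, measurable_fun setT (X i)) -> (forall i, measurable (B i)) ->
  measurable [set w | forall i, B i (X i w)].
Proof.
move=> mX mB.
rewrite (_ : [set w | _] = \bigcap_(i in [set: I]) (X i @^-1` B i)); last first.
  by apply/seteqP; split=> [w Bw i _|w Bw i]; [exact: Bw|exact: (Bw i Logic.I)].
apply: fin_bigcap_measurable => // i _.
by rewrite -[X in measurable X]setTI; exact: mX.
Qed.

Local Notation cube I := (g_sigma_algebraType (@boxes I)).

Lemma measurable_coord (I : finType) (i : I) :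
  measurable_fun [set: cube I] (fun x => x i).
Proof.
move=> _ B mB; rewrite setTI; apply: sub_sigma_algebra.
exists (fun j => if j == i then B else setT); first by move=> j; case: ifP.
apply/seteqP; split => x /= => [Bx j|/(_ i)]; last by rewrite eqxx.
by case: eqP => // ->.
Qed.

Lemma measurable_to_cube d (T : measurableType d) (I : finType) (X : I -> T -> R) :
  (forall i, measurable_fun setT (X i)) ->
  measurable_fun setT (fun w => (X ^~ w : cube I)).
Proof.
move=> mX; apply: (@measurability _ _ T (cube I) setT _ (@boxes I)) => //.
move=> _ [_ [B mB ->]] <-; rewrite setTI.
exact: measurable_box.
Qed.

(** Uniqueness of measures on the pi-system of boxes. It moves an event to any other probability
    space carrying such a family, in particular to a product space. *)
Lemma iid_normal_law d (T : measurableType d) (P : probability T R)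
    d' (T' : measurableType d') (P' : probability T' R) (s : R) (I : finType)
    (X : I -> T -> R) (X' : I -> T' -> R) :
  iid_normal P s X -> iid_normal P' s X' ->
  forall A : set (cube I), measurable A ->
  P [set w | A (X ^~ w)] = P' [set w | A (X' ^~ w)].
Proof.
move=> [mX PX] [mX' PX'] A mA.
have mY := measurable_to_cube mX; have mY' := measurable_to_cube mX'.
pose p1 := pushforward P (fun w => (X ^~ w : cube I)).
pose p2 := pushforward P' (fun w => (X' ^~ w : cube I)).
have boxT : boxes ([set: I -> R]).
  by exists (fun=> setT) => //; apply/seteqP; split.
apply: (@g_sigma_algebra_measure_unique _ R (cube I) (@boxes I) _ (fun=> setT)
  _ _ p1 p2) => //.
- exact: sub_sigma_algebra.
- by rewrite bigcup_const.
- move=> _ _ [B mB ->] [C mC ->]; exists (fun i => B i `&` C i).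
    by move=> i; exact: measurableI.
  by apply/seteqP; split => x /= => [[Bx Cx] i|BCx]; split=> // i; have [] := BCx i.
- by move=> _ [B mB ->]; exact: etrans (PX _ mB) (esym (PX' _ mB)).
- by move=> k; apply: (@le_lt_trans _ _ 1); [rewrite -(probability_setT P)|exact: ltry].
Qed.

(** The product space supplies an independent copy for the coordinates outside of [S], without
    changing the joint law. *)
Lemma iid_normal_split d (T : measurableType d) (P : probability T R) (s : R)
    (I : finType) (S : pred I) (X : I -> T -> R) :
  iid_normal P s X ->
  iid_normal (P \x P) s (fun i (w : T * T) => if S i then X i w.1 else X i w.2).
Proof.
move=> [mX PX]; split.
  by move=> i; case: (S i); apply: measurableT_comp => //.
move=> B mB.
pose B1 i := if S i then B i else setT.
pose B2 i := if S i then setT else B i.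
have mB1 i : measurable (B1 i) by rewrite /B1; case: ifP.
have mB2 i : measurable (B2 i) by rewrite /B2; case: ifP.
rewrite (_ : [set w | _] = [set w | forall i, B1 i (X i w)] `*`
    [set w | forall i, B2 i (X i w)]); last first.
  apply/seteqP; split => [[w1 w2]/= Bw|[w1 w2]/= [Bw1 Bw2] i].
    by split=> i; have := Bw i; rewrite /B1 /B2; case: ifP.
  by have := Bw1 i; have := Bw2 i; rewrite /B1 /B2; case: ifP.
apply: etrans (product_measure1E _ _ _ _) _; [exact: measurable_box..|].
apply: etrans (congr2 mule (PX _ mB1) (PX _ mB2)) _.
rewrite -big_split/=; apply: eq_bigr => i _; rewrite /B1 /B2.
by case: ifP => _; rewrite probability_setT ?mule1 ?mul1e.
Qed.

(* Resampling the coordinates outside of S replaces conditioning on those of S. *)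
Lemma iid_normal_decouple d (T : measurableType d) (P : probability T R) (s : R)
    (I : finType) (S : pred I) (X : I -> T -> R) (A : set (cube I)) :
  iid_normal P s X -> measurable A ->
  P [set w | A (X ^~ w)] =
  \int[P]_w1 P [set w2 | A (fun i => if S i then X i w1 else X i w2)].
Proof.
move=> PX mA; rewrite (iid_normal_law PX (iid_normal_split S PX) mA).
rewrite /product_measure1; apply: eq_integral => w _ /=; congr (P _).
by apply/seteqP; split => w' /=; rewrite xsectionE.
Qed.

Lemma iid_normal_decouple_le d (T : measurableType d) (P : probability T R) (s : R)
    (I : finType) (S : pred I) (X : I -> T -> R) (A : set (cube I)) (b : \bar R) :
  iid_normal P s X -> measurable A ->
  (forall w1, P [set w2 | A (fun i => if S i then X i w1 else X i w2)] <= b) ->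
  P [set w | A (X ^~ w)] <= b.
Proof.
move=> PX mA Ab; rewrite (iid_normal_decouple S PX mA).
have b0 : 0 <= b by apply: le_trans (Ab point).
rewrite -[leRHS]mule1 -(probability_setT P) -integral_cst//.
apply: ge0_le_integral => //.
have mB : measurable [set w : T * T | A (fun i => if S i then X i w.1 else X i w.2)].
  have [m2 _] := iid_normal_split S PX.
  have := measurable_to_cube m2; move=> /(_ measurableT _ mA).
  by rewrite setTI.
apply: eq_measurable_fun (measurable_fun_xsection P mB) => w _ /=; congr (P _).
by apply/seteqP; split => w' /=; rewrite xsectionE.
Qed.

Lemma sub_iid_normal d (T : measurableType d) (P : probability T R) (s : R)
    (I J : finType) (f : J -> I) (X : I -> T -> R) : injective f ->
  iid_normal P s X -> iid_normal P s (fun j => X (f j)).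
Proof.
move=> fI [mX PX]; split=> // B mB.
(* Coordinates outside the range of [f] are left unconstrained and contribute a factor 1. *)
pose C i := if [pick j | f j == i] is Some j then B j else setT.
have Cf j : C (f j) = B j.
  rewrite /C; case: pickP => [k /eqP/fI->//|/(_ j)]; by rewrite eqxx.
have mC i : measurable (C i) by rewrite /C; case: pickP.
rewrite (_ : [set w | _] = [set w | forall i, C i (X i w)]); last first.
  apply/seteqP; split => w /= Bw.
    by move=> i; rewrite /C; case: pickP => // j /eqP <-.
  by move=> j; rewrite -Cf.
rewrite PX// (bigID (fun i => i \in codom f))/= [X in _ * X]big1 ?mule1; last first.
  move=> i; rewrite /C; case: pickP => [j /eqP <-|_ _]; last exact: probability_setT.
  by rewrite codom_f.
rewrite -big_uniq/=; last by rewrite map_inj_uniq// enum_uniq.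
by rewrite big_image/=; apply: eq_bigr => j _; rewrite Cf.
Qed.

End iid_normal.

(** * Invariance under plane rotations and sign changes *)

Section rotation.
Context {R : realType} d (T : measurableType d) (P : probability T R).
Variables (s : R) (s0 : s != 0).
Local Open Scope ereal_scope.
Local Notation N := (normal_prob 0 s).
Local Notation cube I := (g_sigma_algebraType (@boxes R I)).

Lemma iid_normal_pair (I : finType) (X : I -> T -> R) (a b : I)
    (D : set (measurableTypeR R * measurableTypeR R)) :
  a != b -> iid_normal P s X -> measurable D ->
  P [set w | D (X a w, X b w)] = (N \x N) D.
Proof.
move=> ab [mX PX] mD.
have mab : measurable_fun setT
    (fun w => (X a w, X b w) : measurableTypeR R * measurableTypeR R).
  by apply/measurable_fun_pairP; split; exact: mX.
pose m' := pushforward P (fun w => (X a w, X b w) : measurableTypeR R * measurableTypeR R).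
rewrite -[LHS]/(m' D).
apply/esym; apply: (@product_measure_unique _ _ _ _ R N N m') => //= A B mA mB.
pose C i := if i == a then A else if i == b then B else setT.
have mC i : measurable (C i) by rewrite /C; case: ifP => //; case: ifP.
transitivity (P [set w | forall i, C i (X i w)]).
  congr (P _); apply/seteqP; split => w /=.
    by move=> [Aw Bw] i; rewrite /C; case: eqP => [->//|_]; case: eqP => [->|].
  move=> Cw; split; have := Cw a; have := Cw b; rewrite /C !eqxx//.
  by rewrite eq_sym (negbTE ab).
rewrite (PX _ mC) (bigD1 a)//= (bigD1 b)/=; last by rewrite eq_sym.
rewrite big1 ?mule1 /C ?eqxx ?[b == a]eq_sym ?(negbTE ab)//.
by move=> i /andP[/negbTE-> /negbTE->]; exact: probability_setT.
Qed.

(** Reading [a] and [b] on one copy and the other coordinates on an independent one turns the event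
    into a product, whose first factor only concerns a planar Gaussian pair. *)
Lemma iid_normal_rot (I : finType) (X : I -> T -> R) (a b : I) (c t : R) :
  a != b -> (c ^+ 2 + t ^+ 2 = 1)%R -> (c != -1)%R -> iid_normal P s X ->
  iid_normal P s (fun i w => if i == a then c * X a w + t * X b w else
    if i == b then - t * X a w + c * X b w else X i w)%R.
Proof.
move=> ab ct c1 PX; have [mX _] := PX; split.
  by move=> i; case: eqP => _; [|case: eqP => _ //]; apply: measurable_funD;
    apply: measurable_funM.
move=> B mB.
pose A := [set x : cube I | forall i, B i (if i == a then c * x a + t * x b else
    if i == b then - t * x a + c * x b else x i)%R].
have mA : measurable A.
  apply: (measurable_box (T := cube I)
    (X := fun i (x : cube I) => if i == a then c * x a + t * x b else
    if i == b then - t * x a + c * x b else x i)%R) => //.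
  move=> i; case: eqP => _; last case: eqP => _; try exact: measurable_coord;
  by apply: measurable_funD; apply: measurable_funM => //; exact: measurable_coord.
pose S i := (i == a) || (i == b).
pose D : set (measurableTypeR R * measurableTypeR R) := rot c t @^-1` (B a `*` B b).
have mBB : measurable (B a `*` B b) by exact: measurableX.
have mD : measurable D.
  by rewrite -[D]setTI; apply: (measurable_rot c t).
pose C i := if S i then setT else B i.
have mC i : measurable (C i) by rewrite /C; case: ifP.
transitivity (P [set w | D (X a w, X b w)] * P [set w | forall i, C i (X i w)]).
  rewrite (iid_normal_law PX (iid_normal_split S PX) mA).
  apply: etrans (product_measure1E P P _ _); last exact: measurable_box.
    congr ((P \x P) _); apply/seteqP; split => -[w1 w2] /=.
      move=> Aw; split.
        by have := Aw a; have := Aw b; rewrite /S !eqxx orbT eq_sym (negbTE ab).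
      by move=> i; have := Aw i; rewrite /C /S; case: eqP => //= _; case: eqP.
    move=> [[Ba Bb] Cw i]; rewrite /S !eqxx ?orbT.
    case: eqP => [->//|ia]; case: eqP => [->//|ib].
    by have := Cw i; rewrite /C /S; case: eqP => //=; case: eqP.
  have mab : measurable_fun setT
      (fun w => (X a w, X b w) : measurableTypeR R * measurableTypeR R).
    by apply/measurable_fun_pairP; split; exact: mX.
  by have := mab measurableT _ mD; rewrite setTI.
rewrite (iid_normal_pair ab PX mD) (normal_prod_rot s0 ct c1 mBB).
rewrite product_measure1E; [|exact: mB..].
apply: etrans (congr1 (mule (N (B a) * N (B b))) (proj2 PX _ mC)) _.
rewrite [RHS](bigD1 a)//= [in RHS](bigD1 b)/=; last by rewrite eq_sym.
rewrite muleA; congr (_ * _).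
rewrite (bigD1 a)//= (bigD1 b)/=; last by rewrite eq_sym.
rewrite /C /S !eqxx orbT !probability_setT !mul1e.
by apply: eq_bigr => i /andP[/negbTE-> /negbTE->].
Qed.

Lemma iid_normal_flip (I : finType) (X : I -> T -> R) (D : pred I) :
  iid_normal P s X ->
  iid_normal P s (fun i w => if D i then - X i w else X i w)%R.
Proof.
move=> [mX PX]; split.
  by move=> i; case: (D i) => //; exact: measurable_funN.
move=> B mB.
pose C i : set R :=
  if D i then (-%R : _ -> measurableTypeR R) @^-1` (B i) else B i.
have mC i : measurable (C i).
  rewrite /C; case: ifP => // _; rewrite -[X in measurable X]setTI.
  exact: oppr_measurable.
have -> : [set w | forall i, B i (if D i then - X i w else X i w)%R] =
    [set w | forall i, C i (X i w)].
  by apply/seteqP; split => w /= Bw i; have := Bw i; rewrite /C; case: ifP.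
apply: etrans (PX _ mC) _; apply: eq_bigr => i _; rewrite /C; case: ifP => // _.
exact: (normal_probN s0 (mB i)).
Qed.

Definition gauss_mx p n (G : T -> 'M[R]_(p, n)) : Prop :=
  iid_normal P s (fun (ij : 'I_p * 'I_n) w => G w ij.1 ij.2).

Lemma gauss_mx_tr p n (G : T -> 'M[R]_(p, n)) :
  gauss_mx G -> gauss_mx (fun w => (G w)^T).
Proof.
move=> /(@sub_iid_normal _ _ _ _ _ _ _ (fun ij : 'I_n * 'I_p => (ij.2, ij.1))) H.
have /H : injective (fun ij : 'I_n * 'I_p => (ij.2, ij.1)) by move=> [i j] [k l] /= [-> ->].
by congr (iid_normal _ _ _); apply/funext => ij; apply/funext => w; rewrite mxE.
Qed.

(** Only deterministic [K] are considered; random directions are reduced to them by decoupling. All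
    widths [n] are allowed so that the property is about [K] alone and passes to products. *)
Definition left_invariant p (K : 'M[R]_p) : Prop := forall n (G : T -> 'M[R]_(p, n)),
  gauss_mx G -> gauss_mx (fun w => K *m G w).

Lemma left_invariant1 p : @left_invariant p 1%:M.
Proof. by move=> n G; congr gauss_mx; apply/funext => w; rewrite mul1mx. Qed.

Lemma left_invariantM p (K L : 'M[R]_p) :
  left_invariant K -> left_invariant L -> left_invariant (K *m L).
Proof.
move=> HK HL n G /HL/HK; congr gauss_mx.
by apply/funext => w; rewrite mulmxA.
Qed.

Definition flip_mx p (a : 'I_p) : 'M[R]_p := (1%:M - delta_mx a a *+ 2)%R.

Lemma flip_mxE p n (a : 'I_p) (G : 'M[R]_(p, n)) i j :
  (flip_mx a *m G) i j = (if i == a then - G i j else G i j)%R.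
Proof.
rewrite /flip_mx mulr2n mulmxBl mul1mx mulmxDl !mxE (bigD1 a)//= big1 ?addr0; last first.
  by move=> k ka; rewrite !mxE (negbTE ka) andbF mul0r.
rewrite !mxE eqxx andbT; case: eqP => [->|_] /=; first by rewrite mul1r; ring.
by rewrite mul0r; ring.
Qed.

Lemma left_invariant_flip p (a : 'I_p) : left_invariant (flip_mx a).
Proof.
move=> n G /(@iid_normal_flip _ _ (fun ij : 'I_p * 'I_n => ij.1 == a)).
congr (iid_normal _ _ _); apply/funext => -[i j]; apply/funext => w /=.
by rewrite flip_mxE.
Qed.

Definition givens p (a b : 'I_p) (c t : R) : 'M[R]_p :=
  \matrix_(i, j) (if i == a then (if j == a then c else if j == b then t else 0)
    else if i == b then (if j == a then - t else if j == b then c else 0)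
    else (i == j)%:R)%R.

Lemma givensE p n (a b : 'I_p) (c t : R) (G : 'M[R]_(p, n)) i j : a != b ->
  (givens a b c t *m G) i j = (if i == a then c * G a j + t * G b j
    else if i == b then - t * G a j + c * G b j else G i j)%R.
Proof.
move=> ab; rewrite mxE; have ba : (b == a) = false by rewrite eq_sym (negbTE ab).
case: (eqVneq i a) => [->|ia]; [|case: (eqVneq i b) => [->|ib]].
- rewrite (bigD1 a)//= (bigD1 b)/= ?ba// !mxE !eqxx ba big1 ?addr0//.
  by move=> k /andP[/negbTE ka /negbTE kb]; rewrite mxE eqxx ka kb mul0r.
- rewrite (bigD1 a)//= (bigD1 b)/= ?ba// !mxE !eqxx ba big1 ?addr0//.
  by move=> k /andP[/negbTE ka /negbTE kb]; rewrite mxE eqxx ba ka kb mul0r.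
- rewrite (bigD1 i)//= !mxE (negbTE ia) (negbTE ib) eqxx mul1r big1 ?addr0//.
  by move=> k /negbTE ki; rewrite mxE (negbTE ia) (negbTE ib) eq_sym ki mul0r.
Qed.

Lemma givens_tr p (a b : 'I_p) (c t : R) : a != b ->
  ((givens a b c t)^T = givens a b c (- t))%R.
Proof.
move=> ab; apply/matrixP => i j; rewrite !mxE opprK.
have ba : (b == a) = false by rewrite eq_sym (negbTE ab).
have [ia|ia] := @eqP _ i a; have [ja|ja] := @eqP _ j a; subst; rewrite ?eqxx//.
- by case: (j =P b) => // _; case: eqP => // /esym/ja.
- by case: (i =P b) => // _; case: eqP => // /ia.
- case: (i =P b) => ib; case: (j =P b) => jb; subst; rewrite ?eqxx//.
  + by case: eqP => // /jb.
  + by case: eqP => // /ib.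
  + by rewrite eq_sym.
Qed.

Lemma givens_orth p (a b : 'I_p) (c t : R) : a != b -> (c ^+ 2 + t ^+ 2 = 1)%R ->
  ((givens a b c t)^T *m givens a b c t = 1%:M)%R.
Proof.
move=> ab ct; have ba : (b == a) = false by rewrite eq_sym (negbTE ab).
rewrite givens_tr//; apply/matrixP => i j; rewrite givensE// !mxE ba !eqxx.
case: (i =P a) => ia; [|case: (i =P b) => ib]; subst => //.
- case: (j =P a) => ja; first by subst; rewrite eqxx mulr1n -ct; ring.
  have -> : (a == j) = false by apply/eqP => /esym.
  by case: (j == b); rewrite /= mulr0n; ring.
- case: (j =P b) => jb; first by subst; rewrite ba eqxx mulr1n -ct; ring.
  have -> : (b == j) = false by apply/eqP => /esym.
  by case: (j == a); rewrite /= mulr0n; ring.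
Qed.

Lemma left_invariant_givens p (a b : 'I_p) (c t : R) : a != b ->
  (c ^+ 2 + t ^+ 2 = 1)%R -> (c != -1)%R -> left_invariant (givens a b c t).
Proof.
move=> ab ct c1 n G HG.
have ba : (b == a) = false by rewrite eq_sym (negbTE ab).
(* The list [l] records the columns already rotated; each application of [iid_normal_rot] treats the
   two relevant entries of one column. *)
suff H (l : seq 'I_n) : uniq l -> iid_normal P s (fun (ij : 'I_p * 'I_n) w =>
    if ij.2 \in l then (givens a b c t *m G w) ij.1 ij.2 else G w ij.1 ij.2).
  have := H _ (enum_uniq 'I_n); congr (iid_normal _ _ _).
  by apply/funext => ij; apply/funext => w; rewrite mem_enum.
elim: l => [_//|j0 l IH /= /andP[j0l ul]].
have abj : (a, j0) != (b, j0) by rewrite xpair_eqE eqxx andbT.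
have := iid_normal_rot abj ct c1 (IH ul); congr (iid_normal _ _ _).
apply/funext => -[i j]; apply/funext => w /=; rewrite !xpair_eqE inE (negbTE j0l).
case: (eqVneq j j0) => [->|jj0] /=; last by rewrite !andbF.
by rewrite !andbT (negbTE j0l) givensE.
Qed.

End rotation.

(** * Orthogonal invariance *)

Section euclid.
Context {R : realType}.
Implicit Types p n : nat.

Definition dotv p (x y : 'cV[R]_p) : R := (x^T *m y) 0 0.

Lemma dotvE p (x y : 'cV[R]_p) : dotv x y = \sum_i x i 0 * y i 0.
Proof. by rewrite /dotv mxE; apply: eq_bigr => i _; rewrite mxE. Qed.

Lemma dotvC p (x y : 'cV[R]_p) : dotv x y = dotv y x.
Proof. by rewrite !dotvE; apply: eq_bigr => i _; rewrite mulrC. Qed.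

Lemma dotvDl p (x y z : 'cV[R]_p) : dotv (x + y) z = dotv x z + dotv y z.
Proof. by rewrite /dotv linearD/= mulmxDl mxE. Qed.

Lemma dotvNl p (x z : 'cV[R]_p) : dotv (- x) z = - dotv x z.
Proof. by rewrite /dotv linearN/= mulNmx mxE. Qed.

Lemma dotvZl p a (x z : 'cV[R]_p) : dotv (a *: x) z = a * dotv x z.
Proof. by rewrite /dotv linearZ/= -scalemxAl mxE. Qed.

Lemma dotvDr p (x y z : 'cV[R]_p) : dotv z (x + y) = dotv z x + dotv z y.
Proof. by rewrite dotvC dotvDl !(dotvC z). Qed.

Lemma dotvNr p (x z : 'cV[R]_p) : dotv z (- x) = - dotv z x.
Proof. by rewrite dotvC dotvNl dotvC. Qed.

Lemma dotvZr p a (x z : 'cV[R]_p) : dotv z (a *: x) = a * dotv z x.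
Proof. by rewrite dotvC dotvZl dotvC. Qed.

Lemma dotv_mulmx p n (A : 'M[R]_(p, n)) (x : 'cV[R]_p) (y : 'cV[R]_n) :
  dotv x (A *m y) = dotv (A^T *m x) y.
Proof. by rewrite /dotv trmx_mul trmxK mulmxA. Qed.

Lemma dotvv_ge0 p (x : 'cV[R]_p) : 0 <= dotv x x.
Proof. by rewrite dotvE sumr_ge0// => i _; rewrite -expr2 sqr_ge0. Qed.

Lemma dotvv_eq0 p (x : 'cV[R]_p) : (dotv x x == 0) = (x == 0).
Proof.
apply/idP/eqP => [|->]; last by rewrite /dotv mulmx0 mxE.
rewrite dotvE psumr_eq0 => [/allP x0|i _]; last by rewrite -expr2 sqr_ge0.
apply/colP => i; rewrite mxE; apply/eqP.
by have /implyP/(_ isT) := x0 i (mem_index_enum i); rewrite mulf_eq0 orbb.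
Qed.

Lemma l2normE p (x : 'cV[R]_p) : l2norm x = Num.sqrt (dotv x x).
Proof. by rewrite /l2norm dotvE; congr Num.sqrt; apply: eq_bigr => i _; rewrite expr2. Qed.

Lemma l2norm_ge0 p (x : 'cV[R]_p) : 0 <= l2norm x.
Proof. exact: sqrtr_ge0. Qed.

Lemma sqr_l2norm p (x : 'cV[R]_p) : l2norm x ^+ 2 = dotv x x.
Proof. by rewrite l2normE sqr_sqrtr// dotvv_ge0. Qed.

Lemma l2norm_eq1 p (x : 'cV[R]_p) : l2norm x = 1 <-> dotv x x = 1.
Proof.
rewrite -sqr_l2norm; split => [->|/eqP]; first by rewrite expr1n.
by rewrite sqrp_eq1 ?l2norm_ge0// => /eqP.
Qed.

Lemma dotv_CS p (x y : 'cV[R]_p) : dotv x y ^+ 2 <= dotv x x * dotv y y.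
Proof.
have [->|y0] := eqVneq y 0; first by rewrite /dotv !mulmx0 mxE expr0n mulr0.
have yy : 0 < dotv y y by rewrite lt_def dotvv_eq0 y0 dotvv_ge0.
have := dotvv_ge0 (dotv y y *: x - dotv x y *: y).
rewrite !(dotvDl, dotvDr, dotvNl, dotvNr, dotvZl, dotvZr) (dotvC y x) => h.
rewrite -subr_ge0 -(pmulr_rge0 _ yy).
by apply: le_trans h _; rewrite le_eqVlt; apply/orP; left; apply/eqP; ring.
Qed.

Definition reflection p (w : 'cV[R]_p) : 'M[R]_p :=
  1%:M - (2 / dotv w w) *: (w *m w^T).

Lemma reflection_tr p (w : 'cV[R]_p) : (reflection w)^T = reflection w.
Proof. by rewrite /reflection linearB/= linearZ/= trmx_mul trmxK trmx1. Qed.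

Lemma reflection_mulmx p (w x : 'cV[R]_p) :
  reflection w *m x = x - (2 / dotv w w * dotv w x) *: w.
Proof.
rewrite /reflection mulmxBl mul1mx -scalemxAl -mulmxA; congr (_ - _).
rewrite [w^T *m x]mx11_scalar -/(dotv w x) mul_mx_scalar scalerA//.
Qed.

Lemma reflection_orth p (w : 'cV[R]_p) : reflection w *m reflection w = 1%:M.
Proof.
have [->|w0] := eqVneq w 0.
  by rewrite /reflection mul0mx scaler0 subr0 mulmx1.
have ww : dotv w w != 0 by rewrite dotvv_eq0.
rewrite {1}/reflection mulmxBl mul1mx -scalemxAl -mulmxA.
have -> : w^T *m reflection w = - w^T.
  apply: trmx_inj; rewrite trmx_mul reflection_tr trmxK reflection_mulmx linearN/= trmxK.
  by rewrite divfK// scaler_nat mulr2n opprD addrA subrr sub0r.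
by rewrite mulmxN scalerN opprK subrK.
Qed.

Definition e0 p : 'cV[R]_p.+1 := delta_mx 0 0.

(* For e = e0 p the reflection vector is 0 and this is the identity. *)
Definition householder p (e : 'cV[R]_p.+1) : 'M[R]_p.+1 := reflection (e - e0 p).

Lemma dotv_e0 p (x : 'cV[R]_p.+1) : dotv (e0 p) x = x 0 0.
Proof.
by rewrite dotvE (bigD1 0)//= big1 ?addr0 ?mxE ?mul1r// => i i0; rewrite mxE (negbTE i0) mul0r.
Qed.

Lemma householder_mulmx p (e : 'cV[R]_p.+1) : dotv e e = 1 -> householder e *m e = e0 p.
Proof.
move=> e1; rewrite /householder reflection_mulmx; set w := e - e0 p.
have [w0|w0] := eqVneq w 0.
  by rewrite w0 scaler0 subr0; apply/eqP; rewrite -subr_eq0 -/w w0.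
have ww : dotv w w != 0 by rewrite dotvv_eq0.
have we : dotv w w = 2 * dotv w e.
  rewrite /w !(dotvDl, dotvDr, dotvNl, dotvNr) e1 (dotvC e) !dotv_e0 mxE eqxx /=.
  by rewrite mulr1n; ring.
rewrite (_ : 2 / _ * _ = 1) ?scale1r; last first.
  by rewrite mulrAC -we divff.
by rewrite /w opprB addrC subrK.
Qed.

Lemma dotv_orth p (K : 'M[R]_p) (x y : 'cV[R]_p) : K^T *m K = 1%:M ->
  dotv (K *m x) (K *m y) = dotv x y.
Proof. by move=> KK; rewrite dotv_mulmx mulmxA KK mul1mx. Qed.

Lemma dotv_householder p (e x y : 'cV[R]_p.+1) :
  dotv (householder e *m x) (householder e *m y) = dotv x y.
Proof. by rewrite dotv_orth// reflection_tr reflection_orth. Qed.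

Lemma dotv_householderr p (e x y : 'cV[R]_p.+1) :
  dotv x (householder e *m y) = dotv (householder e *m x) y.
Proof. by rewrite dotv_mulmx reflection_tr. Qed.

Lemma householderK p (e x : 'cV[R]_p.+1) : householder e *m (householder e *m x) = x.
Proof. by rewrite mulmxA reflection_orth mul1mx. Qed.

End euclid.

Section householder_invariance.
Context {R : realType} d (T : measurableType d) (P : probability T R).
Variables (s : R) (s0 : s != 0).

(** The coordinates 1, ..., m of [w] are cleared one at a time by rotating each of them into
    coordinate 0. Invariance is recorded for the transpose too, because [K] serves for a
    conjugation. *)
Lemma givens_reduce p (w : 'cV[R]_p.+1) : exists K : 'M[R]_p.+1,
  [/\ left_invariant P s K, left_invariant P s K^T, K^T *m K = 1%:M & exists a, K *m w = a *: e0 p].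
Proof.
suff H m : (m <= p)%N -> exists K : 'M[R]_p.+1,
    [/\ left_invariant P s K, left_invariant P s K^T, K^T *m K = 1%:M &
      forall i : 'I_p.+1, (0 < i <= m)%N -> (K *m w) i 0 = 0].
  have [K [K1 K2 K3 Kw]] := H p (leqnn p).
  exists K; split => //; exists ((K *m w) 0 0); apply/colP => i.
  rewrite [RHS]mxE [X in _ = _ * X]mxE eqxx andbT; have [->|i0] := eqVneq i 0.
    by rewrite mulr1.
  by rewrite mulr0 Kw// lt0n i0/= -ltnS ltn_ord.
elim: m => [_|m IH mp].
  exists 1%:M; split; rewrite ?trmx1 ?mulmx1//; [exact: left_invariant1|exact: left_invariant1|].
  by move=> i; case: (nat_of_ord i).
have [K [K1 K2 K3 Kw]] := IH (ltnW mp).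
pose b : 'I_p.+1 := Ordinal (mp : (m.+1 < p.+1)%N).
set v := K *m w in Kw.
have [vb|vb] := eqVneq (v b 0) 0.
  exists K; split => // i /andP[i0]; rewrite leq_eqVlt => /orP[/eqP im|im].
    by have -> : i = b by apply/val_inj.
  by apply: Kw; rewrite i0.
have ab : (0 : 'I_p.+1) != b by [].
pose rho := Num.sqrt (v 0 0 ^+ 2 + v b 0 ^+ 2).
have rho2 : rho ^+ 2 = v 0 0 ^+ 2 + v b 0 ^+ 2 by rewrite sqr_sqrtr// addr_ge0 ?sqr_ge0.
have rho0 : 0 < rho.
  by rewrite sqrtr_gt0 ltr_wpDl ?sqr_ge0// lt_def sqrf_eq0 vb sqr_ge0.
pose c := v 0 0 / rho; pose t := v b 0 / rho.
have ct : c ^+ 2 + t ^+ 2 = 1.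
  by rewrite /c /t !expr_div_n -mulrDl -rho2 divff// expf_neq0// gt_eqF.
have t0 : t != 0 by rewrite mulf_neq0// invr_neq0// gt_eqF.
have c1 : c != -1.
  apply: contraNneq t0 => cE; move: ct; rewrite cE sqrrN expr1n => /eqP.
  by rewrite -[X in _ == X]addr0 (inj_eq (addrI _)) sqrf_eq0.
exists (givens 0 b c t *m K); rewrite trmx_mul; split.
- by apply: left_invariantM => //; exact: left_invariant_givens.
- apply: left_invariantM => //; rewrite givens_tr//; apply: left_invariant_givens => //.
  by rewrite sqrrN.
- by rewrite mulmxA -(mulmxA K^T) givens_orth// mulmx1.
- move=> i /andP[i0 im]; rewrite -mulmxA givensE//.
  have -> : (i == 0) = false by apply/negbTE; move: i0; rewrite lt0n.
  case: (i =P b) => [_|ib].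
    by rewrite /c /t -/v; field; rewrite gt_eqF.
  rewrite -/v Kw// i0/= -ltnS ltn_neqAle im andbT.
  by apply/eqP => iE; apply: ib; apply/val_inj.
Qed.

(** If [K] is orthogonal and sends [w] to a multiple of [e0 p], the reflection is K^T D K with D the
    sign change of coordinate 0, a product of invariant matrices. *)
Lemma left_invariant_reflection p (w : 'cV[R]_p.+1) : left_invariant P s (reflection w).
Proof.
have [->|w0] := eqVneq w 0.
  by rewrite /reflection mul0mx scaler0 subr0; exact: left_invariant1.
have ww : dotv w w != 0 by rewrite dotvv_eq0.
have [K [K1 K2 K3 [a Kw]]] := givens_reduce w.
have aa : dotv w w = a ^+ 2.
  by rewrite -(dotv_orth w w K3) Kw dotvZl dotvZr dotv_e0 mxE eqxx mulr1.
have -> : reflection w = K^T *m (flip_mx 0 *m K).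
  rewrite /flip_mx mulmxBl mul1mx mulmxBr K3 /reflection; congr (_ - _).
  have -> : w = a *: (K^T *m e0 p).
    by rewrite scalemxAr -Kw mulmxA K3 mul1mx.
  rewrite linearZ/= -scalemxAl -scalemxAr scalerA scalerA trmx_mul trmxK.
  rewrite dotvZl dotvZr dotv_mulmx trmxK mulmxA.
  have KK : K *m K^T = 1%:M by exact: mulmx1C.
  rewrite KK mul1mx dotv_e0 mxE eqxx mulr1.
  rewrite (_ : 2 / _ * a * a = 2); last first.
    rewrite -mulrA -expr2 divfK//; by rewrite -aa.
  rewrite -[X in _ = _ *m (X *m _)]scaler_nat -scalemxAl -scalemxAr.
  congr (_ *: _); rewrite -mulmxA (mulmxA (e0 p)); congr (_ *m (_ *m _)).
  by rewrite /e0 trmx_delta mul_delta_mx.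
by apply: left_invariantM => //; apply: left_invariantM => //; exact: left_invariant_flip.
Qed.

(** The right factor acts on the left of the transpose, whose law is of the same kind. *)
Lemma gauss_mx_householder p n (e : 'cV[R]_p.+1) (f : 'cV[R]_n.+1) (G : T -> 'M[R]_(p.+1, n.+1)) :
  gauss_mx P s G -> gauss_mx P s (fun w => householder e *m G w *m householder f).
Proof.
move=> /(left_invariant_reflection (e - e0 p))/gauss_mx_tr.
move=> /(left_invariant_reflection (f - e0 n))/gauss_mx_tr.
congr gauss_mx; apply/funext => w.
by rewrite !trmx_mul !trmxK reflection_tr.
Qed.

End householder_invariance.

(** * Concentration of chi-square variables *)

Section chi_square.
Context {R : realType}.
Local Open Scope ereal_scope.
Local Notation cube I := (g_sigma_algebraType (@boxes R I)).
Local Notation mu := (@lebesgue_measure R).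

Lemma measurable_le_set d (T : measurableType d) (f g : T -> R) :
  measurable_fun setT f -> measurable_fun setT g ->
  measurable [set w | f w <= g w]%R.
Proof.
move=> mf mg; have := measurable_fun_ler mf mg.
by move=> /(_ measurableT [set true]); rewrite setTI; exact.
Qed.

(** The exponential times the density of deviation s is k times the density of deviation s k, where
    k = (1 - 2 theta)^(-1/2). *)
Lemma normal_mgf_sqr (s theta : R) : (0 < s)%R -> (theta < 1/2)%R ->
  \int[normal_prob 0 s]_x (expR (theta * x ^+ 2 / s ^+ 2))%:E =
  ((Num.sqrt (1 - 2 * theta))^-1)%:E.
Proof.
move=> s_gt0 th; pose k := ((Num.sqrt (1 - 2 * theta))^-1)%R.
have th0 : (0 < 1 - 2 * theta)%R by lra.
have k0 : (0 < k)%R by rewrite invr_gt0 sqrtr_gt0.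
have kk : (k ^+ 2 = (1 - 2 * theta)^-1)%R by rewrite exprVn sqr_sqrtr// ltW.
have sk0 : (s * k != 0)%R by rewrite mulf_neq0// gt_eqF.
have s0 : (s != 0)%R by rewrite gt_eqF.
have mf : measurable_fun [set: measurableTypeR R]
    (fun x : measurableTypeR R => expR (theta * x ^+ 2 / s ^+ 2)).
  apply: measurableT_comp => //; apply: measurable_funM => //.
  by apply: measurable_funM => //; exact: measurable_funX.
rewrite ge0_integral_normal_prob; [|exact/measurable_EFinP|by move=> x; rewrite lee_fin expR_ge0].
transitivity (\int[mu]_x (k%:E * (normal_pdf 0 (s * k) x)%:E)).
  apply: eq_integral => x _; rewrite -!EFinM !normal_pdfE//; congr (_%:E).
  rewrite [LHS]mulrCA [RHS]mulrA; congr (_ * _)%R.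
    rewrite /normal_peak (_ : (s * k) ^+ 2 * pi *+ 2 = k ^+ 2 * (s ^+ 2 * pi *+ 2))%R; last by ring.
    by rewrite sqrtrM ?sqr_ge0// sqrtr_sqr gtr0_norm// invfM mulVKf// gt_eqF.
  rewrite /normal_fun -expRD; congr expR; rewrite subr0 exprMn kk.
  field; rewrite s0/=; apply/andP; split; lra.
rewrite ge0_integralZl//; last 3 first.
- by apply/measurable_EFinP; exact: measurable_normal_pdf.
- by move=> x _; rewrite lee_fin normal_pdf_ge0.
- by rewrite lee_fin ltW.
by rewrite integral_normal_pdf mule1.
Qed.

Lemma iid_normal_integral d (T : measurableType d) (P : probability T R)
    d' (T' : measurableType d') (P' : probability T' R) (s : R) (I : finType)
    (X : I -> T -> R) (X' : I -> T' -> R) (g : cube I -> \bar R) :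
  iid_normal P s X -> iid_normal P' s X' ->
  measurable_fun setT g -> (forall x, 0 <= g x) ->
  \int[P]_w g (X ^~ w) = \int[P']_w g (X' ^~ w).
Proof.
move=> PX PX' mg g0; have [mX _] := PX; have [mX' _] := PX'.
have mY := measurable_to_cube mX; have mY' := measurable_to_cube mX'.
transitivity (\int[pushforward P (fun w => (X ^~ w : cube I))]_x g x).
  by apply/esym; apply: etrans (ge0_integral_pushforward mY P measurableT mg _) _.
transitivity (\int[pushforward P' (fun w => (X' ^~ w : cube I))]_x g x); last first.
  by apply: etrans (ge0_integral_pushforward mY' P' measurableT mg _) _.
by apply: eq_measure_integral => A mA _; exact: iid_normal_law PX PX' A mA.
Qed.

Section expectation_of_product.
Context d (T : measurableType d) (P : probability T R) (s : R) (I : finType)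
  (X : I -> T -> R).
Hypothesis PX : iid_normal P s X.
Variables (f : R -> R) (m : R).
Hypotheses (mf : measurable_fun setT f) (f0 : forall x, (0 <= f x)%R).
Hypothesis fm : \int[normal_prob 0 s]_x (f x)%:E = m%:E.

Lemma iid_normal_integral1 (i : I) : \int[P]_w (f (X i w))%:E = m%:E.
Proof.
have [mX XP] := PX; rewrite -fm.
have mXi : measurable_fun setT (X i : T -> measurableTypeR R) by exact: mX.
transitivity (\int[pushforward P (X i : T -> measurableTypeR R)]_x (f x)%:E).
  apply/esym; apply: etrans (ge0_integral_pushforward mXi P measurableT _ _) _ => //.
  - exact/measurable_EFinP.
  - by move=> x _; rewrite lee_fin.
apply: eq_measure_integral => /= A mA _.
pose C j := if j == i then A else setT.
have mC j : measurable (C j) by rewrite /C; case: ifP.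
transitivity (P [set w | forall j, C j (X j w)]).
  congr (P _); apply/seteqP; split => w /=.
    by move=> Aw j; rewrite /C; case: eqP => // ->.
  by move=> /(_ i); rewrite /C eqxx.
rewrite (XP _ mC) (bigD1 i)//= /C eqxx big1 ?mule1// => j /negbTE ->.
exact: probability_setT.
Qed.

(** Independence enters through the split family: the factor of [i] is read on the first copy and
    the others on the second, so that Fubini separates them. *)
Lemma iid_normal_integral_prod (l : seq I) : uniq l ->
  \int[P]_w (\prod_(i <- l) f (X i w))%:E = (m ^+ size l)%:E.
Proof.
have [mX XP] := PX.
have mprod (l' : seq I) d' (T' : measurableType d') (Y : I -> T' -> R) :
    (forall i, measurable_fun setT (Y i)) ->
    measurable_fun setT (fun w => (\prod_(i <- l') f (Y i w))%:E).
  move=> mY; apply/measurable_EFinP; apply: measurable_prod => i _.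
  exact: measurableT_comp.
have prod0 (l' : seq I) (x : I -> R) : 0 <= (\prod_(i <- l') f (x i))%:E.
  by rewrite lee_fin prodr_ge0.
elim: l => [_|i l IH /= /andP[il ul]].
  under eq_integral do rewrite big_nil.
  rewrite integral_cst// mul1e; exact: probability_setT.
pose g (x : cube I) := (\prod_(j <- i :: l) f (x j))%:E.
have mg : measurable_fun setT g by apply: mprod => j; exact: measurable_coord.
have PXX := iid_normal_split (pred1 i) PX.
rewrite (iid_normal_integral PX PXX mg) ?/g//.
rewrite fubini_tonelli1//; last by apply: mprod; have [] := PXX.
transitivity (\int[P]_w ((f (X i w))%:E * (m ^+ size l)%:E)).
  apply: eq_integral => w1 _; rewrite /fubini_F/=.
  transitivity (\int[P]_w2 ((f (X i w1))%:E * (\prod_(j <- l) f (X j w2))%:E)).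
    apply: eq_integral => w2 _; rewrite big_cons eqxx EFinM; congr (_ * _%:E).
    rewrite big_seq [RHS]big_seq; apply: eq_bigr => j jl.
    by case: eqP => // ji; rewrite -ji jl in il.
  rewrite ge0_integralZl ?lee_fin//; first by rewrite IH.
  exact: mprod.
rewrite ge0_integralZr//.
- by rewrite iid_normal_integral1 -EFinM exprS.
- by apply/measurable_EFinP; exact: measurableT_comp.
- by move=> w _; rewrite lee_fin.
- rewrite lee_fin exprn_ge0// -lee_fin -fm integral_ge0// => x _.
  by rewrite lee_fin.
Qed.

End expectation_of_product.

(** Markov's inequality for the exponential. A negative [theta] is allowed, so that both tails
    follow. *)
Lemma chi_square_chernoff d (T : measurableType d) (P : probability T R)
    (s theta b : R) (I : finType) (X : I -> T -> R) :
  (0 < s)%R -> (theta < 1/2)%R -> iid_normal P s X ->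
  P [set w | b <= theta * (\sum_i X i w ^+ 2) / s ^+ 2]%R <=
  (expR (#|I|%:R * (theta / (1 - 2 * theta)) - b))%:E.
Proof.
move=> s0 th PX; have [mX _] := PX.
pose f (x : R) := expR (theta * x ^+ 2 / s ^+ 2).
have mf : measurable_fun setT f.
  apply: measurableT_comp => //; apply: measurable_funM => //.
  by apply: measurable_funM => //; exact: measurable_funX.
have f0 x : (0 <= f x)%R by exact: expR_ge0.
have := iid_normal_integral_prod PX mf f0 (normal_mgf_sqr s0 th) (enum_uniq I).
rewrite -cardE.
set m := (_^-1)%R => E.
have m0 : (0 <= m)%R by rewrite invr_ge0 sqrtr_ge0.
(* The square of m is 1 / (1 - 2 theta) = 1 + 2 theta / (1 - 2 theta), at most the exponential of
   the last term. *)
have mle : (m <= expR (theta / (1 - 2 * theta)))%R.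
  have h : (0 < 1 - 2 * theta)%R by lra.
  rewrite -(@ler_pXn2r _ 2) ?nnegrE ?expR_ge0// exprVn (sqr_sqrtr (ltW h)) -expRM_natl.
  apply: (le_trans _ (expR_ge1Dx _)); rewrite le_eqVlt; apply/orP; left; apply/eqP.
  by field; lra.
have mA : measurable [set w | b <= theta * (\sum_i X i w ^+ 2) / s ^+ 2]%R.
  apply: measurable_le_set => //.
  apply: measurable_funM => //; apply: measurable_funM => //.
  by apply: measurable_sum => i; exact: measurable_funX.
rewrite -[X in P X]setIT -integral_indic//.
apply: (@le_trans _ _ (\int[P]_w ((expR (- b))%:E * (\prod_(i <- enum I) f (X i w))%:E))).
  apply: ge0_le_integral => //.
  - exact/measurable_EFinP/measurable_indic.
  - apply: emeasurable_funM => //; apply/measurable_EFinP; apply: measurable_prod => i _.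
    exact: measurableT_comp.
  - move=> w _; rewrite -EFinM lee_fin indicE; case: (boolP (_ \in _)) => [|_]; last first.
      by rewrite mulr_ge0 ?expR_ge0// prodr_ge0// => i _; exact: expR_ge0.
    rewrite inE/= => bw; rewrite -expR_sum -expRD -[leLHS]expR0 ler_expR.
    rewrite -mulr_suml -mulr_sumr big_enum/=.
    by rewrite addrC subr_ge0.
rewrite ge0_integralZl//; last 2 first.
- apply/measurable_EFinP; apply: measurable_prod => i _; exact: measurableT_comp.
- by move=> w _; rewrite lee_fin prodr_ge0// => i _; exact: expR_ge0.
rewrite E -EFinM lee_fin addrC expRD ler_wpM2l ?expR_ge0// expRM_natl.
by rewrite lerXn2r ?nnegrE ?expR_ge0.
Qed.

Lemma chi_square_upper d (T : measurableType d) (P : probability T R)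
    (n : nat) (kappa b : R) (I : finType) (X : I -> T -> R) :
  (0 <= kappa < b)%R -> (0 < n)%N -> (#|I|%:R <= kappa * n%:R)%R ->
  iid_normal P (Num.sqrt n%:R^-1) X ->
  P [set w | b <= \sum_i X i w ^+ 2]%R <=
  (expR (- (n%:R * ((b - kappa) ^+ 2 / (8 * (b + kappa))))))%:E.
Proof.
move=> /andP[k0 kb] n0 In PX.
have nR : (0 < n%:R :> R)%R by rewrite ltr0n.
(* This choice ensures kappa / (1 - 2 theta) <= (kappa + b) / 2, so that the exponent is at most - n
   theta (b - kappa) / 2. It need not be optimal: only a positive rate matters. *)
pose theta : R := ((b - kappa) / (4 * (b + kappa)))%R.
have bk : (0 < b + kappa)%R by lra.
have th0 : (0 < theta)%R by rewrite divr_gt0//; lra.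
have thE : (theta * (4 * (b + kappa)) = b - kappa)%R by rewrite divfK// gt_eqF// mulr_gt0.
have th : (theta < 1/2)%R by rewrite ltr_pdivrMr; lra.
have s0 : (0 < Num.sqrt n%:R^-1 :> R)%R by rewrite sqrtr_gt0 invr_gt0.
have := @chi_square_chernoff _ T P _ theta (theta * b * n%:R) I X s0 th PX.
rewrite sqr_sqrtr ?invr_ge0 ?ler0n// invrK.
rewrite (_ : [set w | _] = [set w | b <= \sum_i X i w ^+ 2]%R); last first.
  by apply/seteqP; split => w /=; rewrite ler_pM2r// ler_pM2l.
move=> /le_trans; apply; rewrite lee_fin ler_expR.
have h : (0 < 1 - 2 * theta)%R by lra.
have kth : (kappa / (1 - 2 * theta) <= (kappa + b) / 2)%R.
  by rewrite ler_pdivrMr//; nra.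
have -> : ((b - kappa) ^+ 2 / (8 * (b + kappa)) = theta * (b - kappa) / 2)%R.
  by rewrite /theta; field; lra.
have : (#|I|%:R * (theta / (1 - 2 * theta)) <= n%:R * theta * ((kappa + b) / 2))%R.
  apply: le_trans (_ : kappa * n%:R * (theta / (1 - 2 * theta)) <= _)%R.
    by rewrite ler_wpM2r// divr_ge0 ?ltW.
  have -> : (kappa * n%:R * (theta / (1 - 2 * theta)) =
     n%:R * theta * (kappa / (1 - 2 * theta)))%R by field; lra.
  by rewrite ler_wpM2l// mulr_ge0// ltW.
by move=> hle; lra.
Qed.

Lemma chi_square_lower d (T : measurableType d) (P : probability T R)
    (n : nat) (kappa a : R) (I : finType) (X : I -> T -> R) :
  (0 <= a < kappa)%R -> (0 < n)%N -> (kappa * n%:R <= #|I|%:R)%R ->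
  iid_normal P (Num.sqrt n%:R^-1) X ->
  P [set w | \sum_i X i w ^+ 2 <= a]%R <=
  (expR (- (n%:R * ((kappa - a) ^+ 2 / (8 * (kappa + a))))))%:E.
Proof.
move=> /andP[a0 ak] n0 In PX.
have nR : (0 < n%:R :> R)%R by rewrite ltr0n.
pose tau : R := ((kappa - a) / (4 * (kappa + a)))%R.
have bk : (0 < kappa + a)%R by lra.
have th0 : (0 < tau)%R by rewrite divr_gt0//; lra.
have thE : (tau * (4 * (kappa + a)) = kappa - a)%R by rewrite divfK// gt_eqF// mulr_gt0.
have th : (- tau < 1/2)%R by lra.
have s0 : (0 < Num.sqrt n%:R^-1 :> R)%R by rewrite sqrtr_gt0 invr_gt0.
have := @chi_square_chernoff _ T P _ (- tau) (- tau * a * n%:R) I X s0 th PX.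
rewrite sqr_sqrtr ?invr_ge0 ?ler0n// invrK.
rewrite (_ : [set w | _] = [set w | \sum_i X i w ^+ 2 <= a]%R); last first.
  by apply/seteqP; split => w /=; rewrite ler_pM2r// !mulNr lerN2 ler_pM2l.
move=> /le_trans; apply; rewrite lee_fin ler_expR.
have h : (0 < 1 + 2 * tau)%R by lra.
have kth : ((kappa + a) / 2 <= kappa / (1 + 2 * tau))%R.
  by rewrite ler_pdivlMr//; nra.
have -> : ((kappa - a) ^+ 2 / (8 * (kappa + a)) = tau * (kappa - a) / 2)%R.
  by rewrite /tau; field; lra.
have : (n%:R * tau * ((kappa + a) / 2) <= #|I|%:R * (tau / (1 + 2 * tau)))%R.
  apply: le_trans (_ : _ <= kappa * n%:R * (tau / (1 + 2 * tau)))%R _; last first.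
    by rewrite ler_wpM2r// divr_ge0 ?ltW.
  have -> : (kappa * n%:R * (tau / (1 + 2 * tau)) =
     n%:R * tau * (kappa / (1 + 2 * tau)))%R by field; lra.
  by rewrite ler_wpM2l// mulr_ge0// ltW.
have -> : (- tau / (1 - 2 * - tau) = - (tau / (1 + 2 * tau)))%R by field; lra.
by rewrite mulrN; lra.
Qed.

End chi_square.

(** * Peeling a Gaussian matrix *)

Section peeling.
Context {R : realType}.

(* The first basis vector when q = 0, so that the result is a unit vector if p > 0. *)
Definition normalize p (q : 'cV[R]_p) : 'cV[R]_p :=
  if dotv q q == 0 then \col_i ((i : nat) == 0%N)%:R
  else (Num.sqrt (dotv q q))^-1 *: q.

Lemma normalizeE p (q : 'cV[R]_p) : q = Num.sqrt (dotv q q) *: normalize q.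
Proof.
rewrite /normalize; case: ifPn => [|qq].
  by rewrite dotvv_eq0 => /eqP ->; rewrite /dotv mulmx0 mxE sqrtr0 scale0r.
rewrite scalerA divff ?scale1r// sqrtr_eq0 -ltNge lt_def qq; exact: dotvv_ge0.
Qed.

Lemma normalize_unit p (q : 'cV[R]_p) : (0 < p)%N ->
  dotv (normalize q) (normalize q) = 1.
Proof.
case: p q => // p q _; rewrite /normalize; case: ifPn => qq.
  rewrite dotvE big_ord_recl !mxE mulr1 big1 ?addr0// => i _.
  by rewrite !mxE mulr0.
have q0 : 0 < dotv q q by rewrite lt_def qq dotvv_ge0.
by rewrite dotvZl dotvZr mulrA -expr2 exprVn sqr_sqrtr ?mulVf// ltW.
Qed.

Definition lcol p n (H : 'M[R]_(p.+1, n.+1)) : 'cV[R]_p := \col_i H (lift 0 i) 0.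
Definition urow p n (H : 'M[R]_(p.+1, n.+1)) : 'cV[R]_n := \col_j H 0 (lift 0 j).
Definition minor p n (H : 'M[R]_(p.+1, n.+1)) : 'M[R]_(p, n) :=
  \matrix_(i, j) H (lift 0 i) (lift 0 j).

(* In the Householder bases of e and f, the corner, the first column and the first
   row of G have their squared norms in Ag, Aq and Ar, and so on for at most k steps;
   there is no constraint left when a dimension is exhausted. *)
Fixpoint peel (Ag Aq Ar : set R) (k p n : nat) :
    'M[R]_(p, n) -> 'cV[R]_p -> 'cV[R]_n -> Prop :=
  match k, p, n with
  | k'.+1, p'.+1, n'.+1 => fun G e f =>
      let H := householder e *m G *m householder f in
      [/\ Ag (H 0 0 ^+ 2), Aq (dotv (lcol H) (lcol H)),
          Ar (dotv (urow H) (urow H)) &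
          peel Ag Aq Ar k' (minor H) (normalize (lcol H)) (normalize (urow H))]
  | _, _, _ => fun _ _ _ => True
  end.

Section measurability.
Context d (T : measurableType d).

Definition measurable_mx p n (G : T -> 'M[R]_(p, n)) : Prop :=
  forall i j, measurable_fun setT (fun w => G w i j).

Lemma measurable_mx_cst p n (G : 'M[R]_(p, n)) : measurable_mx (fun=> G).
Proof. by move=> i j; exact: measurable_cst. Qed.

Lemma measurable_mulmx p n m (G : T -> 'M[R]_(p, n)) (H : T -> 'M[R]_(n, m)) :
  measurable_mx G -> measurable_mx H -> measurable_mx (fun w => G w *m H w).
Proof.
move=> mG mH i j; under eq_fun do rewrite mxE.
by apply: measurable_sum => k; exact: measurable_funM.
Qed.

Lemma measurable_dotv p (x y : T -> 'cV[R]_p) : measurable_mx x ->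
  measurable_mx y -> measurable_fun setT (fun w => dotv (x w) (y w)).
Proof.
move=> mx my; under eq_fun do rewrite dotvE.
by apply: measurable_sum => k; exact: measurable_funM.
Qed.

Lemma measurable_inv (f : T -> R) : measurable_fun setT f ->
  measurable_fun setT (fun w => (f w)^-1).
Proof.
suff mV : measurable_fun [set: R] (fun x : R => x^-1).
  by move=> mf; exact: measurableT_comp.
have o0 : open (~` [set 0 : R]) by rewrite openC; exact: closed_eq.
rewrite -(setvU [set 0 : R]); apply/measurable_funU => //.
  exact: open_measurable.
split; last exact: measurable_fun_set1.
apply: open_continuous_measurable_fun => // x; rewrite inE /= => /eqP x0.
exact: inv_continuous.
Qed.

Lemma measurable_sqrt (f : T -> R) : measurable_fun setT f ->
  measurable_fun setT (fun w => Num.sqrt (f w)).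
Proof.
move=> mf; have mS : measurable_fun [set: R] (fun x : R => Num.sqrt x).
  by apply: continuous_measurable_fun; exact: sqrt_continuous.
exact: measurableT_comp.
Qed.

Lemma measurable_householder p (e : T -> 'cV[R]_p.+1) : measurable_mx e ->
  measurable_mx (fun w => householder (e w)).
Proof.
move=> me; have mw : measurable_mx (fun w => e w - e0 p).
  by move=> i j; under eq_fun do rewrite !mxE; apply: measurable_funB.
move=> i j; rewrite (_ : (fun w => _) = fun w => (1%:M : 'M[R]_p.+1) i j -
    2 / dotv (e w - e0 p) (e w - e0 p) * ((e w - e0 p) i 0 * (e w - e0 p) j 0)).
  apply: measurable_funB => //; apply: measurable_funM; last first.
    exact: (measurable_funM (mw i 0) (mw j 0)).
  by apply: measurable_funM => //; apply: measurable_inv; exact: measurable_dotv.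
apply/funext => w; rewrite /householder /reflection; move: (e w - e0 p) => v.
by rewrite !(mxE, big_ord1).
Qed.

Lemma measurable_normalize p (q : T -> 'cV[R]_p) : measurable_mx q ->
  measurable_mx (fun w => normalize (q w)).
Proof.
move=> mq i j; rewrite /normalize.
rewrite (_ : (fun w => _) = (fun w => if dotv (q w) (q w) == 0
   then ((i : nat) == 0%N)%:R else (Num.sqrt (dotv (q w) (q w)))^-1 * q w i j)); last first.
  by apply/funext => w; case: ifP => _; rewrite mxE.
apply: measurable_fun_ifT => //.
  by apply: measurable_fun_eqr => //; exact: measurable_dotv.
by apply: measurable_funM => //; apply: measurable_inv; apply: measurable_sqrt;
  exact: measurable_dotv.
Qed.

Lemma measurable_lcol p n (H : T -> 'M[R]_(p.+1, n.+1)) :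
  measurable_mx H -> measurable_mx (fun w => lcol (H w)).
Proof. by move=> mH i j; under eq_fun do rewrite mxE; exact: mH. Qed.

Lemma measurable_urow p n (H : T -> 'M[R]_(p.+1, n.+1)) :
  measurable_mx H -> measurable_mx (fun w => urow (H w)).
Proof. by move=> mH i j; under eq_fun do rewrite mxE; exact: mH. Qed.

Lemma measurable_minor p n (H : T -> 'M[R]_(p.+1, n.+1)) :
  measurable_mx H -> measurable_mx (fun w => minor (H w)).
Proof. by move=> mH i j; under eq_fun do rewrite mxE; exact: mH. Qed.

Lemma measurable_preim (f : T -> R) (A : set R) : measurable_fun setT f ->
  measurable A -> measurable [set w | A (f w)].
Proof. by move=> mf mA; rewrite -[X in measurable X]setTI; exact: mf. Qed.

Lemma measurable_peel (Ag Aq Ar : set R) k p n (G : T -> 'M[R]_(p, n)) e f :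
  measurable Ag -> measurable Aq -> measurable Ar ->
  measurable_mx G -> measurable_mx e -> measurable_mx f ->
  measurable [set w | peel Ag Aq Ar k (G w) (e w) (f w)].
Proof.
move=> mAg mAq mAr.
elim: k p n G e f => [|k IH] p n G e f mG me mf /=; first exact: measurableT.
case: p G e mG me => [|p] G e mG me; first exact: measurableT.
case: n G f mG mf => [|n] G f mG mf; first exact: measurableT.
pose H w := householder (e w) *m G w *m householder (f w).
have mH : measurable_mx H.
  by apply: measurable_mulmx; [apply: measurable_mulmx => //|]; exact: measurable_householder.
have ml := measurable_lcol mH.
have mu := measurable_urow mH.
have mm := measurable_minor mH.
have m1 := measurable_preim (measurable_funX 2 (mH 0 0)) mAg.
have m2 := measurable_preim (measurable_dotv ml ml) mAq.
have m3 := measurable_preim (measurable_dotv mu mu) mAr.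
have m4 := IH _ _ _ _ _ mm (measurable_normalize ml) (measurable_normalize mu).
have := measurableI _ _ (measurableI _ _ m1 m2) (measurableI _ _ m3 m4).
congr (measurable _); apply/seteqP; split => w /=; first by move=> [[? ?] [? ?]].
by move=> [].
Qed.

End measurability.

Section probability_of_peeling.
Context d (T : measurableType d) (P : probability T R).
Variables (s : R) (s0 : s != 0).
Variables (Ag Aq Ar : set R) (delta : R).
Hypotheses (mAg : measurable Ag) (mAq : measurable Aq) (mAr : measurable Ar).
Local Open Scope ereal_scope.

Definition sqnorm_in (A : set R) m := forall X : 'I_m -> T -> R,
  iid_normal P s X -> P [set w | ~ A (\sum_i X i w ^+ 2)%R] <= delta%:E.

(** For deterministic [e] and [f] the matrix [H] is again Gaussian, and its corner, first column and
    first row cost [delta] each. The next directions depend on that column and row only, hence not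
    on the minor: once they are frozen, the induction hypothesis applies with deterministic
    directions. The ranges of [m] are the lengths of the columns and rows met in k steps. *)
Lemma peel_prob k p n (G : T -> 'M[R]_(p, n)) (e : 'cV[R]_p) (f : 'cV[R]_n) :
  (0 <= delta)%R -> gauss_mx P s G -> sqnorm_in Ag 1 ->
  (forall m, (p - k <= m < p)%N -> sqnorm_in Aq m) ->
  (forall m, (n - k <= m < n)%N -> sqnorm_in Ar m) ->
  P [set w | ~ peel Ag Aq Ar k (G w) e f] <= (k%:R * (3 * delta))%:E.
Proof.
move=> d0 + Hg; elim: k p n G e f => [|k IH] p n G e f GG Hq Hr.
  by rewrite (_ : [set w | _] = set0) ?measure0 ?mul0r// -subset0 => w /=; exact.
have triv (A : set T) : A = set0 -> P A <= (k.+1%:R * (3 * delta))%:E.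
  by move=> ->; rewrite measure0 lee_fin !mulr_ge0.
case: p G e GG Hq => [|p] G e GG Hq.
  by apply: triv; rewrite -subset0 => w /=; exact.
case: n G f GG Hr => [|n] G f GG Hr.
  by apply: triv; rewrite -subset0 => w /=; exact.
pose H w := householder e *m G w *m householder f.
have GH : gauss_mx P s H by exact: gauss_mx_householder.
have [mH _] := GH.
have mHx : measurable_mx H by move=> i j; exact: (mH (i, j)).
have ml := measurable_lcol mHx.
have mu := measurable_urow mHx.
have mm := measurable_minor mHx.
have m1 := measurable_preim (measurable_funX 2 (mHx 0%R 0%R)) mAg.
have m2 := measurable_preim (measurable_dotv ml ml) mAq.
have m3 := measurable_preim (measurable_dotv mu mu) mAr.
have m4 := measurable_peel k mAg mAq mAr mm (measurable_normalize ml) (measurable_normalize mu).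
set A1 := [set w | Ag _] in m1; set A2 := [set w | Aq _] in m2.
set A3 := [set w | Ar _] in m3; set A4 := [set w | peel _ _ _ _ _ _ _] in m4.
have PA1 : P (~` A1) <= delta%:E.
  pose h (i : 'I_1) := (0, 0)%R : 'I_p.+1 * 'I_n.+1.
  have hi : injective h by move=> i j _; rewrite !ord1.
  have := Hg _ (sub_iid_normal hi GH).
  by congr (P _ <= _); apply/seteqP; split => w /=; rewrite big_ord1.
have PA2 : P (~` A2) <= delta%:E.
  pose h (i : 'I_p) := (lift 0 i, 0)%R : 'I_p.+1 * 'I_n.+1.
  have hi : injective h by move=> i j /(congr1 fst)/lift_inj.
  have lep : (p.+1 - k.+1 <= p < p.+1)%N by rewrite subSS leq_subr ltnSn.
  have := Hq _ lep _ (sub_iid_normal hi GH).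
  congr (P _ <= _); suff E w : dotv (lcol (H w)) (lcol (H w)) = (\sum_i H w (lift 0 i) 0 ^+ 2)%R.
    by apply/seteqP; split => w; rewrite /A2/= E.
  by rewrite dotvE; apply: eq_bigr => i _; rewrite mxE expr2.
have PA3 : P (~` A3) <= delta%:E.
  pose h (i : 'I_n) := (0, lift 0 i)%R : 'I_p.+1 * 'I_n.+1.
  have hi : injective h by move=> i j /(congr1 snd)/lift_inj.
  have len : (n.+1 - k.+1 <= n < n.+1)%N by rewrite subSS leq_subr ltnSn.
  have := Hr _ len _ (sub_iid_normal hi GH).
  congr (P _ <= _); suff E w : dotv (urow (H w)) (urow (H w)) = (\sum_i H w 0 (lift 0 i) ^+ 2)%R.
    by apply/seteqP; split => w; rewrite /A3/= E.
  by rewrite dotvE; apply: eq_bigr => i _; rewrite mxE expr2.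
have PA4 : P (~` A4) <= (k%:R * (3 * delta))%:E.
  pose cb := g_sigma_algebraType (@boxes R ('I_p.+1 * 'I_n.+1)%type).
  pose M (x : cb) : 'M[R]_(p.+1, n.+1) := \matrix_(i, j) x (i, j).
  have mM : measurable_mx M.
    move=> i j; rewrite (_ : (fun w => _) = fun x : cb => x (i, j)).
      exact: measurable_coord.
    by apply/funext => x; rewrite mxE.
  have mMl := measurable_lcol mM.
  have mMu := measurable_urow mM.
  have mMm := measurable_minor mM.
  pose B : set cb := ~` [set x | peel Ag Aq Ar k (minor (M x))
    (normalize (lcol (M x))) (normalize (urow (M x)))].
  have mB : measurable B.
    apply: measurableC; apply: measurable_peel => //; exact: measurable_normalize.
  have MH w : M (fun ij => H w ij.1 ij.2) = H w by apply/matrixP => i j; rewrite mxE.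
  have -> : ~` A4 = [set w | B (fun ij => H w ij.1 ij.2)].
    by apply/seteqP; split => w /=; rewrite /B/= MH.
  pose S (ij : 'I_p.+1 * 'I_n.+1) := (ij.1 == 0%R) || (ij.2 == 0%R).
  apply: (iid_normal_decouple_le (S := S) GH mB) => w1.
  have Gm : gauss_mx P s (fun w => minor (H w)).
    pose h (ij : 'I_p * 'I_n) := (lift 0 ij.1, lift 0 ij.2)%R : 'I_p.+1 * 'I_n.+1.
    have hi : injective h.
      move=> [i j] [i' j'] E; have /lift_inj/= -> := congr1 fst E.
      by have /lift_inj/= -> := congr1 snd E.
    have := sub_iid_normal hi GH; congr (iid_normal _ _ _).
    by apply/funext => -[i j]; apply/funext => w; rewrite [RHS]mxE.
  have := IH _ _ _ (normalize (lcol (H w1))) (normalize (urow (H w1))) Gm.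
  have Hq' m : (p - k <= m < p)%N -> sqnorm_in Aq m.
    by move=> /andP[pm mp]; apply: Hq; rewrite subSS pm ltnS ltnW.
  have Hr' m : (n - k <= m < n)%N -> sqnorm_in Ar m.
    by move=> /andP[nm mn]; apply: Hr; rewrite subSS nm ltnS ltnW.
  move=> /(_ Hq' Hr'); apply: le_trans; rewrite le_eqVlt; apply/orP; left; apply/eqP.
  congr (P _); apply/seteqP; split => w2 /=; rewrite /B/=;
  (have -> : lcol (M (fun i => if S i then H w1 i.1 i.2 else H w2 i.1 i.2)) = lcol (H w1)
    by apply/colP => i; rewrite mxE [RHS]mxE mxE /S/= ?eqxx ?orbT);
  (have -> : urow (M (fun i => if S i then H w1 i.1 i.2 else H w2 i.1 i.2)) = urow (H w1)
    by apply/colP => i; rewrite [LHS]mxE [RHS]mxE mxE);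
  (have -> // : minor (M (fun i => if S i then H w1 i.1 i.2 else H w2 i.1 i.2)) = minor (H w2)
    by apply/matrixP => i j; rewrite mxE [RHS]mxE mxE /S/=).
have mC := @measurableC _ T.
rewrite (_ : [set w | _] = (~` A1 `|` ~` A2) `|` (~` A3 `|` ~` A4)); last first.
  rewrite -!setCI; apply/seteqP; split => w /=.
    by move=> np [[? ?] [? ?]]; apply: np.
  by move=> np [? ? ? ?]; apply: np.
apply: (@le_trans _ _ ((delta%:E + delta%:E) + (delta%:E + (k%:R * (3 * delta))%:E))).
  apply: le_trans (measureU2 _ _ _) _; [exact: measurableU (mC _ m1) (mC _ m2)|
    exact: measurableU (mC _ m3) (mC _ m4)|].
  apply: leeD; apply: le_trans (measureU2 _ _ _) _; rewrite ?leeD//; exact: mC.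
by rewrite -!EFinD lee_fin -natr1; lra.
Qed.

End probability_of_peeling.
End peeling.

(** * Bounds on the bilinear form along the peeling chain *)

Section peeling_bounds.
Context {R : realType}.

Definition tailv p (x : 'cV[R]_p.+1) : 'cV[R]_p := \col_i x (lift 0 i) 0.
Definition consv p (a : R) (x : 'cV[R]_p) : 'cV[R]_p.+1 :=
  \col_i if unlift 0 i is Some j then x j 0 else a.

Lemma consv0 p (a : R) (x : 'cV[R]_p) : consv a x 0 0 = a.
Proof. by rewrite mxE unlift_none. Qed.

Lemma tailv_consv p (a : R) (x : 'cV[R]_p) : tailv (consv a x) = x.
Proof. by apply/colP => i; rewrite 2!mxE liftK. Qed.

Lemma dotv_recl p (x y : 'cV[R]_p.+1) :
  dotv x y = x 0 0 * y 0 0 + dotv (tailv x) (tailv y).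
Proof.
by rewrite !dotvE big_ord_recl; congr (_ + _); apply: eq_bigr => i _; rewrite !mxE.
Qed.

Lemma bilinear_recl p n (H : 'M[R]_(p.+1, n.+1)) x y :
  dotv x (H *m y) = x 0 0 * H 0 0 * y 0 0 + x 0 0 * dotv (urow H) (tailv y) +
    y 0 0 * dotv (lcol H) (tailv x) + dotv (tailv x) (minor H *m tailv y).
Proof.
rewrite dotv_recl mxE big_ord_recl mulrDr -!addrA -!mulrA; congr (_ + _).
have -> : dotv (urow H) (tailv y) = \sum_i H 0 (lift 0 i) * y (lift 0 i) 0.
  by rewrite dotvE; apply: eq_bigr => i _; rewrite !mxE.
congr (_ + _).
have -> : tailv (H *m y) = y 0 0 *: lcol H + minor H *m tailv y.
  apply/colP => i; rewrite [LHS]mxE [LHS]mxE big_ord_recl [RHS]mxE.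
  congr (_ + _); first by rewrite 2!mxE mulrC.
  by rewrite mxE; apply: eq_bigr => j _; rewrite !mxE.
by rewrite dotvDr dotvZr (dotvC (lcol H)).
Qed.

(** The chain may end in dimension 0, where there is no unit vector; this is what [normalize_unit]
    guarantees in every dimension. *)
Definition unit_or_empty p (e : 'cV[R]_p) := (0 < p)%N -> dotv e e = 1.

Lemma bessel p (e x : 'cV[R]_p) : unit_or_empty e -> dotv x e ^+ 2 <= dotv x x.
Proof.
case: p e x => [|p] e x ue; first by rewrite !dotvE !big_ord0 expr0n.
by apply: le_trans (dotv_CS x e) _; rewrite ue// mulr1.
Qed.

Lemma young (r a m x y : R) : 0 <= r <= a -> 0 < m ->
  x * (r * y) <= a / 2 * (m * x ^+ 2 + y ^+ 2 / m).
Proof.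
move=> /andP[r0 ra] m0.
have h : 2 * (x * y) <= m * x ^+ 2 + y ^+ 2 / m.
  rewrite -subr_ge0.
  have -> : m * x ^+ 2 + y ^+ 2 / m - 2 * (x * y) = (m * x - y) ^+ 2 / m.
    by field; rewrite gt_eqF.
  by rewrite divr_ge0 ?sqr_ge0// ltW.
have h0 : 0 <= m * x ^+ 2 + y ^+ 2 / m.
  by apply: addr_ge0; [apply: mulr_ge0|apply: divr_ge0] => //; rewrite ?sqr_ge0// ltW.
have := ler_wpM2l r0 h; have := ler_wpM2r h0 ra.
move: (m * x ^+ 2 + _) => S; nra.
Qed.

Section upper.
Variables (eps alpha beta mu nu : R) (Ag Aq Ar : set R).
Hypotheses (eps0 : 0 <= eps) (alpha0 : 0 <= alpha) (beta0 : 0 <= beta).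
Hypotheses (mu0 : 0 < mu) (nu0 : 0 < nu).
Hypotheses (Hg : forall z, Ag z -> z <= eps ^+ 2)
  (Hq : forall z, Aq z -> z <= beta ^+ 2) (Hr : forall z, Ar z -> z <= alpha ^+ 2).

(* The terms that Young's inequality leaves on the first coordinates of the next step
   are cancelled by the negative terms of the bound on the minor. *)
Lemma peel_upper k p n (G : 'M[R]_(p, n)) e f :
  unit_or_empty e -> unit_or_empty f -> (minn p n <= k)%N ->
  peel Ag Aq Ar k G e f -> forall x y,
  dotv x (G *m y) <= (beta / nu + alpha * mu + eps) / 2 * dotv x x +
    (alpha / mu + beta * nu + eps) / 2 * dotv y y -
    beta / nu / 2 * dotv x e ^+ 2 - alpha / mu / 2 * dotv y f ^+ 2.
Proof.
have bn : 0 <= beta / nu by rewrite divr_ge0// ltW.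
have am : 0 <= alpha / mu by rewrite divr_ge0// ltW.
have bn' : 0 <= beta * nu by rewrite mulr_ge0// ltW.
have am' : 0 <= alpha * mu by rewrite mulr_ge0// ltW.
(* Where the chain stops the form vanishes, and Bessel's inequality keeps the right-hand side
   nonnegative in spite of its negative terms. *)
have degenerate p' n' (G' : 'M[R]_(p', n')) e' f' x y : unit_or_empty e' ->
    unit_or_empty f' -> dotv x (G' *m y) = 0 ->
    dotv x (G' *m y) <= (beta / nu + alpha * mu + eps) / 2 * dotv x x +
    (alpha / mu + beta * nu + eps) / 2 * dotv y y -
    beta / nu / 2 * dotv x e' ^+ 2 - alpha / mu / 2 * dotv y f' ^+ 2.
  move=> ue uf ->; have hx := bessel x ue; have hy := bessel y uf.
  have x0 := dotvv_ge0 x; have y0 := dotvv_ge0 y.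
  rewrite -subr_ge0 in hx; rewrite -subr_ge0 in hy.
  have := mulr_ge0 bn hx; have := mulr_ge0 am hy; have := mulr_ge0 am' x0.
  have := mulr_ge0 bn' y0; have := mulr_ge0 eps0 x0; have := mulr_ge0 eps0 y0; lra.
have zero p' n' (G' : 'M[R]_(p', n')) x y : minn p' n' = 0%N -> dotv x (G' *m y) = 0.
  case: p' G' x => [|p'] G' x; first by rewrite dotvE big_ord0.
  case: n' G' y => [|n'] G' y; last by rewrite minnSS.
  by move=> _; rewrite dotvE big1 => // i _; rewrite mxE big_ord0 mulr0.
elim: k p n G e f => [|k IH] p n G e f ue uf.
  by rewrite leqn0 => /eqP pn _ x y; apply: degenerate => //; exact: zero.
case: p G e ue => [|p] G e ue.
  by move=> _ _ x y; apply: degenerate => //; apply: zero; rewrite min0n.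
case: n G f uf => [|n] G f uf.
  by move=> _ _ x y; apply: degenerate => //; apply: zero; rewrite minn0.
rewrite minnSS ltnS => kpn /=; set H := householder e *m G *m householder f.
move=> [/Hg Hgg /Hq Hqq /Hr Hrr /(IH _ _ _ _ _ _ _ kpn)].
move=> /(_ (fun h => normalize_unit (lcol H) h) (fun h => normalize_unit (urow H) h)) {}IH x y.
pose x' := householder e *m x; pose y' := householder f *m y.
have -> : dotv x (G *m y) = dotv x' (H *m y').
  by rewrite /H /x' /y' -!mulmxA householderK dotv_householder.
have -> : dotv x e = x' 0 0.
  by rewrite -(dotv_householder e) householder_mulmx ?ue// dotvC dotv_e0.
have -> : dotv y f = y' 0 0.
  by rewrite -(dotv_householder f) householder_mulmx ?uf// dotvC dotv_e0.
rewrite -(dotv_householder e x x) -(dotv_householder f y y) -/x' -/y' bilinear_recl.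
rewrite (dotv_recl x') (dotv_recl y') -!expr2.
have {}IH := IH (tailv x') (tailv y').
rewrite {1}(normalizeE (urow H)) {1}(normalizeE (lcol H)) !dotvZl.
set rr := Num.sqrt (dotv (urow H) _); set qq := Num.sqrt (dotv (lcol H) _).
have rra : 0 <= rr <= alpha.
  by rewrite sqrtr_ge0 -(ger0_norm alpha0) -sqrtr_sqr ler_wsqrtr.
have qqb : 0 <= qq <= beta.
  by rewrite sqrtr_ge0 -(ger0_norm beta0) -sqrtr_sqr ler_wsqrtr.
have hr := young (x' 0 0) (dotv (normalize (urow H)) (tailv y')) rra mu0.
have hq := young (y' 0 0) (dotv (normalize (lcol H)) (tailv x')) qqb nu0.
rewrite (dotvC (tailv x') (normalize _)) (dotvC (tailv y') (normalize _)) in IH.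
have hg : x' 0 0 * H 0 0 * y' 0 0 <= eps / 2 * (x' 0 0 ^+ 2 + y' 0 0 ^+ 2).
  have : `|H 0 0| <= eps by rewrite -(ger0_norm eps0) -!sqrtr_sqr ler_wsqrtr.
  rewrite ler_norml => /andP[h1 h2].
  have := sqr_ge0 (x' 0 0 - y' 0 0); have := sqr_ge0 (x' 0 0 + y' 0 0).
  by nra.
set X := x' 0 0 in hr hq hg *; set Y := y' 0 0 in hr hq hg *.
set DX := dotv (tailv x') (tailv x') in IH *; set DY := dotv (tailv y') (tailv y') in IH *.
set IX := dotv (normalize (lcol H)) _ in IH hq *.
set IY := dotv (normalize (urow H)) _ in IH hr *.
have er : alpha / 2 * (mu * X ^+ 2 + IY ^+ 2 / mu) =
  alpha * mu / 2 * X ^+ 2 + alpha / mu / 2 * IY ^+ 2 by ring.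
have eq : beta / 2 * (nu * Y ^+ 2 + IX ^+ 2 / nu) =
  beta * nu / 2 * Y ^+ 2 + beta / nu / 2 * IX ^+ 2 by ring.
rewrite er in hr; rewrite eq in hq; lra.
Qed.

End upper.

Section lower.
Variables (eps a b mu nu : R) (Ag Aq Ar : set R).
Hypotheses (eps0 : 0 <= eps) (a0 : 0 <= a) (b0 : 0 <= b).
Hypotheses (mu01 : 0 <= mu <= 1) (nu01 : 0 <= nu <= 1) (munu : mu * nu < 1).
Hypotheses (Hg : forall z, Ag z -> z <= eps ^+ 2)
  (Hq : forall z, Aq z -> b ^+ 2 <= z) (Hr : forall z, Ar z -> a ^+ 2 <= z).

(* The squared norm of the coordinates A, nu B, mu nu A, mu nu^2 B, ... that the test
   vector x has along the peeling chain (those of y are B, mu A, mu nu B, ...). *)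
Definition chain_sqnorm (mu nu A B : R) := (A ^+ 2 + nu ^+ 2 * B ^+ 2) / (1 - (mu * nu) ^+ 2).

(** A coordinate z of x is followed by mu z in y, which gives a mu z^2; a coordinate z of y is
    followed by nu z in x, which gives b nu z^2. *)
Definition chain_value A B :=
  a * mu * chain_sqnorm mu nu A B + b * nu * chain_sqnorm nu mu B A.

(* The part of chain_value due to the steps of the chain after the first j. *)
Fixpoint chain_tail j A B : R :=
  if j is j'.+1 then chain_tail j' (nu * B) (mu * A) else chain_value A B.

Let den0 : 0 < 1 - (mu * nu) ^+ 2.
Proof.
move: mu01 nu01 => /andP[m0 m1] /andP[n0 n1].
by rewrite subr_gt0 expr_lt1// mulr_ge0.
Qed.

Let den1 : 1 - (mu * nu) ^+ 2 != 0. Proof. by rewrite gt_eqF. Qed.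
Let den2 : 1 - (nu * mu) ^+ 2 != 0. Proof. by rewrite mulrC. Qed.

Lemma chain_sqnormE A B :
  chain_sqnorm mu nu A B = A ^+ 2 + chain_sqnorm mu nu (nu * B) (mu * A).
Proof. by rewrite /chain_sqnorm; field. Qed.

Lemma chain_sqnormE' A B :
  chain_sqnorm nu mu B A = B ^+ 2 + chain_sqnorm nu mu (mu * A) (nu * B).
Proof. by rewrite /chain_sqnorm; field. Qed.

Lemma chain_valueE A B : chain_value A B =
  a * mu * A ^+ 2 + b * nu * B ^+ 2 + chain_value (nu * B) (mu * A).
Proof. by rewrite /chain_value chain_sqnormE chain_sqnormE'; ring. Qed.

(** One step exchanges the roles of x and y, while two steps multiply both leading coordinates by mu
    nu. An even depth therefore scales the quadratic [chain_value] by a power of (mu nu)^2. *)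
Lemma chain_tail_double j A B :
  chain_tail j.*2 A B = ((mu * nu) ^+ 2) ^+ j * chain_value A B.
Proof.
elim: j A B => [|j IH] A B; first by rewrite mul1r.
have E : chain_value (nu * (mu * A)) (mu * (nu * B)) = (mu * nu) ^+ 2 * chain_value A B.
  by rewrite /chain_value /chain_sqnorm; field.
by rewrite doubleS /= IH E (exprSr (_ ^+ 2)) mulrA.
Qed.

(** The test vectors are built from the far end of the chain: multiples of [e] and [f] at the last
    step, then one coordinate prepended in the Householder basis at each earlier one. As A and B
    stay in [0, 1], a corner entry costs at most eps. At j = 0 the tail is the whole value and only
    the corner is left. *)
Lemma peel_lower j p n (G : 'M[R]_(p, n)) e f :
  unit_or_empty e -> unit_or_empty f -> (j < p)%N -> (j < n)%N ->
  peel Ag Aq Ar j.+1 G e f -> forall A B, 0 <= A <= 1 -> 0 <= B <= 1 ->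
  exists x y, [/\ dotv x e = A, dotv y f = B,
    dotv x x <= chain_sqnorm mu nu A B, dotv y y <= chain_sqnorm nu mu B A &
    chain_value A B - chain_tail j A B - j.+1%:R * eps <= dotv x (G *m y)].
Proof.
move: mu01 nu01 => /andP[m0 m1] /andP[n0 n1].
have sq0 A B : 0 <= chain_sqnorm mu nu A B.
  by apply: divr_ge0; [apply: addr_ge0; rewrite -?exprMn sqr_ge0|exact: ltW].
have sq0' A B : 0 <= chain_sqnorm nu mu A B.
  by apply: divr_ge0; [apply: addr_ge0; rewrite -?exprMn sqr_ge0|rewrite mulrC; exact: ltW].
elim: j p n G e f => [|j IH] [|p] // [|n] // G e f ue uf jp jn.
- move=> [/Hg Hgg _ _ _] A B /andP[A0 A1] /andP[B0 B1].
  set H := householder e *m G *m householder f in Hgg.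
  exists (A *: e), (B *: f); rewrite !dotvZl !dotvZr ue// uf// !mulr1 -!expr2.
  have sA : A ^+ 2 <= chain_sqnorm mu nu A B by rewrite chain_sqnormE lerDl.
  have sB : B ^+ 2 <= chain_sqnorm nu mu B A by rewrite chain_sqnormE' lerDl.
  split => //=.
  rewrite subrr sub0r mul1r.
  have -> : dotv e (G *m (B *: f)) = B * H 0 0.
    have HE : H 0 0 = dotv (e0 p) (H *m e0 n) by rewrite dotv_e0 /e0 -colE [RHS]mxE.
    rewrite -scalemxAr dotvZr HE -(householder_mulmx (ue isT)) -(householder_mulmx (uf isT)).
    by rewrite /H -!mulmxA householderK dotv_householder.
  have : `|H 0 0| <= eps by rewrite -(ger0_norm eps0) -!sqrtr_sqr ler_wsqrtr.
  rewrite ler_norml => /andP[h1 h2].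
  have AB : 0 <= A * B <= 1 by rewrite mulr_ge0//= mulr_ile1.
  by rewrite mulrA; nra.
rewrite /=; set H := householder e *m G *m householder f.
move=> [/Hg Hgg /Hq Hqq /Hr Hrr /IH].
move=> /(_ (fun h => normalize_unit (lcol H) h) (fun h => normalize_unit (urow H) h) jp jn) {}IH.
move=> A B /andP[A0 A1] /andP[B0 B1].
have [||x' [y' [xe yf xx yy xy]]] := IH (nu * B) (mu * A).
- by rewrite mulr_ge0//= mulr_ile1.
- by rewrite mulr_ge0//= mulr_ile1.
exists (householder e *m consv A x'), (householder f *m consv B y'); rewrite !dotv_householder.
rewrite !(dotv_recl (consv _ _) (consv _ _)) !tailv_consv !consv0 -!expr2.
split.
- by rewrite -{2}(householderK e e) dotv_householder householder_mulmx ?ue// dotvC dotv_e0 consv0.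
- by rewrite -{2}(householderK f f) dotv_householder householder_mulmx ?uf// dotvC dotv_e0 consv0.
- by rewrite chain_sqnormE lerD2l.
- by rewrite chain_sqnormE' lerD2l.
have -> : dotv (householder e *m consv A x') (G *m (householder f *m consv B y')) =
    dotv (consv A x') (H *m consv B y').
  by rewrite /H -!mulmxA -dotv_householderr.
rewrite bilinear_recl !tailv_consv !consv0.
rewrite {1}(normalizeE (urow H)) {1}(normalizeE (lcol H)) !dotvZl.
set rr := Num.sqrt (dotv (urow H) _); set qq := Num.sqrt (dotv (lcol H) _).
have rra : a <= rr by rewrite -(ger0_norm a0) -sqrtr_sqr ler_wsqrtr.
have qqb : b <= qq by rewrite -(ger0_norm b0) -sqrtr_sqr ler_wsqrtr.
rewrite (dotvC (normalize (lcol H))) xe (dotvC (normalize (urow H))) yf.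
have : `|H 0 0| <= eps by rewrite -(ger0_norm eps0) -!sqrtr_sqr ler_wsqrtr.
rewrite ler_norml => /andP[h1 h2].
have AB : 0 <= A * B <= 1 by rewrite mulr_ge0//= mulr_ile1.
have hg : - eps <= A * H 0 0 * B by rewrite mulrAC; nra.
have hr : a * mu * A ^+ 2 <= A * (rr * (mu * A)).
  have -> : A * (rr * (mu * A)) = rr * (mu * A ^+ 2) by ring.
  by rewrite -mulrA ler_wpM2r// mulr_ge0// sqr_ge0.
have hq : b * nu * B ^+ 2 <= B * (qq * (nu * B)).
  have -> : B * (qq * (nu * B)) = qq * (nu * B ^+ 2) by ring.
  by rewrite -mulrA ler_wpM2r// mulr_ge0// sqr_ge0.
rewrite (chain_valueE A B) -(natr1 j.+1); lra.
Qed.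

End lower.
End peeling_bounds.

(** * Singular values and the norm of a rank-two matrix *)

Section singular_values.
Context {R : realType}.

Lemma continuous_sqnorm_mulmx m n (A : 'M[R]_(m, n)) :
  continuous (fun r : 'rV[R]_n => dotv (A *m r^T) (A *m r^T)).
Proof.
have addc : continuous (fun z : R * R => z.1 + z.2) by exact: add_continuous.
have -> : (fun r : 'rV[R]_n => dotv (A *m r^T) (A *m r^T)) =
    (fun r => \sum_i ((\sum_j A i j * r 0 j) * (\sum_j A i j * r 0 j))).
  apply/funext => r; rewrite dotvE; apply: eq_bigr => i _.
  by rewrite mxE; congr (_ * _); apply: eq_bigr => j _; rewrite mxE.
apply: (continuous_big addc) => i _ r.
have c : continuous (fun r : 'rV[R]_n => \sum_j A i j * r 0 j).
  apply: (continuous_big addc) => j _ r'.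
  exact: (cvgM (cvg_cst (A i j)) (@coord_continuous _ _ _ 0 j r')).
exact: (cvgM (c r) (c r)).
Qed.

(** The unit sphere is compact, and [y] witnesses that it is not empty; homogeneity extends the
    maximality to all vectors. *)
Lemma sqnorm_mulmx_max m n (A : 'M[R]_(m, n)) (y : 'cV[R]_n) : dotv y y = 1 ->
  exists z : 'cV[R]_n, dotv z z = 1 /\
    forall x, dotv (A *m x) (A *m x) <= dotv (A *m z) (A *m z) * dotv x x.
Proof.
move=> y1; pose N (r : 'rV[R]_n) := dotv r^T r^T.
have cN : continuous N.
  have -> : N = fun r => dotv (1%:M *m r^T) (1%:M *m r^T).
    by apply/funext => r; rewrite mul1mx.
  exact: (@continuous_sqnorm_mulmx n n).
pose S : set 'rV[R]_n := N @^-1` [set x | x = 1].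
have S0 : S !=set0 by exists y^T; rewrite /S/= /N trmxK.
have cS : compact S.
  apply: (@subclosed_compact _ S [set r : 'rV[R]_n | forall i, `[-1, 1]%classic (r ord0 i)]).
  - exact: ((continuous_closedP N).1 cN _ (@closed_eq R 1)).
  - have := @rV_compact R n (fun=> `[-1, 1]%classic) (fun=> @segment_compact R (-1) 1).
    exact.
  - move=> r; rewrite /S/= /N => r1 i; rewrite in_itv/= -ler_norml.
    rewrite -(@expr_le1 _ 2)// real_normK ?num_real// -r1 dotvE (bigD1 i)//= !mxE -expr2.
    by rewrite lerDl sumr_ge0// => j _; rewrite -expr2 sqr_ge0.
have cf : {within S, continuous (fun r : 'rV[R]_n => dotv (A *m r^T) (A *m r^T))}.
  by apply: continuous_subspaceT => r; exact: continuous_sqnorm_mulmx.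
have [r rS rmax] := EVT_max_rV S0 cS cf.
exists r^T; split; first by rewrite inE in rS.
move=> x; have [->|x0] := eqVneq x 0.
  by rewrite mulmx0 /dotv !mulmx0 mxE mulr0.
have xx : 0 < dotv x x by rewrite lt_def dotvv_eq0 x0 dotvv_ge0.
pose k := (Num.sqrt (dotv x x))^-1.
have kk : k ^+ 2 * dotv x x = 1 by rewrite exprVn sqr_sqrtr ?mulVf ?gt_eqF// ltW.
have /rmax : (k *: x)^T \in S.
  by rewrite inE /S/= /N trmxK dotvZl dotvZr mulrA -expr2.
rewrite trmxK -scalemxAr dotvZl dotvZr mulrA -expr2 => h.
by rewrite -(ler_pM2l (_ : 0 < k ^+ 2)) ?exprn_gt0 ?invr_gt0 ?sqrtr_gt0// mulrCA kk mulr1.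
Qed.

(** Moving z by e w, where w is the residue of the eigenvalue equation, gains 2 e |w|^2 to first
    order, against at most e^2 M |w|^2 at second order. *)
Lemma sqnorm_maximizer_eigen m n (A : 'M[R]_(m, n)) (z : 'cV[R]_n) : dotv z z = 1 ->
  (forall x, dotv (A *m x) (A *m x) <= dotv (A *m z) (A *m z) * dotv x x) ->
  A^T *m (A *m z) = dotv (A *m z) (A *m z) *: z.
Proof.
set M := dotv (A *m z) _ => z1 zmax.
have [w wE] : exists w, w = A^T *m (A *m z) - M *: z by exists (A^T *m (A *m z) - M *: z).
suff : dotv w w == 0 by rewrite dotvv_eq0 wE subr_eq0 => /eqP.
have ww := dotvv_ge0 w.
have key (e : R) : 2 * e * dotv w w <= e ^+ 2 * (M * dotv w w).
  have := zmax (z + e *: w).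
  rewrite mulmxDr -scalemxAr !(dotvDl, dotvDr, dotvZl, dotvZr) -/M z1.
  rewrite (dotvC (A *m w)) (dotvC w z).
  have -> : dotv (A *m z) (A *m w) = dotv w w + M * dotv z w.
    by rewrite dotv_mulmx -(subrK (M *: z) (A^T *m _)) -wE dotvDl dotvZl.
  have := dotvv_ge0 (A *m w); set a := dotv (A *m w) _; set b := dotv z w.
  by move=> a0; have := sqr_ge0 e; nra.
have M0 : 0 <= M by exact: dotvv_ge0.
(* With e = 1 / (M + 1) one has e M = 1 - e, and the inequality becomes e (1 + e) |w|^2 <= 0. *)
rewrite eq_le ww andbT; have := key (M + 1)^-1.
set e := _^-1; have e0 : 0 < e by rewrite invr_gt0 ltr_wpDl.
have eM : e * (M + 1) = 1 by rewrite mulVf// gt_eqF// ltr_wpDl.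
have -> : e ^+ 2 * (M * dotv w w) = e * (e * M) * dotv w w by ring.
have -> : e * M = 1 - e by rewrite -eM; ring.
rewrite -subr_ge0 => h.
have {h} : 0 <= e * (1 + e) * (- dotv w w).
  by apply: le_trans h _; rewrite le_eqVlt; apply/orP; left; apply/eqP; ring.
by rewrite pmulr_rge0 ?oppr_ge0// mulr_gt0// addr_gt0.
Qed.

(** The definition compares s only with other singular values, so the maximum of the form has to be
    realized by a singular triple: the maximizer z of |A z|, with A z / |A z|. If A z = 0 the form
    is at most 0. *)
Lemma top_singular_vectors_max m n (A : 'M[R]_(m, n)) x y :
  top_singular_vectors A x y ->
  [/\ dotv x x = 1, dotv y y = 1 & forall x' y', dotv x' x' <= 1 -> dotv y' y' <= 1 ->
    dotv x' (A *m y') <= dotv x (A *m y)].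
Proof.
move=> [s [s0 /l2norm_eq1 x1 /l2norm_eq1 y1 Ay Ax] smax]; split => // x' y' hx hy.
have -> : dotv x (A *m y) = s by rewrite Ay dotvZr x1 mulr1.
have [z [z1 zmax]] := sqnorm_mulmx_max A y1.
set M := dotv (A *m z) _ in zmax.
have M0 : 0 <= M by exact: dotvv_ge0.
have le_sM : dotv x' (A *m y') <= Num.sqrt M.
  apply: le_trans (ler_norm _) _; rewrite -sqrtr_sqr ler_wsqrtr//.
  apply: le_trans (dotv_CS _ _) _; rewrite -[leRHS]mul1r ler_pM ?dotvv_ge0//.
  by apply: le_trans (zmax y') _; rewrite -[leRHS]mulr1 ler_wpM2l.
apply: le_trans le_sM _; have [->|Mn0] := eqVneq M 0; first by rewrite sqrtr0.
have Mgt0 : 0 < M by rewrite lt_def Mn0.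
apply: (smax (Num.sqrt M) ((Num.sqrt M)^-1 *: (A *m z)) z).
have sM : Num.sqrt M != 0 by rewrite gt_eqF// sqrtr_gt0.
split.
- exact: sqrtr_ge0.
- apply/l2norm_eq1; rewrite dotvZl dotvZr -/M mulrA -expr2 exprVn.
  by rewrite sqr_sqrtr// mulVf.
- exact/l2norm_eq1.
- by rewrite scalerA divff// scale1r.
- rewrite -scalemxAr (sqnorm_maximizer_eigen z1 zmax) scalerA -/M.
  by rewrite -{2}(sqr_sqrtr M0) expr2 mulKf.
Qed.

Lemma opnorm_eq m n (A : 'M[R]_(m, n)) (s : R) : 0 <= s ->
  (forall z, dotv (A *m z) (A *m z) <= s ^+ 2 * dotv z z) ->
  (exists2 z, dotv z z = 1 & dotv (A *m z) (A *m z) = s ^+ 2) ->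
  opnorm A = s.
Proof.
move=> s0 sub [z z1 zs]; rewrite /opnorm; set E := [set _ | _ in _].
have Es : E s.
  exists z; first by rewrite /= (l2norm_eq1 z).2.
  by rewrite l2normE zs sqrtr_sqr ger0_norm.
have ubs : ubound E s.
  move=> _ [x /= x1 <-]; rewrite l2normE -(ger0_norm s0) -sqrtr_sqr ler_wsqrtr//.
  apply: le_trans (sub x) _; rewrite -[leRHS]mulr1 ler_wpM2l ?sqr_ge0//.
  by rewrite -sqr_l2norm expr_le1// l2norm_ge0.
apply/eqP; rewrite eq_le; apply/andP; split.
  by apply: ge_sup => //; exists s.
by apply: ub_le_sup => //; exists s.
Qed.

Definition top_root (S D : R) := (S + Num.sqrt (S ^+ 2 - 4 * D)) / 2.

Lemma le_top_root S D X : X ^+ 2 - S * X + D <= 0 -> X <= top_root S D.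
Proof.
move=> h; rewrite ler_pdivlMr// addrC -lerBlDr.
apply: le_trans (ler_norm _) _; rewrite -sqrtr_sqr ler_wsqrtr//.
by rewrite -subr_ge0; nra.
Qed.

Lemma top_rootE S D : 0 <= S ^+ 2 - 4 * D ->
  top_root S D ^+ 2 - S * top_root S D + D = 0.
Proof.
move=> h; rewrite /top_root; set r := Num.sqrt _.
have rr : r ^+ 2 = S ^+ 2 - 4 * D by rewrite sqr_sqrtr.
have -> : ((S + r) / 2) ^+ 2 - S * ((S + r) / 2) + D = (r ^+ 2 - (S ^+ 2 - 4 * D)) / 4.
  by field.
by rewrite rr subrr mul0r.
Qed.

(** Trace, and next determinant, of M^T M on the span of y and v, for M = q x y^T - t u v^T. The
    arguments X, Y, Z stand for A B, A^2, B^2 and are kept separate because these are the quantities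
    that converge. *)
Definition rank2_trace (q t X : R) := q ^+ 2 + t ^+ 2 - 2 * q * t * X.
Definition rank2_det (q t Y Z : R) := q ^+ 2 * t ^+ 2 * (1 - Y) * (1 - Z).

(** With w = q t, the trace is at least 2 (|w| - w A B), while the determinant equals (|w| - w A
    B)^2 - (|w| A - w B)^2. *)
Lemma rank2_discr (q t A B : R) : A ^+ 2 <= 1 -> B ^+ 2 <= 1 ->
  0 <= rank2_trace q t (A * B) /\
  0 <= rank2_trace q t (A * B) ^+ 2 - 4 * rank2_det q t (A ^+ 2) (B ^+ 2).
Proof.
move=> A1 B1; rewrite /rank2_trace /rank2_det.
have X1 : `|A * B| <= 1.
  rewrite -(@expr_le1 _ 2)// real_normK ?num_real// exprMn.
  by rewrite mulr_ile1 ?sqr_ge0.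
set w := q * t.
have ww : `|w| ^+ 2 = w ^+ 2 by rewrite real_normK ?num_real.
have hw : 2 * `|w| <= q ^+ 2 + t ^+ 2.
  have := sqr_ge0 (q - t); have := sqr_ge0 (q + t); rewrite /w.
  by case: (ger0P (q * t)) => _; lra.
have hX : w * (A * B) <= `|w|.
  apply: le_trans (ler_norm _) _; rewrite normrM -[leRHS]mulr1 ler_wpM2l//.
have -> : 2 * q * t * (A * B) = 2 * (w * (A * B)) by rewrite /w; ring.
set S := q ^+ 2 + t ^+ 2 - _.
have hS : 2 * (`|w| - w * (A * B)) <= S by rewrite /S; lra.
have h0 : 0 <= `|w| - w * (A * B) by rewrite subr_ge0.
split; first by lra.
have -> : 4 * (q ^+ 2 * t ^+ 2 * (1 - A ^+ 2) * (1 - B ^+ 2)) =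
  4 * ((`|w| - w * (A * B)) ^+ 2 - (`|w| * A - w * B) ^+ 2).
  have -> : (`|w| - w * (A * B)) ^+ 2 - (`|w| * A - w * B) ^+ 2 =
    `|w| ^+ 2 * (1 - A ^+ 2) + w ^+ 2 * (A ^+ 2 * B ^+ 2 - B ^+ 2) by ring.
  by rewrite ww /w; ring.
have := sqr_ge0 (`|w| * A - w * B).
have : (2 * (`|w| - w * (A * B))) ^+ 2 <= S ^+ 2.
  by rewrite ler_pXn2r ?nnegrE//; lra.
lra.
Qed.

(** Bessel's inequality for the non-orthogonal pair y, v, multiplied by its Gram determinant 1 -
    B^2. *)
Lemma gram_ge p (y v z : 'cV[R]_p) : dotv y y = 1 -> dotv v v = 1 ->
  let B := dotv y v in let h := dotv y z in let k := dotv v z in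
  0 < 1 - B ^+ 2 -> h ^+ 2 + k ^+ 2 - 2 * B * h * k <= (1 - B ^+ 2) * dotv z z.
Proof.
move=> y1 v1 B h k B1; rewrite -subr_ge0 -(pmulr_rge0 _ B1).
apply: le_trans (dotvv_ge0 ((1 - B ^+ 2) *: z - (h - B * k) *: y - (k - B * h) *: v)) _.
rewrite le_eqVlt; apply/orP; left; apply/eqP.
rewrite !(dotvDl, dotvDr, dotvNl, dotvNr, dotvZl, dotvZr) y1 v1.
rewrite (dotvC z y) (dotvC z v) (dotvC v y) -/B -/h -/k; ring.
Qed.

Section rank2_norm.
Variables (m n : nat) (q t : R) (x u : 'cV[R]_m) (y v : 'cV[R]_n).
Hypotheses (x1 : dotv x x = 1) (u1 : dotv u u = 1).
Hypotheses (y1 : dotv y y = 1) (v1 : dotv v v = 1).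
Let A := dotv x u.
Let B := dotv y v.
Let M : 'M[R]_(m, n) := q *: (x *m y^T) - t *: (u *m v^T).
Let S := rank2_trace q t (A * B).
Let D := rank2_det q t (A ^+ 2) (B ^+ 2).

Let A1 : A ^+ 2 <= 1.
Proof. by apply: le_trans (dotv_CS _ _) _; rewrite x1 u1 mulr1. Qed.

Let B1 : B ^+ 2 <= 1.
Proof. by apply: le_trans (dotv_CS _ _) _; rewrite y1 v1 mulr1. Qed.

Lemma rank2_mulmx z : dotv (M *m z) (M *m z) =
  q ^+ 2 * dotv y z ^+ 2 + t ^+ 2 * dotv v z ^+ 2 -
  2 * q * t * A * dotv y z * dotv v z.
Proof.
have E (m' n' : nat) (a : 'cV[R]_m') (b w : 'cV[R]_n') : a *m b^T *m w = dotv b w *: a.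
  by rewrite -mulmxA [b^T *m w]mx11_scalar mul_mx_scalar.
rewrite /M mulmxBl -!scalemxAl !E.
rewrite !(dotvDl, dotvDr, dotvNl, dotvNr, dotvZl, dotvZr) x1 u1 (dotvC u x) -/A; ring.
Qed.

Let top := top_root S D.

Let topE : top ^+ 2 - S * top + D = 0.
Proof. by apply: top_rootE; have [] := rank2_discr q t A1 B1. Qed.

Let S0 : 0 <= S. Proof. by have [] := rank2_discr q t A1 B1. Qed.

Let top0 : 0 <= top.
Proof. by rewrite /top /top_root divr_ge0// addr_ge0// sqrtr_ge0. Qed.

(** Coefficients of the quadratic form of [formE] in h = <y, z> and k = <v, z>, which compares top
    |z|^2 with |M z|^2 on the span of y and v. As [top] is a root of the characteristic polynomial,
    the form is degenerate: positivity yields the bound on the norm, and a kernel vector attains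
    it. *)
Let a := top - (1 - B ^+ 2) * q ^+ 2.
Let c := top - (1 - B ^+ 2) * t ^+ 2.
Let b := (1 - B ^+ 2) * q * t * A - top * B.

(** The characteristic polynomial is nonpositive at (1 - B^2) q^2, which hence lies below the larger
    root. *)
Let a0 : 0 <= a.
Proof.
rewrite subr_ge0; apply: le_top_root; rewrite /S /D /rank2_trace /rank2_det.
have -> : ((1 - B ^+ 2) * q ^+ 2) ^+ 2 -
   (q ^+ 2 + t ^+ 2 - 2 * q * t * (A * B)) * ((1 - B ^+ 2) * q ^+ 2) +
   q ^+ 2 * t ^+ 2 * (1 - A ^+ 2) * (1 - B ^+ 2) =
  - ((1 - B ^+ 2) * (q * (q * B - t * A)) ^+ 2) by ring.
by rewrite oppr_le0 mulr_ge0 ?sqr_ge0// subr_ge0.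
Qed.

Let c0 : 0 <= c.
Proof.
rewrite subr_ge0; apply: le_top_root; rewrite /S /D /rank2_trace /rank2_det.
have -> : ((1 - B ^+ 2) * t ^+ 2) ^+ 2 -
   (q ^+ 2 + t ^+ 2 - 2 * q * t * (A * B)) * ((1 - B ^+ 2) * t ^+ 2) +
   q ^+ 2 * t ^+ 2 * (1 - A ^+ 2) * (1 - B ^+ 2) =
  - ((1 - B ^+ 2) * (t * (t * B - q * A)) ^+ 2) by ring.
by rewrite oppr_le0 mulr_ge0 ?sqr_ge0// subr_ge0.
Qed.

Let acb : a * c = b ^+ 2.
Proof.
apply/eqP; rewrite -subr_eq0.
have -> : a * c - b ^+ 2 = (1 - B ^+ 2) * (top ^+ 2 - S * top + D).
  by rewrite /a /b /c /S /D /rank2_trace /rank2_det; ring.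
by rewrite topE mulr0.
Qed.

Let formE h k : top * (h ^+ 2 + k ^+ 2 - 2 * B * h * k) -
    (1 - B ^+ 2) * (q ^+ 2 * h ^+ 2 + t ^+ 2 * k ^+ 2 - 2 * q * t * A * h * k) =
  a * h ^+ 2 + 2 * b * h * k + c * k ^+ 2.
Proof. by rewrite /a /b /c; ring. Qed.

Let form_ge0 h k : 0 <= a * h ^+ 2 + 2 * b * h * k + c * k ^+ 2.
Proof.
have [a_eq0|an0] := eqVneq a 0.
  have /eqP : b ^+ 2 = 0 by rewrite -acb a_eq0 mul0r.
  rewrite sqrf_eq0 => /eqP ->; rewrite a_eq0 !(mul0r, mulr0) !add0r.
  by rewrite mulr_ge0// sqr_ge0.
have agt : 0 < a by rewrite lt_def an0.
rewrite -(pmulr_rge0 _ agt).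
have -> : a * (a * h ^+ 2 + 2 * b * h * k + c * k ^+ 2) =
  (a * h + b * k) ^+ 2 + (a * c - b ^+ 2) * k ^+ 2 by ring.
by rewrite acb subrr mul0r addr0 sqr_ge0.
Qed.

Lemma opnorm_rank2 : opnorm M = Num.sqrt top.
Proof.
apply: opnorm_eq; rewrite ?sqrtr_ge0// sqr_sqrtr//.
- move=> z; rewrite rank2_mulmx.
  (* Here v = y or v = - y, so the Gram matrix is singular; M has rank at most one and its squared
     norm is the trace. *)
  have [BB|BB] := eqVneq (1 - B ^+ 2) 0.
    have vE : v = B *: y.
      apply/eqP; rewrite -subr_eq0 -dotvv_eq0.
      rewrite !(dotvDl, dotvDr, dotvNl, dotvNr, dotvZl, dotvZr) y1 v1 (dotvC v y) -/B.
      by apply/eqP; rewrite -[RHS]BB; ring.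
    have hz : dotv y z ^+ 2 <= dotv z z.
      by apply: le_trans (dotv_CS _ _) _; rewrite y1 mul1r.
    have St : S <= top.
      apply: le_top_root; rewrite /D /rank2_det BB mulr0 addr0; nra.
    rewrite vE dotvZl; apply: (@le_trans _ _ (S * dotv y z ^+ 2)); last first.
      by rewrite ler_pM// sqr_ge0.
    rewrite le_eqVlt; apply/orP; left; apply/eqP.
    have B2 : B ^+ 2 = 1 by apply/eqP; rewrite eq_sym -subr_eq0 BB.
    rewrite exprMn B2 mul1r /S /rank2_trace; ring.
  have P0 : 0 < 1 - B ^+ 2 by rewrite lt_def BB subr_ge0.
  rewrite -(ler_pM2l P0); have := gram_ge z y1 v1 P0; rewrite /= -/B => g.
  have := form_ge0 (dotv y z) (dotv v z); rewrite -formE subr_ge0 => h.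
  by apply: le_trans h _; rewrite mulrCA ler_wpM2l.
have [BB|BB] := eqVneq (1 - B ^+ 2) 0.
  exists y => //; rewrite rank2_mulmx y1 (dotvC v y) -/B.
  have B2 : B ^+ 2 = 1 by apply/eqP; rewrite eq_sym -subr_eq0 BB.
  have -> : top = S.
    rewrite /top /top_root /D /rank2_det BB mulr0 mulr0 subr0 sqrtr_sqr ger0_norm//.
    by field.
  by rewrite B2 /S /rank2_trace; ring.
have P0 : 0 < 1 - B ^+ 2 by rewrite lt_def BB subr_ge0.
(* A kernel vector of the degenerate form: (- b, a), or (1, 0) when a = 0. *)
have [h [k [hk f0]]] : exists h k, (h != 0 \/ k != 0) /\
    a * h ^+ 2 + 2 * b * h * k + c * k ^+ 2 = 0.
  have [a_eq0|an0] := eqVneq a 0.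
    exists 1, 0; split; first by left; exact: oner_neq0.
    by rewrite a_eq0; ring.
  exists (- b), a; split; first by right.
  have -> : a * (- b) ^+ 2 + 2 * b * - b * a + c * a ^+ 2 = a * (a * c - b ^+ 2) by ring.
  by rewrite acb subrr mulr0.
(* The vector of the span of y and v whose products with y and v are h and k. *)
pose z := (1 - B ^+ 2)^-1 *: ((h - B * k) *: y + (k - B * h) *: v).
have yz : dotv y z = h.
  rewrite /z !(dotvDr, dotvZr) y1 -/B.
  by field.
have vz : dotv v z = k.
  rewrite /z !(dotvDr, dotvZr) v1 (dotvC v y) -/B.
  by field.
have z0 : z != 0.
  apply/eqP => z0; case: hk; rewrite -?yz -?vz z0 /dotv mulmx0 mxE eqxx//.
have zz : 0 < dotv z z by rewrite lt_def dotvv_eq0 z0 dotvv_ge0.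
have zE : (1 - B ^+ 2) * dotv z z = h ^+ 2 + k ^+ 2 - 2 * B * h * k.
  rewrite {1}/z dotvZl dotvDl !dotvZl yz vz; field.
  exact: BB.
have Mz : dotv (M *m z) (M *m z) = top * dotv z z.
  rewrite rank2_mulmx yz vz; apply: (mulfI BB).
  rewrite [RHS]mulrCA zE; apply/esym/eqP; rewrite -subr_eq0 formE; exact/eqP.
pose r := (Num.sqrt (dotv z z))^-1.
have rr : r * r * dotv z z = 1.
  by rewrite -expr2 exprVn sqr_sqrtr ?mulVf ?gt_eqF// ltW.
exists (r *: z); first by rewrite dotvZl dotvZr mulrA.
by rewrite -scalemxAr dotvZl dotvZr Mz mulrA mulrCA rr mulr1.
Qed.

End rank2_norm.

End singular_values.

(** * From bounds on the top singular value to overlaps and losses *)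

Section spike_parameters.
Context {R : realType}.
Variables (gamma t c ctilde : R).
Hypotheses (gamma_ge0 : 0 <= gamma) (t_gt0 : 0 < t)
  (t_supercritical : gamma `^ (4%:R^-1) < t)
  (c_ge0 : 0 <= c) (ctilde_ge0 : 0 <= ctilde)
  (c_def : c ^+ 2 = (1 - gamma / t ^+ 4) / (1 + gamma / t ^+ 2))
  (ctilde_def : ctilde ^+ 2 = (1 - gamma / t ^+ 4) / (1 + 1 / t ^+ 2)).

Lemma gamma_lt_t4 : gamma < t ^+ 4.
Proof.
have -> : gamma = (gamma `^ (4%:R^-1)) ^+ 4.
  by rewrite -powR_mulrn ?powR_ge0// -powRrM mulVf ?pnatr_eq0// powRr1.
by rewrite ltr_pXn2r// ?nnegrE ?powR_ge0// ltW.
Qed.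

Let t2 : 0 < t ^+ 2. Proof. by rewrite exprn_gt0. Qed.
Let t_ge0 : 0 <= t. Proof. exact: ltW. Qed.
Let t0 : t != 0. Proof. by rewrite gt_eqF. Qed.

Let c2E : c ^+ 2 * (t ^+ 2 * (t ^+ 2 + gamma)) = t ^+ 4 - gamma.
Proof. by rewrite c_def; field; rewrite t0/= gt_eqF// ltr_wpDr. Qed.

Let ct2E : ctilde ^+ 2 * (t ^+ 2 * (t ^+ 2 + 1)) = t ^+ 4 - gamma.
Proof. by rewrite ctilde_def; field; rewrite t0/= gt_eqF// ltr_wpDr. Qed.

Let tg : 0 < t ^+ 2 * (t ^+ 2 + gamma).
Proof. by rewrite mulr_gt0// ltr_wpDr. Qed.

Let t1 : 0 < t ^+ 2 * (t ^+ 2 + 1).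
Proof. by rewrite mulr_gt0// ltr_wpDr. Qed.

Lemma c_gt0 : 0 < c.
Proof.
rewrite lt_def c_ge0 andbT -sqrf_eq0; apply/eqP => c20.
have := c2E; rewrite c20 mul0r; have := gamma_lt_t4; lra.
Qed.

Lemma ctilde_gt0 : 0 < ctilde.
Proof.
rewrite lt_def ctilde_ge0 andbT -sqrf_eq0; apply/eqP => c20.
have := ct2E; rewrite c20 mul0r; have := gamma_lt_t4; lra.
Qed.

Definition spike_mu := Num.sqrt (1 - ctilde ^+ 2).
Definition spike_nu := Num.sqrt (1 - c ^+ 2).
Local Notation mu := spike_mu.
Local Notation nu := spike_nu.

Let mu2E : (1 - ctilde ^+ 2) * (t ^+ 2 * (t ^+ 2 + 1)) = t ^+ 2 + gamma.
Proof. by rewrite mulrBl ct2E; ring. Qed.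

Let nu2E : (1 - c ^+ 2) * (t ^+ 2 * (t ^+ 2 + gamma)) = gamma * (1 + t ^+ 2).
Proof. by rewrite mulrBl c2E; ring. Qed.

Let mu2_gt0 : 0 < 1 - ctilde ^+ 2.
Proof. by rewrite -(pmulr_lgt0 _ t1) mu2E ltr_wpDr. Qed.

Let nu2_ge0 : 0 <= 1 - c ^+ 2.
Proof. by rewrite -(pmulr_lge0 _ tg) nu2E mulr_ge0// addr_ge0// ltW. Qed.

Lemma sqr_mu : mu ^+ 2 = 1 - ctilde ^+ 2. Proof. by rewrite sqr_sqrtr// ltW. Qed.
Lemma sqr_nu : nu ^+ 2 = 1 - c ^+ 2. Proof. by rewrite sqr_sqrtr. Qed.
Lemma mu_gt0 : 0 < mu. Proof. by rewrite sqrtr_gt0. Qed.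
Lemma nu_ge0 : 0 <= nu. Proof. exact: sqrtr_ge0. Qed.

Lemma mu_lt1 : mu < 1.
Proof.
rewrite -(@expr_lt1 _ 2)// ?sqr_mu; last exact: sqrtr_ge0.
by rewrite gtrBl exprn_gt0// ctilde_gt0.
Qed.

Lemma nu_lt1 : nu < 1.
Proof.
rewrite -(@expr_lt1 _ 2)// ?sqr_nu; last exact: sqrtr_ge0.
by rewrite gtrBl exprn_gt0// c_gt0.
Qed.

Lemma c_le1 : c <= 1. Proof. by rewrite -(@expr_le1 _ 2)// -subr_ge0. Qed.
Lemma ctilde_lt1 : ctilde < 1. Proof. by rewrite -(@expr_lt1 _ 2)// -subr_gt0. Qed.

(** In the limit the equation Y^T x = s y reads (s - sqrt gamma nu) ctilde = t c at the first
    coordinate of the chain and (s - sqrt gamma nu) mu = 1 at the later ones; this is what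
    eliminating s leaves. [t2_mu_nu] comes likewise from Y y = s x. *)
Lemma t_mu_c : t * mu * c = ctilde.
Proof.
apply/eqP; rewrite -(@eqrXn2 _ 2)// ?mulr_ge0// ?sqrtr_ge0 ?(ltW t_gt0)//.
rewrite !exprMn sqr_mu; apply/eqP.
apply: (mulIf (lt0r_neq0 tg)); apply: (mulIf (lt0r_neq0 t1)).
transitivity (t ^+ 2 * ((1 - ctilde ^+ 2) * (t ^+ 2 * (t ^+ 2 + 1))) *
  (c ^+ 2 * (t ^+ 2 * (t ^+ 2 + gamma)))); first by ring.
rewrite mu2E c2E.
transitivity (ctilde ^+ 2 * (t ^+ 2 * (t ^+ 2 + 1)) * (t ^+ 2 * (t ^+ 2 + gamma))); last by ring.
by rewrite ct2E; ring.
Qed.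

Lemma t2_mu_nu : t ^+ 2 * mu * nu = Num.sqrt gamma.
Proof.
have h : 0 <= t ^+ 2 * mu * nu by rewrite !mulr_ge0 ?sqrtr_ge0// ltW.
apply/eqP; rewrite -(@eqrXn2 _ 2)// ?sqrtr_ge0//.
rewrite !exprMn sqr_mu sqr_nu sqr_sqrtr//; apply/eqP.
apply: (mulIf (lt0r_neq0 tg)); apply: (mulIf (lt0r_neq0 t1)).
transitivity (t ^+ 4 * ((1 - ctilde ^+ 2) * (t ^+ 2 * (t ^+ 2 + 1))) *
  ((1 - c ^+ 2) * (t ^+ 2 * (t ^+ 2 + gamma)))); first by ring.
by rewrite mu2E nu2E; ring.
Qed.

(** The limit of the top singular value: at the maximizer the sums of x_k y_(k+1) and x_(k+1) y_k
    are mu |x|^2 and nu |y|^2, with unit x and y. *)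
Definition spike_value := t * c * ctilde + Num.sqrt gamma * nu + mu.

(** The coefficient t^2 mu stands for sqrt gamma / nu, by [t2_mu_nu], and still makes sense when
    gamma = nu = 0. *)
Lemma dual_at_mu A B :
  t * A * B + Num.sqrt gamma * nu / 2 + t ^+ 2 * mu * (1 - A ^+ 2) / 2 +
    (mu + (1 - B ^+ 2) / mu) / 2 =
  spike_value - (B - t * mu * A) ^+ 2 / (2 * mu).
Proof.
have m0 := lt0r_neq0 mu_gt0.
have e1 : 1 - mu ^+ 2 - (t * mu * c) ^+ 2 = 0 by rewrite t_mu_c sqr_mu; ring.
have e2 : nu ^+ 2 - (1 - c ^+ 2) = 0 by rewrite sqr_nu subrr.
apply/eqP; rewrite -subr_eq0; apply/eqP; rewrite /spike_value -t_mu_c -t2_mu_nu.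
transitivity ((1 - mu ^+ 2 - (t * mu * c) ^+ 2 -
  t ^+ 2 * mu ^+ 2 * (nu ^+ 2 - (1 - c ^+ 2))) / (2 * mu)); first by field.
by rewrite e1 e2 mulr0 subr0 mul0r.
Qed.

(** Since 1 - mu^2 = ctilde^2, the first-order term in m - mu carries the factor B^2 - ctilde^2, the
    quantity to be controlled. *)
Lemma dual_shift m B : 0 < m ->
  (m + (1 - B ^+ 2) / m) / 2 = (mu + (1 - B ^+ 2) / mu) / 2 +
    (m - mu) * (B ^+ 2 - ctilde ^+ 2 + mu * (m - mu)) / (2 * mu * m).
Proof.
move=> m0; have mu0 := lt0r_neq0 mu_gt0; have m0' := lt0r_neq0 m0.
have e : ctilde ^+ 2 = 1 - mu ^+ 2 by rewrite sqr_mu; ring.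
by rewrite e; field; rewrite m0' mu0.
Qed.

(** * Convergence of the overlaps *)

Section overlaps.
Variables (s A B : nat -> R).
Hypothesis (B1 : forall n, (0 < n)%N -> B n ^+ 2 <= 1).
Hypothesis s_ge : forall eta, 0 < eta -> \forall n \near \oo, spike_value - eta <= s n.
Hypothesis s_le : forall m eta, 0 < m -> 0 < eta -> \forall n \near \oo,
  s n <= t * A n * B n + Num.sqrt gamma * nu / 2 + t ^+ 2 * mu * (1 - A n ^+ 2) / 2 +
    (m + (1 - B n ^+ 2) / m) / 2 + eta.

Let dual_bound m eta : 0 < m -> 0 < eta -> \forall n \near \oo,
  (B n - t * mu * A n) ^+ 2 / (2 * mu) <=
  (m - mu) * (B n ^+ 2 - ctilde ^+ 2 + mu * (m - mu)) / (2 * mu * m) + 2 * eta.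
Proof.
move=> m0 e0; near=> n.
have h1 : spike_value - eta <= s n by near: n; exact: s_ge.
have h2 : s n <= t * A n * B n + Num.sqrt gamma * nu / 2 + t ^+ 2 * mu * (1 - A n ^+ 2) / 2 +
    (m + (1 - B n ^+ 2) / m) / 2 + eta by near: n; exact: s_le.
have := le_trans h1 h2; have := dual_at_mu (A n) (B n); have := dual_shift (B n) m0.
set E1 := (m + _) / 2; set E2 := (mu + _) / 2; set E3 := _ / (2 * mu * m).
set E4 := _ / (2 * mu); lra.
Unshelve. all: end_near. Qed.

Lemma overlap_diff_cvg : B n - t * mu * A n @[n --> \oo] --> (0 : R).
Proof.
apply/cvgr0Pnorm_le => e e0.
have h0 : 0 < e ^+ 2 / (4 * mu) by rewrite divr_gt0 ?exprn_gt0// mulr_gt0// mu_gt0.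
near=> n.
have : (B n - t * mu * A n) ^+ 2 / (2 * mu) <=
  (mu - mu) * (B n ^+ 2 - ctilde ^+ 2 + mu * (mu - mu)) / (2 * mu * mu) + 2 * (e ^+ 2 / (4 * mu)).
  by near: n; exact: dual_bound mu_gt0 h0.
rewrite subrr !mul0r add0r => h.
rewrite -(@ler_pXn2r _ 2)// ?nnegrE// ?(ltW e0)// real_normK ?num_real//.
rewrite -(ler_pM2r (_ : 0 < (2 * mu)^-1)) ?invr_gt0 ?mulr_gt0 ?mu_gt0//.
apply: le_trans h _; rewrite le_eqVlt; apply/orP; left; apply/eqP.
by field; exact: lt0r_neq0 mu_gt0.
Unshelve. all: end_near. Qed.

(* The bound s_le is tight at m = mu; taking m = mu + h and m = mu - h yields two-sided
   bounds on B^2 - ctilde^2 that are of order h. *)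
Lemma overlap_sqr_cvg : B n ^+ 2 @[n --> \oo] --> ctilde ^+ 2.
Proof.
have m0 := mu_gt0.
apply/cvgrPdist_le => e e0.
(* The tolerance h^2 is of lower order than h, so dividing by h leaves an error of at most h + 8 h <
   e; the bound mu / 2 keeps the weight mu - h positive. *)
pose h := Num.min (mu / 2) (e / 16).
have h0 : 0 < h by rewrite lt_min !divr_gt0.
have hmu : h <= mu / 2 by rewrite ge_min lexx.
have he : h <= e / 16 by rewrite ge_min lexx orbT.
have h20 : 0 < h ^+ 2 by rewrite exprn_gt0.
have p0 : 0 < mu + h by lra.
have q0 : 0 < mu - h by lra.
near=> n.
have : (B n - t * mu * A n) ^+ 2 / (2 * mu) <=
  ((mu + h) - mu) * (B n ^+ 2 - ctilde ^+ 2 + mu * ((mu + h) - mu)) / (2 * mu * (mu + h)) + 2 * h ^+ 2.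
  by near: n; exact: (dual_bound p0 h20).
have : (B n - t * mu * A n) ^+ 2 / (2 * mu) <=
  ((mu - h) - mu) * (B n ^+ 2 - ctilde ^+ 2 + mu * ((mu - h) - mu)) / (2 * mu * (mu - h)) + 2 * h ^+ 2.
  by near: n; exact: (dual_bound q0 h20).
have sq0 : 0 <= (B n - t * mu * A n) ^+ 2 / (2 * mu).
  by rewrite divr_ge0 ?sqr_ge0// mulr_ge0// ltW.
set D := B n ^+ 2 - ctilde ^+ 2.
have -> : mu - h - mu = - h by ring.
have -> : mu + h - mu = h by ring.
move=> /(le_trans sq0) hm /(le_trans sq0) hp.
have mu1 := mu_lt1.
have k1 : mu * h <= h by nra.
have k2 : h * (mu * (mu + h)) <= h * 2 by rewrite ler_pM2l//; nra.
have k3 : h * (mu * (mu - h)) <= h * 2 by rewrite ler_pM2l//; nra.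
have lo : - e <= D.
  have : 0 <= h * (D + mu * h) + 2 * h ^+ 2 * (2 * mu * (mu + h)).
    have -> : h * (D + mu * h) + 2 * h ^+ 2 * (2 * mu * (mu + h)) =
      (h * (D + mu * h) / (2 * mu * (mu + h)) + 2 * h ^+ 2) * (2 * mu * (mu + h)).
      by field; rewrite !gt_eqF.
    by rewrite mulr_ge0// !mulr_ge0// ltW.
  have -> : h * (D + mu * h) + 2 * h ^+ 2 * (2 * mu * (mu + h)) =
    h * (D + mu * h + 4 * h * mu * (mu + h)) by ring.
  rewrite pmulr_rge0// => hD; lra.
have up : D <= e.
  have : 0 <= - h * (D + mu * - h) + 2 * h ^+ 2 * (2 * mu * (mu - h)).
    have -> : - h * (D + mu * - h) + 2 * h ^+ 2 * (2 * mu * (mu - h)) =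
      (- h * (D + mu * - h) / (2 * mu * (mu - h)) + 2 * h ^+ 2) * (2 * mu * (mu - h)).
      by field; rewrite !gt_eqF.
    by rewrite mulr_ge0// !mulr_ge0// ltW.
  have -> : - h * (D + mu * - h) + 2 * h ^+ 2 * (2 * mu * (mu - h)) =
    h * (- D + mu * h + 4 * h * mu * (mu - h)) by ring.
  rewrite pmulr_rge0// => hD; lra.
by rewrite distrC ler_norml lo up.
Unshelve. all: end_near. Qed.

Let tmu0 : t * mu != 0. Proof. by rewrite mulf_neq0 ?t0// gt_eqF// mu_gt0. Qed.

Lemma overlap_bounded_cvg0 (d : nat -> R) : d n @[n --> \oo] --> (0 : R) ->
  d n * B n @[n --> \oo] --> (0 : R).
Proof.
move=> /cvgr0Pnorm_le d0; apply/cvgr0Pnorm_le => e e0; near=> n.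
have B1' : `|B n| <= 1.
  rewrite -(@expr_le1 _ 2)// real_normK ?num_real// B1//.
  by near: n; exact: nbhs_infty_gt.
rewrite normrM -[e]mulr1 ler_pM//.
by near: n; exact: d0.
Unshelve. all: end_near. Qed.

(** The common sign of the singular vectors is arbitrary at each n, so A and B themselves need not
    converge. The product is recovered from B^2 and from B - t mu A, which tends to 0. *)
Lemma overlap_prod_cvg : A n * B n @[n --> \oo] --> c * ctilde.
Proof.
have dB := overlap_bounded_cvg0 overlap_diff_cvg.
have -> : (fun n => A n * B n) =
    (fun n => (t * mu)^-1 * (B n ^+ 2 - (B n - t * mu * A n) * B n)).
  apply/funext => n.
  have -> : B n ^+ 2 - (B n - t * mu * A n) * B n = (t * mu) * (A n * B n) by ring.
  by rewrite mulKf.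
have -> : c * ctilde = (t * mu)^-1 * (ctilde ^+ 2 - 0).
  by rewrite subr0 expr2 -{2}t_mu_c -(mulrA (t * mu)) mulKf.
exact: (cvgM (cvg_cst _) (cvgB overlap_sqr_cvg dB)).
Qed.

Lemma overlap_sqr_cvg' : A n ^+ 2 @[n --> \oo] --> c ^+ 2.
Proof.
have dA := cvgM overlap_diff_cvg overlap_diff_cvg.
have dB := overlap_bounded_cvg0 overlap_diff_cvg.
pose d n := B n - t * mu * A n.
have -> : (fun n => A n ^+ 2) =
    (fun n => (t * mu)^-1 ^+ 2 * (B n ^+ 2 - 2 * (d n * B n) + d n * d n)).
  apply/funext => n.
  have -> : B n ^+ 2 - 2 * (d n * B n) + d n * d n = (t * mu * A n) ^+ 2 by rewrite /d; ring.
  by rewrite exprMn mulrA -exprMn mulVf// expr1n mul1r.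
have -> : c ^+ 2 = (t * mu)^-1 ^+ 2 * (ctilde ^+ 2 - 2 * 0 + 0 * 0).
  by rewrite !mulr0 subr0 addr0 -exprMn -t_mu_c mulKf.
apply: cvgM; first exact: cvg_cst.
apply: cvgD; last exact: dA.
apply: cvgB; first exact: overlap_sqr_cvg.
by apply: cvgM; [exact: cvg_cst|exact: dB].
Qed.

End overlaps.

(** * Closed forms of the limiting loss *)

Definition rank2_norm_limit q :=
  Num.sqrt (top_root (rank2_trace q t (c * ctilde)) (rank2_det q t (c ^+ 2) (ctilde ^+ 2))).

Lemma rank2_norm_cvg q (X Y Z : nat -> R) : X n @[n --> \oo] --> c * ctilde ->
  Y n @[n --> \oo] --> c ^+ 2 -> Z n @[n --> \oo] --> ctilde ^+ 2 ->
  Num.sqrt (top_root (rank2_trace q t (X n)) (rank2_det q t (Y n) (Z n))) @[n --> \oo]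
  --> rank2_norm_limit q.
Proof.
move=> cX cY cZ.
have cS : rank2_trace q t (X n) @[n --> \oo] --> rank2_trace q t (c * ctilde).
  by apply: cvgB; [exact: cvg_cst|apply: cvgM => //; exact: cvg_cst].
have cD : rank2_det q t (Y n) (Z n) @[n --> \oo] --> rank2_det q t (c ^+ 2) (ctilde ^+ 2).
  apply: cvgM; first (apply: cvgM; first exact: cvg_cst).
  - by apply: cvgB => //; exact: cvg_cst.
  - by apply: cvgB => //; exact: cvg_cst.
have sqrtc (z : nat -> R) l : z n @[n --> \oo] --> l ->
    Num.sqrt (z n) @[n --> \oo] --> Num.sqrt l.
  by move=> zl; exact: (cvg_comp _ _ zl (@sqrt_continuous R l)).
apply: (sqrtc _ _); apply: cvgM; last exact: cvg_cst.
apply: cvgD => //; apply: (sqrtc _ _); apply: cvgB.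
  exact: (cvgM cS cS).
by apply: cvgM => //; exact: cvg_cst.
Qed.

(** At q = t, with a the larger and b the smaller overlap, the discriminant is the square of 2 t^2
    (a - b). *)
Lemma rank2_norm_limit_t : rank2_norm_limit t =
  t * Num.sqrt ((1 + Num.max c ctilde) * (1 - Num.min c ctilde)).
Proof.
have h a b : 0 <= b -> b <= a -> a <= 1 ->
    Num.sqrt (top_root (rank2_trace t t (a * b)) (rank2_det t t (a ^+ 2) (b ^+ 2))) =
    t * Num.sqrt ((1 + a) * (1 - b)).
  move=> b0 ba a1; rewrite /top_root.
  have -> : rank2_trace t t (a * b) ^+ 2 - 4 * rank2_det t t (a ^+ 2) (b ^+ 2) =
    (2 * t ^+ 2 * (a - b)) ^+ 2 by rewrite /rank2_trace /rank2_det; ring.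
  rewrite sqrtr_sqr ger0_norm ?mulr_ge0 ?subr_ge0 ?(ltW t2)//.
  have -> : (rank2_trace t t (a * b) + 2 * t ^+ 2 * (a - b)) / 2 =
    t ^+ 2 * ((1 + a) * (1 - b)) by rewrite /rank2_trace; field.
  by rewrite sqrtrM ?sqr_ge0// sqrtr_sqr ger0_norm// ltW.
rewrite /rank2_norm_limit; case: (leP c ctilde) => h2.
  rewrite -h ?(ltW ctilde_lt1)// (mulrC c ctilde); congr (Num.sqrt (top_root _ _)).
  by rewrite /rank2_det; ring.
by rewrite -h ?c_le1// ltW.
Qed.

(** The definitions give c^2 (t^2 + gamma) = ctilde^2 (t^2 + 1): the fraction under the root is the
    square of a ratio of overlaps, and the order of c and ctilde is decided by that of 1 and
    gamma. *)
Lemma optimal_shrinkageE : optimal_shrinkage t gamma =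
  t * (Num.min c ctilde / Num.max c ctilde).
Proof.
rewrite /optimal_shrinkage; congr (_ * _).
have hr : c ^+ 2 * (t ^+ 2 + gamma) = ctilde ^+ 2 * (t ^+ 2 + 1).
  by apply: (mulfI (lt0r_neq0 t2)); rewrite mulrCA c2E mulrCA ct2E.
have c0 := lt0r_neq0 c_gt0; have ct0 := lt0r_neq0 ctilde_gt0.
have g0 : t ^+ 2 + gamma != 0 by rewrite gt_eqF// ltr_wpDr.
have g1 : t ^+ 2 + 1 != 0 by rewrite gt_eqF// ltr_wpDr.
case: (leP 1 gamma) => g.
  have cc : c <= ctilde.
    rewrite -(@ler_pXn2r _ 2)// ?nnegrE// -(ler_pM2r (_ : 0 < t ^+ 2 + 1)) ?ltr_wpDr//.
    by rewrite -hr ler_wpM2l ?sqr_ge0// lerD2l.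
  rewrite (min_idPl cc) (max_idPr cc).
  rewrite (_ : _ / _ = (c / ctilde) ^+ 2) ?sqrtr_sqr ?ger0_norm ?divr_ge0//.
  rewrite expr_div_n; apply/eqP; rewrite eqr_div ?expf_neq0//.
  by rewrite hr mulrC.
have cc : ctilde <= c.
  rewrite -(@ler_pXn2r _ 2)// ?nnegrE// -(ler_pM2r (_ : 0 < t ^+ 2 + 1)) ?ltr_wpDr//.
  by rewrite -hr ler_wpM2l ?sqr_ge0// lerD2l ltW.
rewrite (min_idPr cc) (max_idPl cc).
rewrite (_ : _ / _ = (ctilde / c) ^+ 2) ?sqrtr_sqr ?ger0_norm ?divr_ge0//.
rewrite expr_div_n; apply/eqP; rewrite eqr_div ?expf_neq0//.
by rewrite mulrC hr.
Qed.

(** At q = t b / a the discriminant is again a perfect square, that of t^2 (1 - (b / a)^2), and the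
    larger root depends on the smaller overlap b only. *)
Lemma rank2_norm_limit_opt : rank2_norm_limit (optimal_shrinkage t gamma) =
  t * Num.sqrt (1 - Num.min c ctilde ^+ 2).
Proof.
have h a b : 0 <= b -> b <= a -> 0 < a -> a <= 1 ->
    Num.sqrt (top_root (rank2_trace (t * (b / a)) t (a * b))
      (rank2_det (t * (b / a)) t (a ^+ 2) (b ^+ 2))) = t * Num.sqrt (1 - b ^+ 2).
  move=> b0 ba a0 a1; rewrite /top_root; have an0 := lt0r_neq0 a0.
  have -> : rank2_trace (t * (b / a)) t (a * b) ^+ 2 -
    4 * rank2_det (t * (b / a)) t (a ^+ 2) (b ^+ 2) =
    (t ^+ 2 * (1 - (b / a) ^+ 2)) ^+ 2 by rewrite /rank2_trace /rank2_det; field.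
  have ba1 : (b / a) ^+ 2 <= 1.
    by rewrite expr_le1// ?divr_ge0 ?(ltW a0)// ler_pdivrMr// mul1r.
  rewrite sqrtr_sqr ger0_norm ?mulr_ge0 ?subr_ge0 ?(ltW t2)//.
  have -> : (rank2_trace (t * (b / a)) t (a * b) + t ^+ 2 * (1 - (b / a) ^+ 2)) / 2 =
    t ^+ 2 * (1 - b ^+ 2) by rewrite /rank2_trace; field.
  by rewrite sqrtrM ?sqr_ge0// sqrtr_sqr ger0_norm// ltW.
rewrite /rank2_norm_limit optimal_shrinkageE; case: (leP c ctilde) => h2.
  rewrite -(h ctilde) ?(ltW ctilde_lt1) ?ctilde_gt0// (mulrC c ctilde).
  by congr (Num.sqrt (top_root _ _)); rewrite /rank2_det; ring.
by rewrite -(h c) ?c_le1 ?c_gt0// ltW.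
Qed.

Lemma rank2_norm_limit_t_gt0 : 0 < rank2_norm_limit t.
Proof.
rewrite rank2_norm_limit_t mulr_gt0// sqrtr_gt0 mulr_gt0//.
  by rewrite ltr_wpDr// le_max c_ge0.
by rewrite subr_gt0 gt_min ctilde_lt1 orbT.
Qed.

Lemma rank2_norm_limit_ratio :
  rank2_norm_limit (optimal_shrinkage t gamma) / rank2_norm_limit t =
  Num.sqrt ((1 + Num.min c ctilde) / (1 + Num.max c ctilde)).
Proof.
rewrite rank2_norm_limit_opt rank2_norm_limit_t -mulf_div divff ?t0// mul1r.
have b1 : 0 < 1 - Num.min c ctilde by rewrite subr_gt0 gt_min ctilde_lt1 orbT.
have b0 : 0 <= Num.min c ctilde by rewrite le_min c_ge0.
have a0 : 0 < 1 + Num.max c ctilde by rewrite ltr_wpDr// le_max c_ge0.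
have p0 : 0 < (1 + Num.max c ctilde) * (1 - Num.min c ctilde) by rewrite mulr_gt0.
rewrite -sqrtrV ?(ltW p0)// -sqrtrM; last first.
  by rewrite subr_ge0 expr_le1// ltW// -subr_gt0.
congr Num.sqrt; field.
by rewrite !gt_eqF.
Qed.

End spike_parameters.

(** * Almost sure bounds *)

Section almost_sure_peeling.
Context {R : realType} d (T : measurableType d) (P : probability T R).

Lemma geometric_partial_le (C r : R) n : 0 <= C -> 0 <= r -> r < 1 ->
  \sum_(0 <= k < n) C * r ^+ k <= C / (1 - r).
Proof.
move=> C0 r0 r1; have r10 : 0 < 1 - r by rewrite subr_gt0.
have E : (\sum_(0 <= k < n) C * r ^+ k) * (1 - r) = C * (1 - r ^+ n).
  elim: n => [|n IH]; first by rewrite big_nil expr0 subrr mulr0 mul0r.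
  by rewrite big_nat_recr//= mulrDl IH exprS; ring.
by rewrite ler_pdivlMr// E ler_piMr// gerBl exprn_ge0.
Qed.

Lemma borel_cantelli_geometric (F : nat -> set T) (C r : R) (N : nat) :
  (forall n, (N <= n)%N -> measurable (F n)) -> 0 <= C -> 0 <= r -> r < 1 ->
  (forall n, (N <= n)%N -> (P (F n) <= (C * r ^+ n)%:E)%E) ->
  {ae P, forall w, \forall n \near \oo, ~ F n w}.
Proof.
move=> mF C0 r0 r1 PF.
(* Emptying the events below [N], for which there is no bound, does not change their limit
   superior. *)
pose F' n := if (n < N)%N then set0 else F n.
have mF' n : measurable (F' n) by rewrite /F'; case: ltnP => // /mF.
have PF' n : (P (F' n) <= (C * r ^+ n)%:E)%E.
  rewrite /F'; case: ltnP => [_|/PF//].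
  by rewrite measure0 lee_fin mulr_ge0// exprn_ge0.
have sumF : (\sum_(n <oo) P (F' n) < +oo)%E.
  apply: (@le_lt_trans _ _ (C / (1 - r))%:E); last exact: ltry.
  apply: lime_le; first by apply: is_cvg_nneseries => n _ _; exact: measure_ge0.
  apply: nearW => n; apply: (@le_trans _ _ (\sum_(0 <= k < n) (C * r ^+ k)%:E)%E).
    by apply: lee_sum => k _; exact: PF'.
  by rewrite sumEFin lee_fin geometric_partial_le.
exists (lim_sup_set F'); split.
- by apply: bigcap_measurable => // n _; exact: bigcup_measurable.
- exact: lim_sup_set_cvg0.
- move=> w /= nw n _; apply: contrapT => nF; apply: nw.
  exists (maxn n N) => // m /=; rewrite geq_max => /andP[nm Nm] Fm; apply: nF.
  by exists m => //; rewrite /F' ltnNge Nm.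
Qed.

(** Up to n peeling steps cost a factor n; half of the exponential rate absorbs it, as n c / 2 <=
    exp (n c / 2). *)
Lemma natr_expRN_le (c : R) (n : nat) : 0 < c ->
  n%:R * (3 * expR (- (n%:R * c))) <= 6 / c * expR (- (c / 2)) ^+ n.
Proof.
move=> c0; rewrite -expRM_natl.
have h : n%:R * c / 2 <= expR (n%:R * c / 2).
  by apply: le_trans (expR_ge1Dx _); rewrite lerDr.
have -> : n%:R * - (c / 2) = n%:R * c / 2 - n%:R * c by field.
rewrite expRD; have E := expR_gt0 (- (n%:R * c)).
set X := expR (n%:R * c / 2) in h *; set Y := expR _ in E *.
have -> : 6 / c * (X * Y) = (6 / c * X) * Y by ring.
have -> : n%:R * (3 * Y) = 6 / c * (n%:R * c / 2) * Y by field; rewrite gt_eqF.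
by rewrite ler_pM2r// ler_pM2l// divr_gt0.
Qed.

Lemma sqnorm_in_le n m (kappa b c : R) : 0 <= kappa < b -> (0 < n)%N ->
  m%:R <= kappa * n%:R -> c <= (b - kappa) ^+ 2 / (8 * (b + kappa)) ->
  sqnorm_in P (Num.sqrt n%:R^-1) (expR (- (n%:R * c))) [set z | z <= b] m.
Proof.
move=> kb n0 mn cb X PX; have [mX _] := PX.
have mS : measurable_fun setT (fun w => \sum_i X i w ^+ 2).
  by apply: measurable_sum => i; exact: measurable_funX.
have := @chi_square_upper _ _ T P n kappa b _ X kb n0.
rewrite card_ord => /(_ mn PX) h.
apply: (@le_trans _ _ (P [set w | b <= \sum_i X i w ^+ 2])).
  apply: le_measure; rewrite ?inE.
  - rewrite (_ : [set w | _] = ~` [set w | \sum_i X i w ^+ 2 <= b])//.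
    by apply: measurableC; exact: measurable_le_set.
  - exact: measurable_le_set.
  - by move=> w /= /negP; rewrite -ltNge => /ltW.
by apply: le_trans h _; rewrite lee_fin ler_expR lerN2 ler_wpM2l.
Qed.

Lemma sqnorm_in_ge n m (kappa a c : R) : 0 <= a < kappa -> (0 < n)%N ->
  kappa * n%:R <= m%:R -> c <= (kappa - a) ^+ 2 / (8 * (kappa + a)) ->
  sqnorm_in P (Num.sqrt n%:R^-1) (expR (- (n%:R * c))) [set z | a <= z] m.
Proof.
move=> kb n0 mn cb X PX; have [mX _] := PX.
have mS : measurable_fun setT (fun w => \sum_i X i w ^+ 2).
  by apply: measurable_sum => i; exact: measurable_funX.
have := @chi_square_lower _ _ T P n kappa a _ X kb n0.
rewrite card_ord => /(_ mn PX) h.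
apply: (@le_trans _ _ (P [set w | \sum_i X i w ^+ 2 <= a])).
  apply: le_measure; rewrite ?inE.
  - rewrite (_ : [set w | _] = ~` [set w | a <= \sum_i X i w ^+ 2])//.
    by apply: measurableC; exact: measurable_le_set.
  - exact: measurable_le_set.
  - by move=> w /= /negP; rewrite -ltNge => /ltW.
by apply: le_trans h _; rewrite lee_fin ler_expR lerN2 ler_wpM2l.
Qed.

Lemma sqnorm_in_nneg s delta m : 0 <= delta ->
  sqnorm_in P s delta [set z | 0 <= z] m.
Proof.
move=> d0 X PX; rewrite (_ : [set w | _] = set0) ?measure0 ?lee_fin//.
rewrite -subset0 => w /=; apply; rewrite sumr_ge0// => i _; exact: sqr_ge0.
Qed.

Variables (p : nat -> nat) (gamma : R).
Hypothesis gamma_ge0 : 0 <= gamma.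
Hypothesis p_ratio : ((p n)%:R / n%:R : R) @[n --> \oo] --> gamma.
Variable G : forall n, T -> 'M[R]_(p n, n).
Hypothesis gaussG : forall n, (0 < n)%N -> gauss_mx P (Num.sqrt n%:R^-1) (@G n).
Variables (u : forall n, 'cV[R]_(p n)) (v : forall n, 'cV[R]_n).

Lemma ae_peel (Ag Aq Ar : set R) (k : nat -> nat) (c : R) : 0 < c ->
  measurable Ag -> measurable Aq -> measurable Ar -> (forall n, (k n <= n)%N) ->
  (\forall n \near \oo,
    let S := sqnorm_in P (Num.sqrt n%:R^-1) (expR (- (n%:R * c))) in
    [/\ S Ag 1%N, forall m, (p n - k n <= m < p n)%N -> S Aq m &
      forall m, (n - k n <= m < n)%N -> S Ar m]) ->
  {ae P, forall w, \forall n \near \oo,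
    peel Ag Aq Ar (k n) (G n w) (u n) (v n)}.
Proof.
move=> c0 mAg mAq mAr kn [N _ HN].
pose F n := [set w | ~ peel Ag Aq Ar (k n) (G n w) (u n) (v n)].
have mF n : (N.+1 <= n)%N -> measurable (F n).
  move=> Nn; rewrite (_ : F n = ~` [set w | peel Ag Aq Ar (k n) (G n w) (u n) (v n)])//.
  apply: measurableC; apply: measurable_peel => //; try exact: measurable_mx_cst.
  by move=> i j; have [mG _] := gaussG (leq_ltn_trans (leq0n _) Nn); exact: (mG (i, j)).
have e0 : 0 <= expR (- (c / 2)) by exact: expR_ge0.
have e1 : expR (- (c / 2)) < 1 by rewrite expR_lt1 oppr_lt0 divr_gt0.
have C0 : 0 <= 6 / c by rewrite divr_ge0// ltW.
have := @borel_cantelli_geometric F _ _ N.+1 mF C0 e0 e1.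
have PF n : (N.+1 <= n)%N -> (P (F n) <= (6 / c * expR (- (c / 2)) ^+ n)%:E)%E.
  move=> Nn; have [/= Sg Sq Sr] := HN n (ltnW Nn).
  have n0 : (0 < n)%N by exact: leq_ltn_trans Nn.
  have s0 : Num.sqrt (n%:R^-1 : R) != 0 by rewrite gt_eqF// sqrtr_gt0 invr_gt0 ltr0n.
  have := peel_prob s0 mAg mAq mAr (u n) (v n) (expR_ge0 _) (gaussG n0) Sg Sq Sr.
  move=> /le_trans; apply; rewrite lee_fin; apply: le_trans (natr_expRN_le n c0).
  by rewrite ler_wpM2r ?mulr_ge0 ?expR_ge0// ler_nat.
move=> /(_ PF); apply: filterS => w; apply: filterS => n nF.
exact: contrapT.
Qed.

Lemma ae_peel_upper (eps : R) : 0 < eps ->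
  {ae P, forall w, \forall n \near \oo,
    peel [set z | z <= eps ^+ 2] [set z | z <= (Num.sqrt gamma + eps) ^+ 2]
      [set z | z <= (1 + eps) ^+ 2] (minn (p n) n) (G n w) (u n) (v n)}.
Proof.
move=> eps0; have e2 : 0 < eps ^+ 2 by rewrite exprn_gt0.
have sg := sqr_sqrtr gamma_ge0; have sg0 := sqrtr_ge0 gamma.
pose rate (b kappa : R) := (b - kappa) ^+ 2 / (8 * (b + kappa)).
have rate0 b kappa : 0 <= kappa -> kappa < b -> 0 < rate b kappa.
  by move=> k0 kb; rewrite divr_gt0 ?exprn_gt0//; lra.
(* Strictly above gamma, to dominate p n / n eventually even if gamma = 0, and strictly below the
   threshold, for a positive rate. *)
pose kq := gamma + eps ^+ 2 / 2.
have kq_lt : kq < (Num.sqrt gamma + eps) ^+ 2.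
  rewrite /kq -{1}sg; have : 0 <= Num.sqrt gamma * eps by rewrite mulr_ge0// ltW.
  have -> : (Num.sqrt gamma + eps) ^+ 2 =
    Num.sqrt gamma ^+ 2 + 2 * (Num.sqrt gamma * eps) + eps ^+ 2 by ring.
  lra.
have kq0 : 0 <= kq by rewrite addr_ge0// divr_ge0// ltW.
have one_lt : 1 < (1 + eps) ^+ 2 by rewrite expr2; nra.
pose c := Num.min (rate (eps ^+ 2) (eps ^+ 2 / 2))
  (Num.min (rate ((Num.sqrt gamma + eps) ^+ 2) kq) (rate ((1 + eps) ^+ 2) 1)).
have c0 : 0 < c.
  rewrite !lt_min; apply/and3P; split; apply: rate0 => //; lra.
have cle : [/\ c <= rate (eps ^+ 2) (eps ^+ 2 / 2),
   c <= rate ((Num.sqrt gamma + eps) ^+ 2) kq & c <= rate ((1 + eps) ^+ 2) 1].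
  by rewrite /c !ge_min !lexx !orbT.
have [c1 c2 c3] := cle.
have mle b : measurable [set z : R | z <= b] by exact: measurable_le_set.
apply: (ae_peel c0) => //; first by move=> n; exact: geq_minr.
near=> n.
have n0 : (0 < n)%N by near: n; exact: nbhs_infty_gt.
have nR : 0 < n%:R :> R by rewrite ltr0n.
split.
(* The corner is a single entry, and one degree of freedom is at most n eps^2 / 2 for n large. *)
- apply: (sqnorm_in_le (kappa := eps ^+ 2 / 2)) => //; first by lra.
  rewrite -ler_pdivrMl ?divr_gt0// mulr1.
  by near: n; exact: nbhs_infty_ger.
- move=> m /andP[_ mp]; apply: (sqnorm_in_le (kappa := kq)) => //; first by rewrite kq0.
  apply: (@le_trans _ _ (p n)%:R); first by rewrite ler_nat ltnW.
  rewrite -ler_pdivrMr//; near: n.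
  by apply: (cvgr_le gamma) => //; rewrite /kq; lra.
- move=> m /andP[_ mn]; apply: (sqnorm_in_le (kappa := 1)) => //; first by rewrite ler01.
  by rewrite mul1r ler_nat ltnW.
Unshelve. all: end_near. Qed.

(** For a fixed number of steps, p n - k and n - k divided by n still tend to gamma and 1. The
    maximum with 0 covers sqrt gamma <= eps, where the condition on |q| is void. *)
Lemma ae_peel_lower (eps : R) (k : nat) : 0 < eps < 1 ->
  {ae P, forall w, \forall n \near \oo,
    peel [set z | z <= eps ^+ 2] [set z | Num.max (Num.sqrt gamma - eps) 0 ^+ 2 <= z]
      [set z | (1 - eps) ^+ 2 <= z] (minn k n) (G n w) (u n) (v n)}.
Proof.
move=> /andP[eps0 eps1]; have e2 : 0 < eps ^+ 2 by rewrite exprn_gt0.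
have sg := sqr_sqrtr gamma_ge0; have sg0 := sqrtr_ge0 gamma.
pose rate (b kappa : R) := (kappa - b) ^+ 2 / (8 * (kappa + b)).
have rate0 b kappa : 0 <= b -> b < kappa -> 0 < rate b kappa.
  by move=> k0 kb; rewrite divr_gt0 ?exprn_gt0//; lra.
set b := Num.max _ _.
have b0 : 0 <= b by rewrite le_max lexx orbT.
pose kq := (gamma + b ^+ 2) / 2.
have b_lt : 0 < b -> b ^+ 2 < kq /\ kq < gamma.
  rewrite lt_max ltxx orbF => h.
  have -> : b = Num.sqrt gamma - eps by apply/max_idPl; exact: ltW.
  have : (Num.sqrt gamma - eps) ^+ 2 < gamma.
    by rewrite -[ltRHS]sg ltr_pXn2r ?nnegrE// ?(ltW h)//; lra.
  rewrite /kq; have -> : b = Num.sqrt gamma - eps by apply/max_idPl; exact: ltW.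
  by move=> ?; split; lra.
pose ka := (1 + (1 - eps) ^+ 2) / 2.
have a_lt : (1 - eps) ^+ 2 < 1 by rewrite expr_lt1//; lra.
have ka_lt : ka < 1 by rewrite /ka; lra.
have ka_gt : (1 - eps) ^+ 2 < ka by rewrite /ka; lra.
pose c := Num.min (rate (eps ^+ 2 / 2) (eps ^+ 2))
  (Num.min (if 0 < b then rate (b ^+ 2) kq else 1) (rate ((1 - eps) ^+ 2) ka)).
have c0 : 0 < c.
  rewrite !lt_min; apply/and3P; split.
  - by apply: rate0; lra.
  - by case: ifPn => // /b_lt[? ?]; apply: rate0 => //; exact: sqr_ge0.
  - by apply: rate0; rewrite ?sqr_ge0.
have cle : [/\ c <= rate (eps ^+ 2 / 2) (eps ^+ 2),
   c <= (if 0 < b then rate (b ^+ 2) kq else 1) & c <= rate ((1 - eps) ^+ 2) ka].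
  by rewrite /c !ge_min !lexx !orbT.
have [c1 c2 c3] := cle.
have mle (x : R) : measurable [set z : R | z <= x] by exact: measurable_le_set.
have mge (x : R) : measurable [set z : R | x <= z] by exact: measurable_le_set.
have p_near : \forall n \near \oo, 0 < b -> (kq + gamma) / 2 <= (p n)%:R / n%:R.
  have [/b_lt[_ kg]|_] := ltP 0 b; last by near=> n.
  near=> n => _; near: n.
  by apply: (cvgr_ge gamma) => //; lra.
apply: (ae_peel c0) => //; first by move=> n; exact: geq_minr.
near=> n.
have n0 : (0 < n)%N by near: n; exact: nbhs_infty_gt.
have nR : 0 < n%:R :> R by rewrite ltr0n.
have kn : (k <= n)%N by near: n; exact: nbhs_infty_ge.
rewrite (minn_idPl kn).
split.
- apply: (sqnorm_in_le (kappa := eps ^+ 2 / 2)) => //; first by lra.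
  rewrite -ler_pdivrMl ?divr_gt0// mulr1.
  by near: n; exact: nbhs_infty_ger.
- move=> m /andP[mp _]; have [b_gt|b_le] := ltP 0 b; last first.
    have -> : b = 0 by apply/eqP; rewrite eq_le b0 b_le.
    rewrite expr0n/=; apply: sqnorm_in_nneg; exact: expR_ge0.
  rewrite b_gt in c2; have [bk kg] := b_lt b_gt.
  apply: (sqnorm_in_ge (kappa := kq)) => //; first by rewrite sqr_ge0.
  have h1 : (kq + gamma) / 2 * n%:R <= (p n)%:R.
    rewrite -ler_pdivlMr//; suff : 0 < b -> (kq + gamma) / 2 <= (p n)%:R / n%:R by exact.
    by near: n; exact: p_near.
  (* Half of the gap between gamma and [kq] is left to the fluctuation of p n / n, the other half
     pays for the k lost dimensions. *)
  have h2 : k%:R <= (gamma - kq) / 2 * n%:R.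
    rewrite -ler_pdivrMl ?divr_gt0 ?subr_gt0//.
    by near: n; exact: nbhs_infty_ger.
  have h3 : (p n)%:R - k%:R <= m%:R :> R by rewrite lerBlDr -natrD ler_nat addnC -leq_subLR.
  lra.
- move=> m /andP[mn _]; apply: (sqnorm_in_ge (kappa := ka)) => //.
    by rewrite sqr_ge0.
  have h2 : k%:R <= (1 - ka) * n%:R.
    rewrite -ler_pdivrMl ?subr_gt0//.
    by near: n; exact: nbhs_infty_ger.
  have h3 : n%:R - k%:R <= m%:R :> R by rewrite lerBlDr -natrD ler_nat addnC -leq_subLR.
  lra.
Unshelve. all: end_near. Qed.

End almost_sure_peeling.

Lemma iid_normal_entries_gauss (R : realType) d (T : measurableType d)
    (P : probability T R) (p n : nat) (G : 'I_p -> 'I_n -> {RV P >-> R}) (s : R) :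
  iid_normal_entries G s ->
  gauss_mx P (Num.sqrt s) (fun w => \matrix_(i, j) G i j w).
Proof.
move=> [indep law]; split.
  move=> ij; rewrite (_ : (fun w => _) = G ij.1 ij.2); first exact: measurable_funP.
  by apply/funext => w; rewrite mxE.
move=> B mB; have := indep [set: 'I_p * 'I_n]%SET B mB.
rewrite (_ : \bigcap_(i in _) _ = [set w | forall ij, B ij ((\matrix_(i, j) G i j w) ij.1 ij.2)]); last first.
  apply/seteqP; split => w /= Bw ij; first by rewrite mxE; apply: Bw; rewrite /= inE.
  by move=> _; have := Bw ij; rewrite mxE.
move=> ->; under eq_bigl do rewrite inE.
by apply: eq_bigr => ij _; rewrite -(law ij.1 ij.2)//.
Qed.

(** * The spiked matrix on the peeling events *)

Section overlap_bounds.
Context {R : realType}.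
Variables (gamma t c ctilde : R).
Hypotheses (gamma_ge0 : 0 <= gamma) (t_gt0 : 0 < t)
  (t_supercritical : gamma `^ (4%:R^-1) < t)
  (c_ge0 : 0 <= c) (ctilde_ge0 : 0 <= ctilde)
  (c_def : c ^+ 2 = (1 - gamma / t ^+ 4) / (1 + gamma / t ^+ 2))
  (ctilde_def : ctilde ^+ 2 = (1 - gamma / t ^+ 4) / (1 + 1 / t ^+ 2)).
Local Notation mu := (spike_mu ctilde).
Local Notation nu := (spike_nu c).
Local Notation lambda := (spike_value gamma t c ctilde).

Lemma dotv_spiked p n (u x : 'cV[R]_p) (v y : 'cV[R]_n) (G : 'M[R]_(p, n)) :
  dotv x ((signal t u v + G) *m y) = t * dotv x u * dotv y v + dotv x (G *m y).
Proof.
rewrite mulmxDl dotvDr /signal -scalemxAl -mulmxA [v^T *m y]mx11_scalar.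
by rewrite mul_mx_scalar !dotvZr -/(dotv v y) (dotvC v y) -mulrA (mulrC (dotv y v)).
Qed.

(* The weight nu + e replaces nu, which is 0 if gamma = 0; the tolerance e^2 makes
   e^2 / (nu + e) at most e. *)
Lemma spiked_upper p n (u x : 'cV[R]_p) (v y : 'cV[R]_n) (G : 'M[R]_(p, n)) (e m : R) :
  unit_or_empty u -> unit_or_empty v -> dotv x x = 1 -> dotv y y = 1 ->
  0 < e <= 1 -> 0 < m ->
  peel [set z | z <= (e ^+ 2) ^+ 2] [set z | z <= (Num.sqrt gamma + e ^+ 2) ^+ 2]
    [set z | z <= (1 + e ^+ 2) ^+ 2] (minn p n) G u v ->
  dotv x ((signal t u v + G) *m y) <=
  t * dotv x u * dotv y v + Num.sqrt gamma * nu / 2 +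
    t ^+ 2 * mu * (1 - dotv x u ^+ 2) / 2 + (m + (1 - dotv y v ^+ 2) / m) / 2 +
    e * (2 + (Num.sqrt gamma + nu + m + m^-1) / 2).
Proof.
move=> uu vv x1 y1 /andP[e0 e1] m0 pl.
have sg0 := sqrtr_ge0 gamma; have n0 := nu_ge0 c.
have e20 : 0 < e ^+ 2 by rewrite exprn_gt0.
have ne0 : 0 < nu + e by rewrite ltr_wpDl.
have := @peel_upper R (e ^+ 2) (1 + e ^+ 2) (Num.sqrt gamma + e ^+ 2) m (nu + e)
  _ _ _ (ltW e20) _ _ m0 ne0 (fun z h => h) (fun z h => h) (fun z h => h)
  (minn p n) p n G u v uu vv (leqnn _) pl x y.
move=> /(_ (addr_ge0 ler01 (ltW e20)) (addr_ge0 sg0 (ltW e20))).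
rewrite dotv_spiked x1 y1 !mulr1.
have A1 : 0 <= 1 - dotv x u ^+ 2 by rewrite subr_ge0 -x1; exact: bessel.
have B1 : 0 <= 1 - dotv y v ^+ 2 by rewrite subr_ge0 -y1; exact: bessel.
move: (dotv x u) (dotv y v) A1 B1 => A B A1 B1.
have m_gt0 := mu_gt0 gamma_ge0 t_gt0 ctilde_def.
have k1 : (Num.sqrt gamma + e ^+ 2) / (nu + e) <= t ^+ 2 * mu + e.
  rewrite ler_pdivrMr// -(t2_mu_nu gamma_ge0 t_gt0 c_def ctilde_def).
  have : 0 <= t ^+ 2 * mu * e + e * nu.
    by rewrite addr_ge0// !mulr_ge0// ?sqr_ge0// ltW.
  lra.
have k2 : (Num.sqrt gamma + e ^+ 2) * (nu + e) <=
    Num.sqrt gamma * nu + e * (Num.sqrt gamma + nu + 1).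
  have : e * (e * nu) <= e * nu by rewrite ler_pM2l// ler_piMl.
  have : e * e ^+ 2 <= e * 1 by rewrite ler_pM2l// expr_le1// ltW.
  lra.
have k3 : e ^+ 2 <= e by rewrite expr2 ler_piMl// ltW.
have minv : 0 < m^-1 by rewrite invr_gt0.
have k4 : (1 - B ^+ 2) / m <= m^-1.
  by rewrite ler_piMl ?(ltW minv)// gerBl sqr_ge0.
have k40 : 0 <= (1 - B ^+ 2) / m by rewrite divr_ge0// ltW.
have k5 : (Num.sqrt gamma + e ^+ 2) / (nu + e) * (1 - A ^+ 2) <=
   t ^+ 2 * mu * (1 - A ^+ 2) + e.
  apply: le_trans (ler_wpM2r A1 k1) _; rewrite mulrDl lerD2l.
  by rewrite ler_piMr ?(ltW e0)// gerBl sqr_ge0.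
have k6 : e ^+ 2 * (m + (1 - B ^+ 2) / m) <= e * (m + m^-1).
  by apply: ler_pM => //; rewrite ?(ltW e20) ?addr_ge0 ?(ltW m0)// lerD2l.
set bn := (Num.sqrt gamma + e ^+ 2) / (nu + e) in k5 *.
set bn' := (Num.sqrt gamma + e ^+ 2) * (nu + e) in k2 *.
move=> h; lra.
Qed.

(** At A = c and B = ctilde both chain norms are exactly 1, and the even depth makes the discarded
    tail explicit. Of the 2 i + 3 errors, 2 i + 1 come from the corners and 2 from replacing 1 and
    sqrt gamma by the lower bounds on |r| and |q|. *)
Lemma spiked_lower p n (u : 'cV[R]_p) (v : 'cV[R]_n) (G : 'M[R]_(p, n)) (eps : R) (i : nat) :
  unit_or_empty u -> unit_or_empty v -> 0 < eps < 1 ->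
  (i.*2 < p)%N -> (i.*2 < n)%N ->
  peel [set z | z <= eps ^+ 2] [set z | Num.max (Num.sqrt gamma - eps) 0 ^+ 2 <= z]
    [set z | (1 - eps) ^+ 2 <= z] i.*2.+1 G u v ->
  exists x y, [/\ dotv x x <= 1, dotv y y <= 1 &
    lambda - (1 + Num.sqrt gamma) * ((mu * nu) ^+ 2) ^+ i - (i.*2.+3)%:R * eps <=
      dotv x ((signal t u v + G) *m y)].
Proof.
move=> uu vv /andP[e0 e1] ip ni pl.
have sg0 := sqrtr_ge0 gamma.
have m_gt0 := mu_gt0 gamma_ge0 t_gt0 ctilde_def.
have m_lt1 := mu_lt1 gamma_ge0 t_gt0 t_supercritical ctilde_ge0 ctilde_def.
have n_ge0 := nu_ge0 c.
have n_lt1 := nu_lt1 gamma_ge0 t_gt0 t_supercritical c_ge0 c_def.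
have c1 := c_le1 gamma_ge0 t_gt0 c_ge0 c_def.
have ct1 := ctilde_lt1 gamma_ge0 t_gt0 ctilde_ge0 ctilde_def.
have mu01 : 0 <= mu <= 1 by rewrite !ltW.
have nu01 : 0 <= nu <= 1 by rewrite n_ge0 ltW.
have munu : mu * nu < 1.
  by apply: le_lt_trans m_lt1; rewrite ler_piMr// ltW.
set b := Num.max _ _ in pl.
have b0 : 0 <= b by rewrite le_max lexx orbT.
have c01 : 0 <= c <= 1 by rewrite c_ge0.
have ct01 : 0 <= ctilde <= 1 by rewrite ctilde_ge0 ltW.
have a0 : 0 <= 1 - eps by rewrite subr_ge0 ltW.
have [x [y [xu yv xx yy xy]]] := @peel_lower R eps (1 - eps) b mu nu _ _ _ (ltW e0)
  a0 b0 mu01 nu01 munu (fun z h => h) (fun z h => h) (fun z h => h) i.*2 p n G u v uu vv ip ni pl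
  c ctilde c01 ct01.
have m2 := sqr_mu gamma_ge0 t_gt0 ctilde_def.
have n2 := sqr_nu gamma_ge0 t_gt0 c_def.
have q1 : chain_sqnorm mu nu c ctilde = 1.
  have mn : 1 - (mu * nu) ^+ 2 != 0.
    by rewrite gt_eqF// subr_gt0 expr_lt1// mulr_ge0// ltW.
  rewrite /chain_sqnorm; apply: (mulIf mn); rewrite divfK// mul1r exprMn m2 n2; ring.
have q2 : chain_sqnorm nu mu ctilde c = 1.
  have mn : 1 - (nu * mu) ^+ 2 != 0.
    by rewrite mulrC gt_eqF// subr_gt0 expr_lt1// mulr_ge0// ltW.
  rewrite /chain_sqnorm; apply: (mulIf mn); rewrite divfK// mul1r exprMn m2 n2; ring.
exists x, y; rewrite -{1}q1 -{1}q2; split => //.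
rewrite dotv_spiked xu yv -mulrA.
move: xy; rewrite chain_tail_double// /chain_value q1 q2 !mulr1.
set k := _ ^+ i; set X := dotv x _; set V := (1 - eps) * mu + b * nu.
have k0 : 0 <= k by rewrite exprn_ge0// sqr_ge0.
have V_le : V <= 1 + Num.sqrt gamma.
  have a1 : 1 - eps <= 1 by rewrite gerBl ltW.
  rewrite /V lerD//; first by rewrite mulr_ile1 ?(ltW m_gt0) ?(ltW m_lt1).
  rewrite -[leRHS]mulr1; apply: ler_pM => //; last exact: ltW.
  by rewrite ge_max sg0 andbT gerBl ltW.
have V_ge : mu + Num.sqrt gamma * nu - 2 * eps <= V.
  have h1 : (Num.sqrt gamma - eps) * nu <= b * nu by rewrite ler_wpM2r// le_max lexx.
  have h2 : eps * nu <= eps by rewrite ler_piMr// ltW.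
  have h3 : eps * mu <= eps by rewrite ler_piMr// ltW.
  rewrite /V; lra.
have Vk : k * V <= (1 + Num.sqrt gamma) * k by rewrite mulrC ler_wpM2r.
rewrite /spike_value -(natr1 i.*2.+2) -(natr1 i.*2.+1) => h; lra.
Qed.

End overlap_bounds.

(* The hypotheses on the objects of index n are required for n >= 1 only,
   since there is no unit vector in dimension 0. *)
Theorem proposition3p2 (R : realType) (d : measure_display)
  (T : measurableType d) (P : probability T R)
  (gamma t : R) (gamma_ge0 : 0 <= gamma) (t_gt0 : 0 < t)
  (t_supercritical : gamma `^ (4%:R^-1) < t)
  (p : nat -> nat)
  (p_infty : p n @[n --> \oo] --> \oo)
  (p_ratio : ((p n)%:R / n%:R : R) @[n --> \oo] --> gamma)
  (u : forall n, 'cV[R]_(p n)) (v : forall n, 'cV[R]_n)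
  (u_unit : forall n, (0 < n)%N -> l2norm (u n) = 1)
  (v_unit : forall n, (0 < n)%N -> l2norm (v n) = 1)
  (G : forall n, 'I_(p n) -> 'I_n -> {RV P >-> R})
  (G_iid : forall n, (0 < n)%N -> iid_normal_entries (G n) (n%:R^-1))
  (X : forall n, 'M[R]_(p n, n))
  (X_def : forall n, X n = signal t (u n) (v n))
  (uhat : forall n, T -> 'cV[R]_(p n)) (vhat : forall n, T -> 'cV[R]_n)
  (hat_top : forall n w, (0 < n)%N ->
     top_singular_vectors (observation (X n) (G n) w) (uhat n w) (vhat n w))
  (c ctilde : R) (c_ge0 : 0 <= c) (ctilde_ge0 : 0 <= ctilde)
  (c_def : c ^+ 2 = (1 - gamma / t ^+ 4) / (1 + gamma / t ^+ 2))
  (ctilde_def : ctilde ^+ 2 = (1 - gamma / t ^+ 4) / (1 + 1 / t ^+ 2)) :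
  let qstar := optimal_shrinkage t gamma in
  let loss := shrinkage_loss X uhat vhat in
  let Linf := fun q => as_lim P (loss q) in
  let rho := Num.sqrt ((1 + Num.min c ctilde) / (1 + Num.max c ctilde)) in
  [/\ as_cvg P (loss qstar) (Linf qstar),
      as_cvg P (loss t) (Linf t),
      Linf qstar / Linf t = rho &
      as_cvg P (fun n w => loss qstar n w / loss t n w) rho].
Proof.
move=> qstar loss Linf rho.
pose Gmx n w : 'M[R]_(p n, n) := \matrix_(i, j) G n i j w.
have gaussG n : (0 < n)%N -> gauss_mx P (Num.sqrt n%:R^-1) (Gmx n).
  by move=> n0; exact: iid_normal_entries_gauss (G_iid n n0).
have YE n w : observation (X n) (G n) w = signal t (u n) (v n) + Gmx n w.
  by rewrite /observation X_def.
have uu n : (0 < n)%N -> dotv (u n) (u n) = 1 by move=> /u_unit/l2norm_eq1.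
have vv n : (0 < n)%N -> dotv (v n) (v n) = 1 by move=> /v_unit/l2norm_eq1.
pose A w n := dotv (uhat n w) (u n).
pose B w n := dotv (vhat n w) (v n).
have lossE q n w : (0 < n)%N -> loss q n w = Num.sqrt (top_root
    (rank2_trace q t (A w n * B w n)) (rank2_det q t (A w n ^+ 2) (B w n ^+ 2))).
  move=> n0; have [x1 y1 _] := top_singular_vectors_max (hat_top n w n0).
  by rewrite /loss /shrinkage_loss X_def opnorm_rank2// ?uu ?vv.
(* One almost sure event must serve all tolerances, hence a countable family; 1 / (j + 2) stays
   strictly below 1, as [spiked_lower] requires. *)
have inv01 (j : nat) : 0 < (j.+2%:R^-1 : R) < 1.
  by rewrite invr_gt0 ltr0n/= invf_lt1 ?ltr0n// ltr1n.
have small (x : R) : 0 < x -> exists j : nat, j.+2%:R^-1 <= x.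
  move=> x0; have [N _ HN] : \forall n \near \oo, x^-1 <= n%:R := nbhs_infty_ger x^-1.
  exists N; rewrite -[leRHS]invrK lef_pV2 ?posrE ?invr_gt0// ?ltr0n//.
  by apply: le_trans (HN N (leqnn _)) _; rewrite ler_nat ltnW.
have aeU : {ae P, forall w, forall j : nat, \forall n \near \oo,
    let e : R := j.+2%:R^-1 in
    peel [set z | z <= (e ^+ 2) ^+ 2] [set z | z <= (Num.sqrt gamma + e ^+ 2) ^+ 2]
      [set z | z <= (1 + e ^+ 2) ^+ 2] (minn (p n) n) (Gmx n w) (u n) (v n)}.
  apply: ae_foralln => j; have /andP[j0 _] := inv01 j.
  by apply: (ae_peel_upper gamma_ge0 p_ratio gaussG); rewrite exprn_gt0.
have aeL : {ae P, forall w, forall i j : nat, \forall n \near \oo,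
    let e : R := j.+2%:R^-1 in
    peel [set z | z <= e ^+ 2] [set z | Num.max (Num.sqrt gamma - e) 0 ^+ 2 <= z]
      [set z | (1 - e) ^+ 2 <= z] (minn i.*2.+1 n) (Gmx n w) (u n) (v n)}.
  apply: ae_foralln => i; apply: ae_foralln => j.
  exact: (ae_peel_lower gamma_ge0 p_ratio gaussG).
have cvg_loss : {ae P, forall w, forall q,
    loss q n w @[n --> \oo] --> rank2_norm_limit t c ctilde q}.
  apply: filterS2 aeU aeL => w wU wL q.
  pose s n := dotv (uhat n w) ((signal t (u n) (v n) + Gmx n w) *m vhat n w).
  have B1 n : (0 < n)%N -> B w n ^+ 2 <= 1.
    move=> n0; have [_ y1 _] := top_singular_vectors_max (hat_top n w n0).
    by apply: le_trans (dotv_CS _ _) _; rewrite y1 vv// mulr1.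
  have s_ge eta : 0 < eta -> \forall n \near \oo, spike_value gamma t c ctilde - eta <= s n.
    move=> eta0; pose kappa := (spike_mu ctilde * spike_nu c) ^+ 2.
    have kappa1 : `|kappa| < 1.
      have m_lt1 := mu_lt1 gamma_ge0 t_gt0 t_supercritical ctilde_ge0 ctilde_def.
      have n_lt1 := nu_lt1 gamma_ge0 t_gt0 t_supercritical c_ge0 c_def.
      have mn0 : 0 <= spike_mu ctilde * spike_nu c by rewrite mulr_ge0// sqrtr_ge0.
      rewrite ger0_norm ?sqr_ge0// expr_lt1//.
      by apply: le_lt_trans m_lt1; rewrite ler_piMr ?sqrtr_ge0// ltW.
    have sg1 : 0 < 1 + Num.sqrt gamma by rewrite ltr_wpDr// sqrtr_ge0.
    (* The depth is chosen before the tolerance, because the error is 2 i + 3 tolerances. *)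
    have [i hi] : exists i : nat, (1 + Num.sqrt gamma) * kappa ^+ i <= eta / 2.
      have : (1 + Num.sqrt gamma) * kappa ^+ i @[i --> \oo] --> (1 + Num.sqrt gamma) * 0.
        by apply: cvgM; [exact: cvg_cst|exact: cvg_expr].
      have eta2 : 0 < eta / 2 by rewrite divr_gt0.
      rewrite mulr0 => /cvgr0Pnorm_le /(_ _ eta2) [i _ /(_ i (leqnn i))].
      by move=> /(le_trans (ler_norm _)); exists i.
    have eta3 : 0 < eta / 2 / (i.*2.+3)%:R by rewrite !divr_gt0// ltr0n.
    have [j hj] := small _ eta3.
    have pN : \forall n \near \oo, (i.*2 < p n)%N := p_infty _ (nbhs_infty_gt i.*2).
    near=> n.
    have n0 : (0 < n)%N by near: n; exact: nbhs_infty_gt.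
    have [x1 y1 smax] := top_singular_vectors_max (hat_top n w n0).
    have ni : (i.*2 < n)%N by near: n; exact: nbhs_infty_gt.
    have ip : (i.*2 < p n)%N by near: n.
    have pl : let e : R := j.+2%:R^-1 in
        peel [set z | z <= e ^+ 2] [set z | Num.max (Num.sqrt gamma - e) 0 ^+ 2 <= z]
        [set z | (1 - e) ^+ 2 <= z] (minn i.*2.+1 n) (Gmx n w) (u n) (v n).
      by near: n; exact: wL.
    rewrite /= (minn_idPl ni) in pl.
    have [x [y [xx yy xy]]] := spiked_lower gamma_ge0 t_gt0 t_supercritical c_ge0 ctilde_ge0
      c_def ctilde_def (fun=> uu n n0) (fun=> vv n n0) (inv01 j) ip ni pl.
    have := smax x y xx yy; rewrite YE -/(s n); apply: le_trans.
    apply: le_trans xy.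
    have : (i.*2.+3)%:R * j.+2%:R^-1 <= eta / 2 by rewrite mulrC -ler_pdivlMr ?ltr0n.
    have aux (L x' y' z : R) : x' <= z / 2 -> y' <= z / 2 -> L - z <= L - x' - y' by lra.
    by move=> h; exact: aux.
  have s_le m eta : 0 < m -> 0 < eta -> \forall n \near \oo,
      s n <= t * A w n * B w n + Num.sqrt gamma * spike_nu c / 2 +
      t ^+ 2 * spike_mu ctilde * (1 - A w n ^+ 2) / 2 + (m + (1 - B w n ^+ 2) / m) / 2 + eta.
    move=> m0 eta0; pose C := 2 + (Num.sqrt gamma + spike_nu c + m + m^-1) / 2.
    have C0 : 0 < C.
      by rewrite ltr_wpDr// divr_ge0// !addr_ge0 ?sqrtr_ge0 ?invr_ge0 ?(ltW m0).
    have [j hj] := small (eta / C) (divr_gt0 eta0 C0).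
    near=> n.
    have n0 : (0 < n)%N by near: n; exact: nbhs_infty_gt.
    have [x1 y1 _] := top_singular_vectors_max (hat_top n w n0).
    have pl : let e : R := j.+2%:R^-1 in
      peel [set z | z <= (e ^+ 2) ^+ 2] [set z | z <= (Num.sqrt gamma + e ^+ 2) ^+ 2]
      [set z | z <= (1 + e ^+ 2) ^+ 2] (minn (p n) n) (Gmx n w) (u n) (v n).
      by near: n; exact: wU.
    have j01 : 0 < (j.+2%:R^-1 : R) <= 1 by have /andP[-> /ltW] := inv01 j.
    have := spiked_upper gamma_ge0 t_gt0 c_def ctilde_def (fun=> uu n n0) (fun=> vv n n0)
      x1 y1 j01 m0 pl.
    move=> /le_trans; apply; rewrite lerD2l.
    by rewrite -ler_pdivlMr.
  have cB := overlap_sqr_cvg gamma_ge0 t_gt0 t_supercritical c_ge0 ctilde_ge0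
    c_def ctilde_def s_ge s_le.
  have cA := overlap_sqr_cvg' gamma_ge0 t_gt0 t_supercritical c_ge0 ctilde_ge0
    c_def ctilde_def B1 s_ge s_le.
  have cAB := overlap_prod_cvg gamma_ge0 t_gt0 t_supercritical c_ge0 ctilde_ge0
    c_def ctilde_def B1 s_ge s_le.
  have := rank2_norm_cvg (t := t) (q := q) cAB cA cB.
  apply: cvg_trans; apply: near_eq_cvg; near=> n.
  by rewrite lossE//; near: n; exact: nbhs_infty_gt.
have cvgL q : as_cvg P (loss q) (rank2_norm_limit t c ctilde q).
  by apply: filterS cvg_loss => w.
have LinfE q : Linf q = rank2_norm_limit t c ctilde q by exact: as_limE.
rewrite !LinfE; split => //.
  exact: rank2_norm_limit_ratio.
rewrite /rho -(rank2_norm_limit_ratio gamma_ge0 t_gt0 t_supercritical c_ge0 ctilde_ge0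
  c_def ctilde_def).
apply: filterS2 (cvgL qstar) (cvgL t) => w w1 w2.
apply: cvgM => //; apply: cvgV => //.
by rewrite gt_eqF// (rank2_norm_limit_t_gt0 gamma_ge0).
Unshelve. all: end_near. Qed.
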